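(* Let $\hat{\mathfrak g}$ be the universal central extension of $\mathfrak g=\mathfrak{psl}(2|2)$ and $J=M_{1,1}^+$. The category $J\text{-mod}_1^{\,0}$ is equivalent to the category of finite-dimensional representations of the polynomial ring $\mathbb C[x,y,t]$ with nilpotent action of $x,y,t$.
   Context: All spaces are over $\mathbb C$; modules over superalgebras are finite-dimensional and $\mathbb Z_2$-graded. $\mathfrak{psl}(2|2)$ is $\mathfrak{sl}(2|2)$ modulo scalar matrices; $E_{ij}$ are matrix units of $\mathfrak{gl}(2|2)$ (indices $1,2$ even, $3,4$ odd). The center $Z$ of $\hat{\mathfrak g}$ is 3-dimensional. The short $\mathfrak{sl}_2$-subalgebra of $\mathfrak g$ is spanned by $h=\frac12(E_{11}-E_{22}+E_{33}-E_{44})$ and suitable multiples $e,f$ of $E_{12}+E_{34}$, $E_{21}+E_{43}$ with $[e,f]=h$, $[h,e]=e$, $[h,f]=-f$; it lifts to $\hat{\mathfrak g}$. The $h$-eigenspaces give $\hat{\mathfrak g}=\hat{\mathfrak g}[-1]\oplus\hat{\mathfrak g}[0]\oplus\hat{\mathfrak g}[1]$ with $\hat{\mathfrak g}[\pm1]=\mathfrak g[\pm1]$, and $\mathfrak g[1]$ with product $x\cdot y=[[x,f],y]$ is the Jordan superalgebra $J\cong M_{1,1}^+$ (that is, $\operatorname{End}(\mathbb C^{1|1})$ with product $\frac12(ab+(-1)^{|a||b|}ba)$). $\hat{\mathfrak g}\text{-mod}_1$ is the category of finite-dimensional $\hat{\mathfrak g}$-modules on which $h$ has eigenvalues in $\{-1,0,1\}$;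 $\hat{\mathfrak g}\text{-mod}_1^{\,0}$ is the full subcategory of modules on which every $z\in Z$ acts nilpotently. $J\text{-mod}_1$ is the category of finite-dimensional unital Jordan $J$-bimodules (superspaces $M$ with $J$-action such that the null split extension $J\oplus M$ is a Jordan superalgebra, and the identity of $J$ acts as the identity). The functor $Jor$ sends $N\in\hat{\mathfrak g}\text{-mod}_1$ to its $h$-eigenspace $N[1]$ of eigenvalue $1$ with $x\cdot m=[x,f]m$, and $J\text{-mod}_1^{\,0}$ is the full subcategory of $J\text{-mod}_1$ of objects lying in the image of $\hat{\mathfrak g}\text{-mod}_1^{\,0}$ under $Jor$. *)

(* Defs.v *)
From HB Require Import structures.
From mathcomp Require Import all_boot all_order all_algebra ring_quotient.
From mathcomp Require Import generic_quotient ring.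
From mathcomp Require Import boolp reals complex.
From mathcomp Require Import mpoly.

Set Implicit Arguments.
Unset Strict Implicit.
Unset Printing Implicit Defensive.

Import GRing.Theory.
Local Open Scope ring_scope.
Local Open Scope quotient_scope.

Record category := Category {
  obj : Type;
  hom : obj -> obj -> Type;
  idm : forall X, hom X X;
  comp : forall X Y Z, hom Y Z -> hom X Y -> hom X Z;
  comp1m : forall X Y (f : hom X Y), comp (idm Y) f = f;
  compm1 : forall X Y (f : hom X Y), comp f (idm X) = f;
  compA : forall X Y Z T (f : hom Z T) (g : hom Y Z) (h : hom X Y),
    comp f (comp g h) = comp (comp f g) h }.
Arguments idm {c} X.
Arguments comp {c X Y Z} _ _.

Record functor (C D : category) := Functor {
  fobj :> obj C -> obj D;
  fmap : forall X Y, hom X Y -> hom (fobj X) (fobj Y);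
  fmap1 : forall X, fmap (idm X) = idm (fobj X);
  fmapM : forall X Y Z (f : hom Y Z) (g : hom X Y),
    fmap (comp f g) = comp (fmap f) (fmap g) }.
Arguments fmap {C D} _ {X Y} _.

Definition functor_id (C : category) : functor C C :=
  @Functor C C (fun X => X) (fun _ _ f => f)
    (fun _ => erefl) (fun _ _ _ _ _ => erefl).

Section FunctorComp.
Variables (C D E : category) (G : functor D E) (F : functor C D).

Lemma functor_comp1 X : fmap G (fmap F (idm X)) = idm (G (F X)).
Proof. by rewrite !fmap1. Qed.

Lemma functor_compM X Y Z (f : hom Y Z) (g : hom X Y) :
  fmap G (fmap F (comp f g)) = comp (fmap G (fmap F f)) (fmap G (fmap F g)).
Proof. by rewrite !fmapM. Qed.

Definition functor_comp : functor C E := Functor functor_comp1 functor_compM.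

End FunctorComp.

Definition nat_iso (C D : category) (F G : functor C D) :=
  exists (eta : forall X, hom (F X) (G X)) (eps : forall X, hom (G X) (F X)),
    [/\ forall X, comp (eps X) (eta X) = idm (F X),
        forall X, comp (eta X) (eps X) = idm (G X)
      & forall X Y (f : hom X Y), comp (eta Y) (fmap F f) = comp (fmap G f) (eta X)].

Definition equivalent (C D : category) :=
  exists (F : functor C D) (G : functor D C),
    nat_iso (functor_comp G F) (functor_id C) /\
    nat_iso (functor_comp F G) (functor_id D).

(* A category of sets with structure, whose morphisms are the functions       *)
(* satisfying [P].                                                            *)
Section ConcreteCategory.
Variables (O : Type) (car : O -> Type).
Variable P : forall X Y : O, (car X -> car Y) -> Prop.
Hypothesis P_id : forall X, @P X X id.
Hypothesis P_comp : forall X Y Z (g : car Y -> car Z) (f : car X -> car Y),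
  P g -> P f -> P (g \o f).

Let chom X Y := {f : car X -> car Y | P f}.
Let cid X : chom X X := exist _ id (P_id X).
Let ccomp X Y Z (g : chom Y Z) (f : chom X Y) : chom X Z :=
  exist _ (sval g \o sval f) (P_comp (svalP g) (svalP f)).

Let chom_eq X Y (f g : chom X Y) : sval f = sval g -> f = g.
Proof.
case: f g => [f hf] [g hg] /= fg; move: hf; rewrite fg => hf.
by congr exist; exact: Prop_irrelevance.
Qed.

Definition concrete_category : category.
Proof.
by refine (@Category O chom cid ccomp _ _ _) => *; apply: chom_eq.
Defined.

End ConcreteCategory.

Definition full_subcategory (C : category) (Q : obj C -> Prop) : category :=
  @Category {X : obj C | Q X} (fun X Y => hom (sval X) (sval Y))
    (fun X => idm (sval X)) (fun _ _ _ g f => comp g f)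
    (fun _ _ f => comp1m f) (fun _ _ f => compm1 f)
    (fun _ _ _ _ f g h => compA f g h).

(* A Z/2-grading is given by its homogeneous parts: [gr false] is the even    *)
(* part and [gr true] the odd one; degrees add up with [(+)] on [bool].       *)
Definition is_grading (K : fieldType) (V : lmodType K) (gr : bool -> V -> Prop) :=
  [/\ forall i, gr i 0,
      forall i a u v, gr i u -> gr i v -> gr i (a *: u + v),
      forall v, exists v0 v1, [/\ gr false v0, gr true v1 & v = v0 + v1]
    & forall v, gr false v -> gr true v -> v = 0].

Record superVect (K : fieldType) := SuperVect {
  sv_sort :> vectType K;
  sv_gr : bool -> sv_sort -> Prop;
  sv_grP : is_grading sv_gr }.

Definition bilinear_op (K : fieldType) (U V W : lmodType K) (m : U -> V -> W) :=
  (forall v, linear (m^~ v)) /\ (forall u, linear (m u)).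

Definition graded_op (U V W : Type) (gU : bool -> U -> Prop)
    (gV : bool -> V -> Prop) (gW : bool -> W -> Prop) (m : U -> V -> W) :=
  forall i j u v, gU i u -> gV j v -> gW (i (+) j) (m u v).

(* The Koszul sign (-1)^(ij). *)
Definition ksgn (K : fieldType) (i j : bool) : K := (-1) ^+ (i && j).
Arguments ksgn {K}.

Definition nilpotent_op (K : fieldType) (V : lmodType K) (f : V -> V) :=
  exists n, forall v, iter n f v = 0.

Definition is_lie_superalgebra (K : fieldType) (L : lmodType K)
    (gr : bool -> L -> Prop) (br : L -> L -> L) :=
  [/\ is_grading gr, bilinear_op br, graded_op gr gr gr br,
      forall i j x y, gr i x -> gr j y -> br x y = - (ksgn i j *: br y x)
    & forall i j x y z, gr i x -> gr j y ->
        br x (br y z) = br (br x y) z + ksgn i j *: br y (br x z)].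

Record lieSuperalgebra (K : fieldType) := LieSuperalgebra {
  lie_sort :> lmodType K;
  lie_gr : bool -> lie_sort -> Prop;
  lie_br : lie_sort -> lie_sort -> lie_sort;
  lieP : is_lie_superalgebra lie_gr lie_br }.

Definition is_lie_hom (K : fieldType) (L L' : lieSuperalgebra K) (f : L -> L') :=
  [/\ linear f, forall i x, lie_gr i x -> lie_gr i (f x)
    & forall x y, f (lie_br x y) = lie_br (f x) (f y)].

Definition lie_central (K : fieldType) (L : lieSuperalgebra K) (z : L) :=
  forall x, lie_br z x = 0.

Definition central_extension (K : fieldType) (U L : lieSuperalgebra K)
    (p : U -> L) :=
  [/\ is_lie_hom p, forall y, exists x, p x = y
    & forall z, p z = 0 -> lie_central z].

Definition universal_central_extension (K : fieldType)
    (U L : lieSuperalgebra K) (u : U -> L) :=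
  central_extension u /\
  forall (E : lieSuperalgebra K) (p : E -> L), central_extension p ->
    exists phi : U -> E,
      [/\ is_lie_hom phi, forall x, p (phi x) = u x
        & forall psi : U -> E, is_lie_hom psi -> (forall x, p (psi x) = u x) ->
            psi =1 phi].

Record lieModule (K : fieldType) (L : lieSuperalgebra K) := LieModule {
  lm_sort :> superVect K;
  lm_act : L -> lm_sort -> lm_sort;
  lm_bilin : bilinear_op lm_act;
  lm_graded : graded_op (@lie_gr K L) (@sv_gr K lm_sort) (@sv_gr K lm_sort) lm_act;
  lm_br : forall i j x y v, lie_gr i x -> lie_gr j y ->
    lm_act (lie_br x y) v =
      lm_act x (lm_act y v) - ksgn i j *: lm_act y (lm_act x v) }.

Section SuperMatrix.
Variables (K : fieldType) (n : nat) (p : 'I_n -> bool).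
Implicit Types A B C : 'M[K]_n.

Definition mxpart (b : bool) A : 'M[K]_n :=
  \matrix_(i, j) if p i (+) p j == b then A i j else 0.

Definition mxgr (b : bool) A : Prop := mxpart b A = A.

(* [stwist A B] is the bilinear extension of (-1)^(|A||B|) B A. *)
Definition stwist A B : 'M[K]_n :=
  \sum_(b : bool) \sum_(c : bool) ksgn b c *: (mxpart c B *m mxpart b A).

Definition sbracket A B : 'M[K]_n := A *m B - stwist A B.
Definition jordan_mul A B : 'M[K]_n := 2^-1 *: (A *m B + stwist A B).

Definition supertrace A : K := \sum_i ksgn (p i) (p i) * A i i.

Lemma mxpart_linear b : linear (mxpart b).
Proof.
move=> a A B; apply/matrixP => i j; rewrite !mxE.
by case: ifP => // _; rewrite mulr0 addr0.
Qed.

Lemma mxpart_sum A : A = mxpart false A + mxpart true A.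
Proof.
apply/matrixP => i j; rewrite !mxE.
by case: (p i (+) p j); rewrite /= ?add0r ?addr0.
Qed.

Lemma mxpart_gr b A : mxgr b (mxpart b A).
Proof. by apply/matrixP => i j; rewrite !mxE; case: (_ == b). Qed.

Lemma mxgr_part b c A : mxgr b A -> mxpart c A = if c == b then A else 0.
Proof.
move=> <-; apply/matrixP => i j.
by case: b c => [] []; rewrite !mxE /= ?mxE; case: (p i (+) p j).
Qed.

Lemma mxgr_grading : is_grading (mxgr : bool -> 'M[K]_n -> Prop).
Proof.
split=> [i|i a u v hu hv|v|v h0 h1].
- by apply/matrixP => j k; rewrite !mxE; case: (_ == i).
- by rewrite /mxgr mxpart_linear hu hv.
- exists (mxpart false v), (mxpart true v).
  by split; [exact: mxpart_gr|exact: mxpart_gr|exact: mxpart_sum].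
- by rewrite -h0 (mxgr_part _ h1).
Qed.

Lemma mxgr_mul b c A B : mxgr b A -> mxgr c B -> mxgr (b (+) c) (A *m B).
Proof.
move=> hA hB; apply/matrixP => i j; rewrite mxE.
case: ifP => // /negbT nbc; rewrite mxE big1 // => k _.
rewrite -hA -hB !mxE; case: ifP => [/eqP h1|_]; last by rewrite mul0r.
case: ifP => [/eqP h2|_]; last by rewrite mulr0.
by move: nbc; rewrite -h1 -h2; case: (p i) (p k) (p j) => [] [] [].
Qed.

Lemma stwistE b c A B : mxgr b A -> mxgr c B ->
  stwist A B = ksgn b c *: (B *m A).
Proof.
move=> hA hB; rewrite /stwist !big_bool /= !(mxgr_part _ hA) !(mxgr_part _ hB).
by case: b c {hA hB} => [] [] /=;
  rewrite ?(mulmx0, mul0mx, scaler0, addr0, add0r).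
Qed.

Lemma stwist_bilinear : bilinear_op (stwist : _ -> _ -> 'M[K]_n).
Proof.
split=> [B a A A'|A a B B'];
  rewrite /stwist scaler_sumr -big_split; apply: eq_bigr => b _ /=;
  rewrite scaler_sumr -big_split; apply: eq_bigr => c _ /=;
  rewrite mxpart_linear ?mulmxDr ?mulmxDl -?scalemxAr -?scalemxAl scalerDr;
  by rewrite !scalerA [_ * a]mulrC.
Qed.

Lemma sbracket_bilinear : bilinear_op (sbracket : _ -> _ -> 'M[K]_n).
Proof.
have [tl tr] := stwist_bilinear.
split=> [B a A A'|A a B B']; rewrite /sbracket.
  by rewrite (tl B) mulmxDl -scalemxAl scalerBr opprD addrACA.
by rewrite (tr A) mulmxDr -scalemxAr scalerBr opprD addrACA.
Qed.

Lemma sbracketE b c A B : mxgr b A -> mxgr c B ->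
  sbracket A B = A *m B - ksgn b c *: (B *m A).
Proof. by move=> hA hB; rewrite /sbracket (stwistE hA hB). Qed.

Lemma sbracket_gr : graded_op mxgr mxgr mxgr sbracket.
Proof.
move=> b c A B hA hB; rewrite (sbracketE hA hB).
have [_ lin _ _] := mxgr_grading.
rewrite addrC -scaleNr; apply: lin; last exact: mxgr_mul.
by rewrite addbC; exact: mxgr_mul.
Qed.

Lemma ksgnC b c : ksgn b c = ksgn c b :> K.
Proof. by rewrite /ksgn andbC. Qed.

Lemma ksgnK b c : ksgn b c * ksgn b c = 1 :> K.
Proof. by rewrite /ksgn -expr2 sqrr_sign. Qed.

Lemma ksgnDr b c d : ksgn b (c (+) d) = ksgn b c * ksgn b d :> K.
Proof. by case: b c d => [] [] []; rewrite /ksgn /= ?expr0 ?expr1; ring. Qed.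

Lemma sbracket_skew b c A B : mxgr b A -> mxgr c B ->
  sbracket A B = - (ksgn b c *: sbracket B A).
Proof.
move=> hA hB; rewrite (sbracketE hA hB) (sbracketE hB hA).
by rewrite scalerBr scalerA (ksgnC c b) ksgnK scale1r opprB.
Qed.

Lemma sbracket_jacobi b c A B C : mxgr b A -> mxgr c B ->
  sbracket A (sbracket B C) =
    sbracket (sbracket A B) C + ksgn b c *: sbracket B (sbracket A C).
Proof.
move=> hA hB.
have [bl br] := sbracket_bilinear.
have brD X Y Z : sbracket X (Y + Z) = sbracket X Y + sbracket X Z.
  by have := br X 1 Y Z; rewrite !scale1r.
suff J d D : mxgr d D -> sbracket A (sbracket B D) =
    sbracket (sbracket A B) D + ksgn b c *: sbracket B (sbracket A D).
  rewrite (mxpart_sum C) !(brD _ (mxpart false C)).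
  rewrite (brD A (sbracket B _)) (brD B (sbracket A _)).
  rewrite !(J _ _ (mxpart_gr _ C)).
  rewrite (scalerDr _ (sbracket B (sbracket A (mxpart false C)))).
  exact: addrACA.
move=> hD.
rewrite (sbracketE hA (sbracket_gr hB hD)) (sbracketE (sbracket_gr hA hB) hD).
rewrite (sbracketE hB (sbracket_gr hA hD)) (sbracketE hA hB) (sbracketE hB hD).
rewrite (sbracketE hA hD) ![ksgn (_ (+) _) _]ksgnC !ksgnDr.
rewrite (ksgnC d b) (ksgnC d c) (ksgnC c b).
move: (ksgnK b c); move: (ksgn b c) (ksgn b d) (ksgn c d) => s t u s2.
rewrite !(mulmxBl, mulmxBr) -?(scalemxAl, scalemxAr) !mulmxA.
move: (A *m B *m D) (A *m D *m B) (B *m A *m D) (B *m D *m A) (D *m A *m B)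
  (D *m B *m A) => X1 X2 X3 X4 X5 X6.
apply/matrixP => i j; rewrite !mxE.
have -> : s * (X3 i j - t * X4 i j - s * u * (X2 i j - t * X5 i j)) =
  s * X3 i j - s * t * X4 i j - (s * s) * u * (X2 i j - t * X5 i j) by ring.
rewrite s2; ring.
Qed.

Lemma sbracket_lie : is_lie_superalgebra mxgr sbracket.
Proof.
split; [exact: mxgr_grading|exact: sbracket_bilinear|exact: sbracket_gr| |].
- by move=> b c A B; exact: sbracket_skew.
- by move=> b c A B C; exact: sbracket_jacobi.
Qed.

Lemma stwist_entry A B i j :
  stwist A B i j =
    \sum_k ksgn (p i (+) p k) (p k (+) p j) * (B i k * A k j).
Proof.
rewrite /stwist !big_bool !mxE !mulr_sumr -!big_split; apply: eq_bigr => k _ /=.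
rewrite !mxE ksgnC.
by case: (p i (+) p k) (p k (+) p j) => [] [] /=; ring.
Qed.

Lemma supertrace_linear a A B :
  supertrace (a *: A + B) = a * supertrace A + supertrace B.
Proof.
rewrite /supertrace mulr_sumr -big_split; apply: eq_bigr => i _ /=.
rewrite !mxE; ring.
Qed.

Lemma supertrace_sbracket A B : supertrace (sbracket A B) = 0.
Proof.
have trM : supertrace (A *m B) =
    \sum_i \sum_k ksgn (p i) (p i) * (A i k * B k i).
  by apply: eq_bigr => i _; rewrite mxE mulr_sumr.
have trT : supertrace (stwist A B) =
    \sum_i \sum_k ksgn (p k) (p k) * (A k i * B i k).
  apply: eq_bigr => i _; rewrite stwist_entry mulr_sumr.
  apply: eq_bigr => k _; rewrite /ksgn.
  by case: (p i) (p k) => [] [] /=; ring.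
have -> : sbracket A B = (-1) *: stwist A B + A *m B.
  by rewrite scaleN1r addrC.
by rewrite supertrace_linear trM trT exchange_big mulN1r addNr.
Qed.

End SuperMatrix.

Section SpecialLinear.
Variables (K : fieldType) (n : nat) (p : 'I_n -> bool).

Definition sl_pred : {pred 'M[K]_n} := fun A => supertrace p A == 0.

Lemma sl_submod : submod_closed sl_pred.
Proof.
split=> [|a A B]; rewrite !unfold_in.
  by rewrite /supertrace big1 // => i _; rewrite mxE mulr0.
by move=> /eqP hA /eqP hB; rewrite supertrace_linear hA hB mulr0 addr0.
Qed.

HB.instance Definition _ := GRing.isSubmodClosed.Build K 'M[K]_n sl_pred sl_submod.

Record sl := SL { sl_val : 'M[K]_n; sl_valP : sl_val \in sl_pred }.

HB.instance Definition _ := [isSub for sl_val].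
HB.instance Definition _ := [Choice of sl by <:].
HB.instance Definition _ := [SubChoice_isSubLmodule of sl by <:].

Lemma sl_bracketP (x y : sl) : sbracket p (sl_val x) (sl_val y) \in sl_pred.
Proof. by rewrite unfold_in supertrace_sbracket. Qed.

Definition sl_bracket (x y : sl) : sl := SL (sl_bracketP x y).
Definition sl_gr (i : bool) (x : sl) : Prop := mxgr p i (sl_val x).

Definition sl_scalar : {pred sl} := fun x => is_scalar_mx (sl_val x).

Lemma sl_val_linear a x y : sl_val (a *: x + y) = a *: sl_val x + sl_val y.
Proof. by []. Qed.

Lemma sl_grading : is_grading sl_gr.
Proof.
have [h0 hlin hdec hdir] := @mxgr_grading K n p.
have strp b A : A \in sl_pred -> mxpart p b A \in sl_pred.
  rewrite !unfold_in => /eqP hA; apply/eqP; case: b.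
    by rewrite /supertrace big1 // => i _; rewrite mxE addbb mulr0.
  by rewrite -[RHS]hA; apply: eq_bigr => i _; rewrite mxE addbb.
split=> [i|i a x y hx hy|x|x hx0 hx1].
- exact: h0.
- exact: hlin.
- exists (SL (strp false _ (sl_valP x))), (SL (strp true _ (sl_valP x))).
  split; [exact: mxpart_gr|exact: mxpart_gr|].
  by apply: val_inj; exact: (mxpart_sum p (sl_val x)).
- by apply: val_inj; exact: hdir.
Qed.

Lemma sl_lie : is_lie_superalgebra sl_gr sl_bracket.
Proof.
have [bl br] := @sbracket_bilinear K n p.
split; first exact: sl_grading.
- by split=> [x a y z|x a y z]; apply: val_inj; [exact: bl|exact: br].
- by move=> i j x y hx hy; exact: sbracket_gr.
- by move=> i j x y hx hy; apply: val_inj; exact: sbracket_skew.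
- by move=> i j x y z hx hy; apply: val_inj; exact: sbracket_jacobi.
Qed.

Lemma sl_scalarP x : reflect (exists a, sl_val x = a%:M) (x \in sl_scalar).
Proof. exact: is_scalar_mxP. Qed.

Lemma sl_scalar_submod : submod_closed sl_scalar.
Proof.
split=> [|a x y /sl_scalarP[c hx] /sl_scalarP[d hy]]; apply/sl_scalarP.
  by exists 0; rewrite raddf0.
exists (a * c + d); rewrite sl_val_linear hx hy.
by rewrite raddfD /= scale_scalar_mx.
Qed.

HB.instance Definition _ :=
  GRing.isSubmodClosed.Build K sl sl_scalar sl_scalar_submod.

Definition psl := Quotient.quot sl_scalar.
HB.instance Definition _ := GRing.Zmodule.on psl.

Definition psl_class (x : sl) : psl := \pi_(Quotient.quot sl_scalar) x.

Lemma psl_classK (u : psl) : psl_class (repr u) = u.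
Proof. exact: reprK. Qed.

Lemma psl_class_eq x y : (psl_class x = psl_class y) <-> (x - y \in sl_scalar).
Proof. by rewrite Quotient.idealrBE; split=> [/eqP|/eqP]. Qed.

Lemma psl_classD x y : psl_class (x + y) = psl_class x + psl_class y.
Proof. exact: Quotient.pi_add. Qed.

Definition psl_scale (a : K) (u : psl) : psl := psl_class (a *: repr u).

Lemma psl_scale_class a x : psl_scale a (psl_class x) = psl_class (a *: x).
Proof.
apply/psl_class_eq; rewrite -scalerBr; apply: rpredZ.
by apply/psl_class_eq; exact: psl_classK.
Qed.

Lemma psl_scaleA a b u : psl_scale a (psl_scale b u) = psl_scale (a * b) u.
Proof. by rewrite -[u]psl_classK !psl_scale_class scalerA. Qed.

Lemma psl_scale1 : left_id 1 psl_scale.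
Proof. by move=> u; rewrite -[u in LHS]psl_classK psl_scale_class scale1r psl_classK. Qed.

Lemma psl_scaleDr : right_distributive psl_scale +%R.
Proof.
move=> a u v; rewrite -[u]psl_classK -[v]psl_classK -psl_classD.
by rewrite !psl_scale_class scalerDr psl_classD.
Qed.

Lemma psl_scaleDl u : {morph psl_scale^~ u : a b / a + b}.
Proof.
by move=> a b; rewrite -[u]psl_classK !psl_scale_class scalerDl psl_classD.
Qed.

HB.instance Definition _ := GRing.Zmodule_isLmodule.Build K psl
  psl_scaleA psl_scale1 psl_scaleDr psl_scaleDl.

Lemma psl_class_linear : linear psl_class.
Proof. by move=> a x y; rewrite psl_classD -psl_scale_class. Qed.

Definition psl_bracket (u v : psl) : psl :=
  psl_class (sl_bracket (repr u) (repr v)).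

Definition psl_gr (i : bool) (u : psl) : Prop :=
  exists2 x, sl_gr i x & psl_class x = u.

Lemma psl_bracket_class x y :
  psl_bracket (psl_class x) (psl_class y) = psl_class (sl_bracket x y).
Proof.
have [[bl br] _ _] : [/\ bilinear_op sl_bracket, True & True].
  by split=> //; case: sl_lie.
have bz z w : z \in sl_scalar -> sl_bracket z w = 0.
  move=> /sl_scalarP[c hz]; apply: val_inj => /=; rewrite hz.
  apply/matrixP => i j; rewrite !mxE stwist_entry.
  rewrite (bigD1 i) //= big1 ?addr0 => [|k nik]; last by rewrite !mxE eq_sym (negPf nik) mul0r.
  rewrite (bigD1 j) //= big1 ?addr0 => [|k nkj]; last first.
    by rewrite !mxE (negPf nkj) !mulr0.
  by rewrite !mxE !eqxx addbb /ksgn andbF expr0 !mulr1n; ring.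
have bz' z w : z \in sl_scalar -> sl_bracket w z = 0.
  move=> /sl_scalarP[c hz]; apply: val_inj => /=; rewrite hz.
  apply/matrixP => i j; rewrite !mxE stwist_entry.
  rewrite (bigD1 j) //= big1 ?addr0 => [|k nik]; last by rewrite !mxE (negPf nik) mulr0.
  rewrite (bigD1 i) //= big1 ?addr0 => [|k nkj]; last first.
    by rewrite !mxE eq_sym (negPf nkj) mul0r mulr0.
  by rewrite !mxE !eqxx addbb /ksgn /= expr0 !mulr1n; ring.
have rep z : repr (psl_class z) - z \in sl_scalar.
  by apply/psl_class_eq; exact: psl_classK.
rewrite /psl_bracket -{1}[repr (psl_class x)](subrK x) -{1}[repr (psl_class y)](subrK y).
have blD u v w : sl_bracket (u + v) w = sl_bracket u w + sl_bracket v w.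
  by have := bl w 1 u v; rewrite !scale1r.
have brD u v w : sl_bracket w (u + v) = sl_bracket w u + sl_bracket w v.
  by have := br w 1 u v; rewrite !scale1r.
by rewrite blD (bz _ _ (rep x)) add0r brD (bz' _ _ (rep y)) add0r.
Qed.

Lemma psl_grading : is_grading psl_gr.
Proof.
have [h0 hlin hdec hdir] := sl_grading.
split=> [i|i a _ _ [x hx <-] [y hy <-]|u|u [x hx <-] [y hy /esym]].
- exists 0; first exact: h0.
  by have := psl_classD 0 0; rewrite addr0 -[X in X = _]addr0 => /addrI.
- by exists (a *: x + y); [exact: hlin|rewrite psl_class_linear].
- have [v0 [v1 [g0 g1 def_u]]] := hdec (repr u).
  exists (psl_class v0), (psl_class v1).
  by split; [exists v0|exists v1|rewrite -psl_classD -def_u psl_classK].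
- move=> /psl_class_eq /sl_scalarP[c hc].
  have y0 : y = 0.
    apply: hdir hy; have -> : y = (-1) *: (x - y) + x.
      by rewrite scaleN1r opprB subrK.
    apply: hlin => //; rewrite /sl_gr hc; apply/matrixP => i j.
    by rewrite !mxE; case: (eqVneq i j) => [->|_]; rewrite ?addbb // mulr0n if_same.
  have <- : psl_class 0 = 0.
    by have := psl_classD 0 0; rewrite addr0 -[X in X = _]addr0 => /addrI.
  by apply/psl_class_eq/sl_scalarP; exists c; rewrite -hc y0.
Qed.

Lemma psl_lie : is_lie_superalgebra psl_gr psl_bracket.
Proof.
have [_ [bl br] bg bs bj] := sl_lie.
have lin := psl_class_linear.
split; first exact: psl_grading.
- split=> [w a u v|w a u v].
    rewrite -[w]psl_classK -[u]psl_classK -[v]psl_classK -lin.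
    by rewrite !psl_bracket_class bl lin.
  rewrite -[w]psl_classK -[u]psl_classK -[v]psl_classK -lin.
  by rewrite !psl_bracket_class br lin.
- move=> i j _ _ [x hx <-] [y hy <-]; rewrite psl_bracket_class.
  by exists (sl_bracket x y) => //; exact: bg.
- move=> i j _ _ [x hx <-] [y hy <-]; rewrite !psl_bracket_class (bs i j) //.
  by rewrite -!scaleNr -psl_scale_class.
- move=> i j _ _ w [x hx <-] [y hy <-]; rewrite -[w]psl_classK.
  by rewrite !psl_bracket_class (bj i j) // addrC lin addrC.
Qed.

Definition psl_lieSuperalgebra := LieSuperalgebra psl_lie.

End SpecialLinear.

Definition par22 (i : 'I_4) : bool := (2 <= i)%N.
Definition par11 (i : 'I_2) : bool := (1 <= i)%N.

Section Psl22.
Variable K : fieldType.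

Definition psl22 : lieSuperalgebra K := @psl_lieSuperalgebra K 4 par22.

(* Matrix units of gl(2|2), with the usual indices from 1 to 4. *)
Definition Emx (i j : nat) : 'M[K]_4 :=
  \matrix_(k, l) ((k.+1 == i) && (l.+1 == j))%:R.

(* M_{1,1} as g[1]: the entries of [a] go to rows 1, 3 and columns 2, 4.  The *)
(* multiples in e and f are those for which the product [[x, f], y] becomes   *)
(* the product of M_{1,1}^+ on the nose, with identity e: see psl_iota1 and   *)
(* psl_iotaM.                                                                 *)
Definition iota_mx (a : 'M[K]_2) : 'M[K]_4 :=
  a 0 0 *: Emx 1 2 + a 0 1 *: Emx 1 4 + a 1 0 *: Emx 3 2 + a 1 1 *: Emx 3 4.
Definition e_mx : 'M[K]_4 := Emx 1 2 + Emx 3 4.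
Definition f_mx : 'M[K]_4 := 2^-1 *: (Emx 2 1 + Emx 4 3).
Definition h_mx : 'M[K]_4 := 2^-1 *: (Emx 1 1 - Emx 2 2 + Emx 3 3 - Emx 4 4).

Local Ltac str_tac := rewrite unfold_in /supertrace !big_ord_recl big_ord0 !mxE /=;
  apply/eqP; rewrite /ksgn /=; ring.

Lemma iota_mxP a : iota_mx a \in sl_pred par22.
Proof. str_tac. Qed.
Lemma e_mxP : e_mx \in sl_pred par22.
Proof. str_tac. Qed.
Lemma f_mxP : f_mx \in sl_pred par22.
Proof. str_tac. Qed.
Lemma h_mxP : h_mx \in sl_pred par22.
Proof. str_tac. Qed.

Definition psl_iota a : psl22 := psl_class (SL (iota_mxP a)).
Definition psl_e : psl22 := psl_class (SL e_mxP).
Definition psl_f : psl22 := psl_class (SL f_mxP).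
Definition psl_h : psl22 := psl_class (SL h_mxP).

Lemma psl_iota1 : psl_iota 1%:M = psl_e.
Proof.
congr psl_class; apply: val_inj => /=.
apply/matrixP => i j; rewrite /iota_mx /e_mx !mxE /= !mulr1n !mulr0n; ring.
Qed.

Lemma sl_eq x y : sl_val x = sl_val y -> psl_class x = psl_class y :> psl22.
Proof. by move=> h; congr psl_class; apply: val_inj. Qed.

Lemma E_mul i j k l : (0 < j <= 4)%N ->
  Emx i j *m Emx k l = if j == k then Emx i l else 0.
Proof.
case/andP=> j0 j4; apply/matrixP => r c; rewrite mxE.
have jj : (j.-1 < 4)%N by rewrite prednK.
rewrite (bigD1 (Ordinal jj)) //= big1 ?addr0 => [|m nm]; last first.
  rewrite mxE; case: (m.+1 =P j) => [mj|_]; last by rewrite andbF mul0r.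
  by case/eqP: nm; apply: val_inj; rewrite /= -mj.
rewrite !mxE /= prednK // eqxx andbT.
by case: (j == k); rewrite !mxE /= ?mulr0 // -natrM mulnb.
Qed.

Lemma E_gr i j : mxgr par22 ((3 <= i)%N (+) (3 <= j)%N) (Emx i j).
Proof.
apply/matrixP => r c; rewrite !mxE /par22.
case: (r.+1 =P i) => [<-|_]; last by rewrite if_same.
case: (c.+1 =P j) => [<-|_]; last by rewrite andbF if_same.
by rewrite !ltnS eqxx.
Qed.

Lemma sbracket_E i j k l : (0 < j <= 4)%N -> (0 < l <= 4)%N ->
  sbracket par22 (Emx i j) (Emx k l) =
    (if j == k then Emx i l else 0) -
    ksgn ((3 <= i)%N (+) (3 <= j)%N) ((3 <= k)%N (+) (3 <= l)%N) *:
      (if l == i then Emx k j else 0).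
Proof. by move=> hj hl; rewrite (sbracketE (@E_gr _ _) (@E_gr _ _)) !E_mul. Qed.

Let sbr := sbracket par22 : 'M[K]_4 -> 'M[K]_4 -> 'M[K]_4.

Let sbrE i j k l : (0 < j <= 4)%N -> (0 < l <= 4)%N ->
  sbr (Emx i j) (Emx k l) =
    (if j == k then Emx i l else 0) -
    ksgn ((3 <= i)%N (+) (3 <= j)%N) ((3 <= k)%N (+) (3 <= l)%N) *:
      (if l == i then Emx k j else 0).
Proof. exact: sbracket_E. Qed.

Let sbrDl A B C : sbr (A + B) C = sbr A C + sbr B C.
Proof.
by have [h _] := @sbracket_bilinear K 4 par22; have := h C 1 A B; rewrite !scale1r.
Qed.

Let sbrZl a A C : sbr (a *: A) C = a *: sbr A C.
Proof.
have [h _] := @sbracket_bilinear K 4 par22.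
by apply: (addIr (sbr 0 C)); rewrite -[RHS]h addr0 -sbrDl addr0.
Qed.

Let sbrDr A B C : sbr C (A + B) = sbr C A + sbr C B.
Proof.
by have [_ h] := @sbracket_bilinear K 4 par22; have := h C 1 A B; rewrite !scale1r.
Qed.

Let sbrZr a A C : sbr C (a *: A) = a *: sbr C A.
Proof.
have [_ h] := @sbracket_bilinear K 4 par22.
by apply: (addIr (sbr C 0)); rewrite -[RHS]h addr0 -sbrDr addr0.
Qed.

Let sbrNl A C : sbr (- A) C = - sbr A C.
Proof. by rewrite -scaleN1r sbrZl scaleN1r. Qed.

Local Opaque sbracket.

Local Ltac sbr_tac :=
  rewrite ?(sbrDl, sbrDr, sbrZl, sbrZr, sbrNl) ?sbrE //= /ksgn /= ?expr0 ?expr1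
    ?(scaler0, subr0, sub0r, addr0, add0r);
  repeat match goal with |- context [Emx ?i ?j] => move: (Emx i j) => ? end;
  apply/matrixP => ? ?; rewrite !mxE.

Lemma psl_ef : (2 : K) != 0 -> lie_br psl_e psl_f = psl_h.
Proof.
move=> n2; rewrite /lie_br /= psl_bracket_class; apply: sl_eq.
rewrite /= -/(sbr _ _) /e_mx /f_mx /h_mx.
sbr_tac; ring.
Qed.

Lemma psl_he : (2 : K) != 0 -> lie_br psl_h psl_e = psl_e.
Proof.
move=> n2; rewrite /lie_br /= psl_bracket_class; apply: sl_eq.
rewrite /= -/(sbr _ _) /e_mx /h_mx.
by sbr_tac; field.
Qed.

Lemma psl_hf : (2 : K) != 0 -> lie_br psl_h psl_f = - psl_f.
Proof.
move=> n2; rewrite /lie_br /= psl_bracket_class.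
transitivity (psl_class (- SL f_mxP)); last first.
  rewrite -[X in psl_class X]scaleN1r.
  exact: (etrans (esym (psl_scale_class _ _)) (scaleN1r (psl_f : psl K par22))).
apply: sl_eq; rewrite /= -/(sbr _ _) /f_mx /h_mx.
by sbr_tac; field.
Qed.

Lemma psl_iotaM a b :
  lie_br (lie_br (psl_iota a) psl_f) (psl_iota b) =
  psl_iota (jordan_mul par11 a b).
Proof.
rewrite /lie_br /= [psl_bracket (psl_iota a) _]psl_bracket_class.
rewrite psl_bracket_class; apply: sl_eq.
change (sbr (sbr (iota_mx a) f_mx) (iota_mx b) = iota_mx (jordan_mul par11 a b)).
have -> : sbr (iota_mx a) f_mx =
    2^-1 *: (a 0 0 *: (Emx 1 1 - Emx 2 2) + a 0 1 *: (Emx 1 3 - Emx 2 4)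
             + a 1 0 *: (Emx 3 1 - Emx 4 2) + a 1 1 *: (Emx 3 3 - Emx 4 4)).
  by rewrite /iota_mx /f_mx; sbr_tac; ring.
rewrite /iota_mx /jordan_mul !mxE !stwist_entry !big_ord_recl !big_ord0 /=.
have -> : lift ord0 ord0 = 1 :> 'I_2 by apply: val_inj.
have -> : ord0 = 0 :> 'I_2 by apply: val_inj.
rewrite /ksgn /= !expr0 !expr1.
move: (a 0 0) (a 0 1) (a 1 0) (a 1 1) (b 0 0) (b 0 1) (b 1 0) (b 1 1).
move=> a0 a1 a2 a3 b0 b1 b2 b3.
by sbr_tac; ring.
Qed.

End Psl22.

Definition is_jordan_superalgebra (K : fieldType) (J : lmodType K)
    (gr : bool -> J -> Prop) (m : J -> J -> J) :=
  [/\ is_grading gr, bilinear_op m, graded_op gr gr gr m,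
      forall i j a b, gr i a -> gr j b -> m a b = ksgn i j *: m b a
    & forall i j k l a b c d, gr i a -> gr j b -> gr k c -> gr l d ->
        m (m a b) (m c d)
        + ksgn j k *: m (m a c) (m b d)
        + (ksgn j l * ksgn k l) *: m (m a d) (m b c)
        = m (m (m a b) c) d
          + (ksgn j k * ksgn j l * ksgn k l) *: m (m (m a d) c) b
          + (ksgn i j * ksgn i k * ksgn i l * ksgn k l) *: m (m (m b d) c) a].

Section JordanBimodules.
Variable K : fieldType.

(* The Jordan superalgebra M_{1,1}^+. *)
Local Notation J := 'M[K]_2.

Definition J_gr : bool -> J -> Prop := mxgr par11.
Definition J_mul : J -> J -> J := jordan_mul par11.

Section NullExtension.
Variables (M : superVect K) (l : J -> M -> M) (r : M -> J -> M).

Definition null_ext_gr (i : bool) (u : J * M) : Prop :=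
  J_gr i u.1 /\ sv_gr i u.2.
Definition null_ext_mul (u v : J * M) : J * M :=
  (J_mul u.1 v.1, l u.1 v.2 + r u.2 v.1).

End NullExtension.

Record jordanBimodule := JordanBimodule {
  jb_sort :> superVect K;
  jb_l : J -> jb_sort -> jb_sort;
  jb_r : jb_sort -> J -> jb_sort;
  jb_l_bilin : bilinear_op jb_l;
  jb_r_bilin : bilinear_op jb_r;
  jb_jordan :
    is_jordan_superalgebra (@null_ext_gr jb_sort) (null_ext_mul jb_l jb_r);
  jb_unital : forall m, jb_l 1%:M m = m /\ jb_r m 1%:M = m }.

(* Homogeneous homomorphisms, of degree [d]. *)
Definition jb_hom_deg (d : bool) (M N : jordanBimodule) (f : M -> N) :=
  [/\ linear f, forall i m, sv_gr i m -> sv_gr (i (+) d) (f m),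
      forall i a m, J_gr i a -> f (jb_l a m) = ksgn d i *: jb_l a (f m)
    & forall m a, f (jb_r m a) = jb_r (f m) a].

(* Sums of an even and an odd homomorphism. *)
Definition jb_hom (M N : jordanBimodule) (f : M -> N) :=
  exists f0 f1, [/\ jb_hom_deg false f0, jb_hom_deg true f1
                  & forall m, f m = f0 m + f1 m].

Lemma jb_hom_deg_id M : @jb_hom_deg false M M id.
Proof.
split=> // [i m|i a m _]; first by rewrite addbF.
by rewrite /ksgn expr0 scale1r.
Qed.

Lemma jb_hom_deg_comp d d' (M N P : jordanBimodule) (g : N -> P) (f : M -> N) :
  jb_hom_deg d g -> jb_hom_deg d' f -> jb_hom_deg (d' (+) d) (g \o f).
Proof.
move=> [gl gd gL gR] [fl fd fL fR]; split=> /=.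
- by move=> a u v /=; rewrite fl gl.
- by move=> i m /fd/gd; rewrite addbA.
- move=> i a m ha; rewrite (fL i) //.
  have gZ c v : g (c *: v) = c *: g v.
    have g0 : g 0 = 0 by have := gl (-1) 0 0; rewrite scaler0 addr0 scaleN1r addNr.
    by have := gl c v 0; rewrite g0 !addr0.
  by rewrite gZ (gL i) // scalerA ![ksgn _ i]ksgnC -ksgnDr.
- by move=> m a; rewrite fR gR.
Qed.

Lemma jb_hom_deg_add d (M N : jordanBimodule) (f g h : M -> N) :
  jb_hom_deg d f -> jb_hom_deg d g -> (forall m, h m = f m + g m) ->
  jb_hom_deg d h.
Proof.
move=> [fl fd fL fR] [gl gd gL gR] hE; split.
- by move=> a u v; rewrite !hE fl gl scalerDr addrACA.
- move=> i m hm; rewrite hE -[f m]scale1r.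
  by case: (sv_grP N) => _ lin _ _; apply: lin; [exact: fd|exact: gd].
- move=> i a m ha; rewrite !hE (fL i) // (gL i) // -scalerDr; congr (_ *: _).
  by have [_ nl] := jb_l_bilin N; have := nl a 1 (f m) (g m); rewrite !scale1r.
- move=> m a; rewrite !hE fR gR.
  by have [nr _] := jb_r_bilin N; have := nr a 1 (f m) (g m); rewrite !scale1r.
Qed.

Lemma jb_hom_id M : @jb_hom M M id.
Proof.
exists id, (fun=> 0); split; [exact: jb_hom_deg_id| |by move=> m; rewrite addr0].
have [_ nl] := jb_l_bilin M; have [nr _] := jb_r_bilin M.
split=> [a u v|i m _|i a m _|m a].
- by rewrite scaler0 addr0.
- by case: (sv_grP M).
- by have := nl a (-1) 0 0; rewrite scaler0 addr0 scaleN1r addNr => ->; rewrite scaler0.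
- by have := nr a (-1) 0 0; rewrite scaler0 addr0 scaleN1r addNr => ->.
Qed.

Lemma jb_hom_comp (M N P : jordanBimodule) (g : N -> P) (f : M -> N) :
  jb_hom g -> jb_hom f -> jb_hom (g \o f).
Proof.
move=> [g0 [g1 [hg0 hg1 gE]]] [f0 [f1 [hf0 hf1 fE]]].
exists (fun m => g0 (f0 m) + g1 (f1 m)), (fun m => g0 (f1 m) + g1 (f0 m)); split.
- exact: (jb_hom_deg_add (jb_hom_deg_comp hg0 hf0) (jb_hom_deg_comp hg1 hf1)).
- exact: (jb_hom_deg_add (jb_hom_deg_comp hg0 hf1) (jb_hom_deg_comp hg1 hf0)).
move=> m; rewrite /= gE fE.
have [l0 _ _ _] := hg0; have [l1 _ _ _] := hg1.
have := l0 1 (f0 m) (f1 m); have := l1 1 (f0 m) (f1 m).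
by rewrite !scale1r => -> ->; rewrite [g1 _ + _]addrC addrACA.
Qed.

Definition Jmod1_even : category :=
  concrete_category jb_hom_deg_id (@jb_hom_deg_comp false false).

Definition Jmod1 : category := concrete_category jb_hom_id jb_hom_comp.

End JordanBimodules.

Section Jor.
Variables (K : fieldType) (ghat : lieSuperalgebra K) (pi : ghat -> psl22 K).
Variables e f h : ghat.

(* [e], [f], [h] is the lift of the short sl_2 of psl(2|2) to [ghat]. *)
Definition sl2_lift : Prop :=
  [/\ pi e = psl_e K, pi f = psl_f K & pi h = psl_h K] /\
  [/\ lie_br e f = h, lie_br h e = e & lie_br h f = - f].

Definition ghat_mod1 (N : lieModule ghat) : Prop :=
  forall (c : K) (v : N), v != 0 -> lm_act h v = c *: v ->
    [\/ c = -1, c = 0 | c = 1].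

Definition ghat_mod1_0 (N : lieModule ghat) : Prop :=
  ghat_mod1 N /\ forall z, lie_central z -> nilpotent_op (@lm_act K ghat N z).

(* [M] is isomorphic to [Jor N]: [phi] identifies [M] with the eigenspace     *)
(* [N[1]], where [a] acts by [x, f], [x] being the element of [ghat[1]] above *)
(* [a] in [g[1] = J].  The right action is then determined by                 *)
(* supercommutativity.                                                        *)
Definition is_Jor (N : lieModule ghat) (M : jordanBimodule K) : Prop :=
  exists phi : M -> N,
    [/\ linear phi, forall i m, sv_gr i m -> sv_gr i (phi m), injective phi,
        forall v, lm_act h v = v <-> exists m, v = phi m
      & forall a x m, lie_br h x = x -> pi x = psl_iota a ->
          phi (jb_l a m) = lm_act (lie_br x f) (phi m)].

Definition in_image_Jor0 (M : jordanBimodule K) : Prop :=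
  exists2 N : lieModule ghat, ghat_mod1_0 N & is_Jor N M.

(* Morphisms: the even ones only, respectively all of them.  J and its parity *)
(* shift are isomorphic for the second convention only.                       *)
Definition Jmod1_0_even : category :=
  @full_subcategory (Jmod1_even K) in_image_Jor0.
Definition Jmod1_0 : category :=
  @full_subcategory (Jmod1 K) in_image_Jor0.

End Jor.

Section PolyRep.
Variable K : fieldType.
Local Notation A := {mpoly K[3]}.

Definition is_polyrep (V : lmodType K) (act : A -> V -> V) :=
  [/\ bilinear_op act, forall v, act 1 v = v
    & forall p q v, act (p * q) v = act p (act q v)].

Record polyRep := PolyRep {
  pr_sort :> vectType K;
  pr_act : A -> pr_sort -> pr_sort;
  pr_actP : is_polyrep pr_act }.

(* Here the polynomial ring is purely even. *)
Record superPolyRep := SuperPolyRep {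
  spr_sort :> superVect K;
  spr_act : A -> spr_sort -> spr_sort;
  spr_actP : is_polyrep spr_act;
  spr_even : forall i p v, sv_gr i v -> sv_gr i (spr_act p v) }.

Definition pr_hom (V W : polyRep) (f : V -> W) :=
  linear f /\ forall p v, f (pr_act p v) = pr_act p (f v).

Definition spr_hom (V W : superPolyRep) (f : V -> W) :=
  [/\ linear f, forall i v, sv_gr i v -> sv_gr i (f v)
    & forall p v, f (spr_act p v) = spr_act p (f v)].

Lemma pr_hom_id V : @pr_hom V V id.
Proof. by []. Qed.

Lemma pr_hom_comp (V W X : polyRep) (g : W -> X) (f : V -> W) :
  pr_hom g -> pr_hom f -> pr_hom (g \o f).
Proof.
move=> [gl gp] [fl fp]; split=> [a u v|p v] /=; first by rewrite fl gl.
by rewrite fp gp.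
Qed.

Lemma spr_hom_id V : @spr_hom V V id.
Proof. by []. Qed.

Lemma spr_hom_comp (V W X : superPolyRep) (g : W -> X) (f : V -> W) :
  spr_hom g -> spr_hom f -> spr_hom (g \o f).
Proof.
move=> [gl gd gp] [fl fd fp]; split=> [a u v|i v /fd/gd //|p v] /=.
  by rewrite fl gl.
by rewrite fp gp.
Qed.

Definition polyRep_nilp : category :=
  @full_subcategory (concrete_category pr_hom_id pr_hom_comp)
    (fun V : polyRep => forall i : 'I_3, nilpotent_op (@pr_act V 'X_i)).

Definition superPolyRep_nilp : category :=
  @full_subcategory (concrete_category spr_hom_id spr_hom_comp)
    (fun V : superPolyRep => forall i : 'I_3, nilpotent_op (@spr_act V 'X_i)).

End PolyRep.

(* Main.v *)
(** An object M of J-mod_1 is determined by its Peirce component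
    V = {m | (e11 - e22) m = m}.  With A, B the left actions of the odd matrix
    units E12, E21, the even operators x = A^2, y = B^2, t = AB + BA commute
    with J and preserve V.  If [alpha], [beta] in [ghat] are the elements
    [x, f] through which E12, E21 act on N[1], then [alpha, alpha],
    [beta, beta] and [alpha, beta] vanish in psl(2|2), hence are central, hence
    nilpotent on N: so x, y, t are nilpotent.

    Conversely, the products of v, A v, B v, AB v (v in V) are forced by the
    Jordan identity and define a Jordan bimodule on V^4 for every
    representation V of K[x,y,t].  When x, y, t are nilpotent every M is
    obtained in this way from its V (a Nakayama argument gives surjectivity
    of V^4 -> M), and homogeneous maps of V extend uniquely.

    It remains to produce the bimodule V^4 from a module over [ghat].  The
    polarized determinants of the two odd blocks are 2-cocycles of sl(2|2) and
    define a central extension E of psl(2|2), to which [ghat] maps by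
    universality.  A deformation, with coefficients in V, of the adjoint action
    on the 17-dimensional algebra of derivations of psl(2|2) is an E-module on
    the subspace of V^17 given by one linear constraint; its eigenspace for
    h = 1 is V^4.

    Identities in a K[x,y,t]-module V are checked by [ring] in the trivial
    extension K[x,y,t] + V. *)

From HB Require Import structures.
Require Import Defs.
From mathcomp Require Import all_boot all_order all_algebra.
From mathcomp Require Import reals complex.
From mathcomp Require Import ssrcomplements.
From mathcomp Require Import boolp ring mpoly.
Import Defs.

Set Implicit Arguments.
Unset Strict Implicit.
Unset Printing Implicit Defensive.

Import GRing.Theory.
Local Open Scope ring_scope.

(** Put s = T/2 + 1/4 and s' = T/2 - 1/4. The bijectivity of V^4 -> M rests on the determinant XY -
    s s', for injectivity as well as for surjectivity. Its constant term is 1/16, so it is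
    invertible once x, y, t are nilpotent.

    The algebra [ghat] is never described explicitly. Universality gives one map [ghat] -> E over
    psl(2|2). Lifts of elements are known up to the centre and brackets do not see the centre, so
    the brackets that matter are computed with 2 x 2 blocks in E.

    The constraint on V^17 repairs the bracket relation of two odd elements: without it the relation
    holds up to multiples of x d4 - y d2 - 2 t d1.

    One construction on objects serves both equivalences. As x, y, t have degree two in A and B,
    Koszul signs cancel, and an odd homomorphism restricts to a K[x,y,t]-linear map of V just as an
    even one does. So even homomorphisms match the graded maps of super representations, and sums of
    even and odd ones match all K[x,y,t]-linear maps. *)

Lemma equivalent_ff (C D : category) (F : functor C D) :
  (forall X Y (f g : hom X Y), fmap F f = fmap F g -> f = g) ->
  (forall X Y (g : hom (F X) (F Y)), exists f, fmap F f = g) ->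
  (forall Y : obj D, exists X (u : hom (F X) Y) (v : hom Y (F X)),
     comp u v = idm Y /\ comp v u = idm (F X)) ->
  equivalent C D.
Proof.
move=> faith full surj.
pose ch T (P : T -> Prop) (h : exists x, P x) : {x | P x} := cid h.
pose G0 Y := sval (ch _ _ (surj Y)).
pose u Y : hom (F (G0 Y)) Y := sval (ch _ _ (svalP (ch _ _ (surj Y)))).
pose v Y : hom Y (F (G0 Y)) :=
  sval (ch _ _ (svalP (ch _ _ (svalP (ch _ _ (surj Y)))))).
have [uv vu] : (forall Y, comp (u Y) (v Y) = idm Y) /\
    (forall Y, comp (v Y) (u Y) = idm (F (G0 Y))).
  by split=> Y; case: (svalP (ch _ _ (svalP (ch _ _ (svalP (ch _ _ (surj Y))))))).
clearbody u v; clearbody G0.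
pose lift X Y (g : hom (F X) (F Y)) := sval (ch _ _ (full X Y g)).
have liftK X Y (g : hom (F X) (F Y)) : fmap F (lift X Y g) = g.
  exact: (svalP (ch _ _ (full X Y g))).
clearbody lift.
(* The quasi-inverse on morphisms: conjugate by the chosen isomorphisms, then lift by fullness. Its
   functoriality is checked after applying [F], by faithfulness. *)
pose G1 Y Z (f : hom Y Z) := lift _ _ (comp (v Z) (comp f (u Y))).
have G1_1 Y : G1 Y Y (idm Y) = idm (G0 Y).
  by apply: faith; rewrite liftK fmap1 comp1m vu.
have G1_M X Y Z (f : hom Y Z) (g : hom X Y) :
    G1 X Z (comp f g) = comp (G1 Y Z f) (G1 X Y g).
  apply: faith; rewrite fmapM !liftK -!compA; congr comp.
  by rewrite !compA -[comp (comp f (u Y)) (v Y)]compA uv compm1.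
pose G : functor D C := @Functor D C G0 G1 G1_1 G1_M.
exists F, G; split; last first.
  exists u, v; split=> // Y Z f /=; rewrite liftK !compA uv comp1m //.
exists (fun X => lift (G0 (F X)) X (u (F X))), (fun X => lift X (G0 (F X)) (v (F X))).
split=> [X|X|X Y f] /=; apply: faith; rewrite !fmapM ?liftK ?fmap1 //.
by rewrite !compA uv comp1m.
Qed.

(** * Parity components in a graded space *)

Section Grading.
Variables (K : fieldType) (V : lmodType K) (gr : bool -> V -> Prop).
Hypothesis grP : is_grading gr.

Lemma gr0 i : gr i 0. Proof. by case: grP. Qed.

Lemma grZD i a u v : gr i u -> gr i v -> gr i (a *: u + v).
Proof. by case: grP => _ h _ _; exact: h. Qed.

Lemma grD i u v : gr i u -> gr i v -> gr i (u + v).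
Proof. by move=> hu hv; rewrite -[u]scale1r; exact: grZD. Qed.

Lemma grZ i a u : gr i u -> gr i (a *: u).
Proof. by move=> hu; rewrite -[X in gr i X]addr0; apply: grZD => //; exact: gr0. Qed.

Lemma grN i u : gr i u -> gr i (- u).
Proof. by rewrite -scaleN1r; exact: grZ. Qed.

Lemma gr_eq0 i u : gr i u -> gr (~~ i) u -> u = 0.
Proof. by case: grP => _ _ _ h; case: i => ? ?; exact: h. Qed.

Lemma gr_part v : exists w : bool -> V, (forall i, gr i (w i)) /\ v = w false + w true.
Proof.
case: grP => _ _ h _; have [v0 [v1 [h0 h1 ->]]] := h v.
by exists (fun b => if b then v1 else v0); split=> // -[].
Qed.

(** A grading only asserts that components exist, so they are picked by choice; [grpart_uniq] makes
    the choice immaterial. *)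
Definition grpart (i : bool) (v : V) : V := sval (cid (gr_part v)) i.

Lemma grpart_gr i v : gr i (grpart i v).
Proof. by case: (svalP (cid (gr_part v))). Qed.

Lemma grpart_sum v : v = grpart false v + grpart true v.
Proof. by case: (svalP (cid (gr_part v))). Qed.

Lemma grpart_uniq w0 w1 v : gr false w0 -> gr true w1 -> v = w0 + w1 ->
  grpart false v = w0 /\ grpart true v = w1.
Proof.
move=> h0 h1 hv.
have e : grpart false v - w0 = w1 - grpart true v.
  by apply/eqP; rewrite subr_eq addrAC eq_sym subr_eq -grpart_sum hv addrC.
have z : grpart false v - w0 = 0.
  apply: (@gr_eq0 false); first by apply: grD; [exact: grpart_gr|exact: grN].
  by rewrite e; apply: grD => //; apply: grN; exact: grpart_gr.
by split; apply/eqP; [rewrite -subr_eq0 z|rewrite eq_sym -subr_eq0 -e z].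
Qed.

Lemma grpart_id i j v : gr i v -> grpart j v = if j == i then v else 0.
Proof.
case: i => hv.
  have [h0 h1] := grpart_uniq (gr0 false) hv (esym (add0r v)).
  by case: j.
have [h0 h1] := grpart_uniq hv (gr0 true) (esym (addr0 v)).
by case: j.
Qed.

Lemma grpart_linear i : linear (grpart i).
Proof.
move=> a u v.
have h j : gr j (a *: grpart j u + grpart j v) by apply: grZD; exact: grpart_gr.
have [] := grpart_uniq (v := a *: u + v) (h false) (h true).
  by rewrite {1}(grpart_sum u) {1}(grpart_sum v) scalerDr addrACA.
by case: i.
Qed.

End Grading.

Lemma gr_ind (K : fieldType) (V : lmodType K) (gr : bool -> V -> Prop)
    (P : V -> Prop) : is_grading gr ->
  (forall u v, P u -> P v -> P (u + v)) -> (forall i v, gr i v -> P v) ->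
  forall v, P v.
Proof.
by move=> grP PD Pgr v; rewrite (grpart_sum grP v); apply: PD;
   apply: Pgr; exact: grpart_gr.
Qed.

(** * Commuting operators as an action of a polynomial ring *)

Section PolyAction.
Variables (K : fieldType) (n : nat) (V : lmodType K) (h : 'I_n -> V -> V).
Hypothesis h_linear : forall i, linear (h i).
Hypothesis hC : forall i j v, h i (h j v) = h j (h i v).
Local Notation A := {mpoly K[n]}.

Definition monact (m : 'X_{1..n}) (v : V) : V :=
  foldr (fun i => iter (m i) (h i)) v (enum 'I_n).

Definition polyact (p : A) (v : V) : V := \sum_(m <- msupp p) p@_m *: monact m v.

Let iter_linear i k : linear (iter k (h i)).
Proof. by elim: k => [|k IH] a u v //=; rewrite IH h_linear. Qed.

Let foldr_linear (m : 'X_{1..n}) s :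
  linear (fun v => foldr (fun i => iter (m i) (h i)) v s).
Proof. by elim: s => [|i s IH] a u v //=; rewrite IH iter_linear. Qed.

Let h_iter i j k v : h i (iter k (h j) v) = iter k (h j) (h i v).
Proof. by elim: k => //= k IH; rewrite hC IH. Qed.

Let iter_iter i j k l v :
  iter l (h i) (iter k (h j) v) = iter k (h j) (iter l (h i) v).
Proof. by elim: l => //= l ->; rewrite h_iter. Qed.

Lemma monact_linear m : linear (monact m).
Proof. exact: foldr_linear. Qed.

(** Commutativity of the operators [h i] enters here: [monact] applies them in the fixed order of
    [enum 'I_n], so the powers from [m2] must be moved past those from [m1]. *)
Lemma monactD m1 m2 v : monact (m1 + m2)%MM v = monact m1 (monact m2 v).
Proof.
rewrite /monact; elim: (enum _) => //= i s ->.
rewrite mnmDE iterD; congr iter.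
elim: s {v}(foldr _ v s) => //= j s IH v.
by rewrite iter_iter IH.
Qed.

Lemma monact0 v : monact 0%MM v = v.
Proof. by rewrite /monact; elim: (enum _) => //= i s ->; rewrite mnm0E. Qed.

Lemma monactU i v : monact U_(i)%MM v = h i v.
Proof.
rewrite /monact; have := mem_enum 'I_n i; have := enum_uniq 'I_n.
have id_off s : i \notin s -> foldr (fun j => iter (U_(i)%MM j) (h j)) v s = v.
  elim: s => //= j s IH; rewrite inE negb_or => /andP[ij /IH ->].
  by rewrite mnm1E (negPf ij).
elim: (enum _) => //= j s IH /andP[js us]; rewrite inE => /orP[/eqP ij|si].
  by rewrite -ij mnm1E eqxx /= id_off // ij.
rewrite mnm1E IH //; case: (eqVneq i j) => // ij.
by move: js; rewrite -ij si.
Qed.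

(** Two polynomials have different supports; summing over all monomials below a common degree bound
    makes additivity in the polynomial a termwise statement. *)
Lemma polyactE d p v : (msize p <= d)%N ->
  polyact p v = \sum_(m : 'X_{1..n < d}) p@_m *: monact m v.
Proof.
move=> le_pd; rewrite /polyact (big_mksub 'X_{1..n < d}) ?msupp_uniq //=; last first.
  by move=> x /msize_mdeg_lt /leq_trans; apply.
by rewrite big_rmcond //= => m /memN_msupp_eq0 ->; rewrite scale0r.
Qed.

Let polyactZD a p q v : polyact (a *: p + q) v = a *: polyact p v + polyact q v.
Proof.
pose d := maxn (msize (a *: p + q)) (maxn (msize p) (msize q)).
rewrite !(@polyactE d) ?leq_max ?leqnn ?orbT //.
rewrite scaler_sumr -big_split; apply: eq_bigr => m _ /=.
by rewrite mcoeffD mcoeffZ scalerDl scalerA.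
Qed.

Lemma polyactX m v : polyact 'X_[m] v = monact m v.
Proof. by rewrite /polyact msuppX big_seq1 mcoeffX eqxx scale1r. Qed.

Lemma polyactXi i v : polyact 'X_i v = h i v.
Proof. by rewrite polyactX monactU. Qed.

Let polyact_linear p : linear (polyact p).
Proof.
move=> a u v; rewrite scaler_sumr -big_split; apply: eq_bigr => m _ /=.
by rewrite monact_linear scalerDr !scalerA mulrC.
Qed.

Lemma mpoly_linear_ind (P : A -> Prop) : P 0 ->
  (forall a p q, P p -> P q -> P (a *: p + q)) -> (forall m, P 'X_[m]) ->
  forall p, P p.
Proof.
move=> P0 PD PX p; rewrite (mpolyE p); elim: (msupp p) => [|m s IH].
  by rewrite big_nil.
by rewrite big_cons; apply: PD.
Qed.

Lemma polyactP : [/\ bilinear_op polyact, forall v, polyact 1 v = v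
  & forall p q v, polyact (p * q) v = polyact p (polyact q v)].
Proof.
split; first by split=> [v a p q|]; [exact: polyactZD|exact: polyact_linear].
  by move=> v; rewrite -mpolyX0 polyactX monact0.
have z0 q : polyact 0 q = 0 by rewrite /polyact msupp0 big_nil.
move=> p q v; elim/mpoly_linear_ind: p => [|a p p' Hp Hp'|m].
- by rewrite mul0r !z0.
- by rewrite mulrDl -scalerAl !polyactZD Hp Hp'.
elim/mpoly_linear_ind: q => [|a q q' Hq Hq'|m'].
- rewrite mulr0 !z0; have := polyact_linear 'X_[m] (-1) 0 0.
  by rewrite scaler0 addr0 scaleN1r addNr.
- by rewrite mulrDr -scalerAr !polyactZD Hq Hq' polyact_linear.
by rewrite -mpolyXD !polyactX monactD.
Qed.

End PolyAction.

(** * The square-zero extension of K[x,y,t] by a module *)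

Section TrivialExtension.
Variables (K : fieldType) (V : polyRep K).
Local Notation A := {mpoly K[3]}.

Definition trivext : Type := (A * V)%type.
HB.instance Definition _ := GRing.Zmodule.on trivext.

Local Notation act := (@pr_act K V).

Lemma actD p u v : act p (u + v) = act p u + act p v.
Proof. by case: (pr_actP V) => -[_ h] _ _; have := h p 1 u v; rewrite !scale1r. Qed.
Lemma actDp p q v : act (p + q) v = act p v + act q v.
Proof. by case: (pr_actP V) => -[h _] _ _; have := h v 1 p q; rewrite !scale1r. Qed.
Lemma act0 p : act p 0 = 0.
Proof. by apply: (addrI (act p 0)); rewrite -actD !addr0. Qed.
Lemma act0p v : act 0 v = 0.
Proof. by apply: (addrI (act 0 v)); rewrite -actDp !addr0. Qed.
Lemma actZ p a v : act p (a *: v) = a *: act p v.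
Proof.
case: (pr_actP V) => -[_ h] _ _.
by have := h p a v 0; rewrite act0 !addr0.
Qed.
Lemma actZp p a v : act (a *: p) v = a *: act p v.
Proof.
case: (pr_actP V) => -[h _] _ _.
by have := h v a p 0; rewrite act0p !addr0.
Qed.
Lemma act1 v : act 1 v = v. Proof. by case: (pr_actP V). Qed.
Lemma actM p q v : act (p * q) v = act p (act q v).
Proof. by case: (pr_actP V). Qed.
Lemma actC p q v : act p (act q v) = act q (act p v).
Proof. by rewrite -!actM mulrC. Qed.
Definition te_one : trivext := (1, 0).
Definition te_mul (a b : trivext) : trivext :=
  (a.1 * b.1, act a.1 b.2 + act b.1 a.2).

Lemma te_mulA : associative te_mul.
Proof.
move=> [p u] [q v] [r w]; congr pair; rewrite /= ?mulrA //.
by rewrite !actD !actM (actC r p) (actC r q) addrA.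
Qed.
Lemma te_mulC : commutative te_mul.
Proof. by move=> [p u] [q v]; congr pair; rewrite /= 1?mulrC // addrC. Qed.
Lemma te_mul1 : left_id te_one te_mul.
Proof. by move=> [p u]; congr pair; rewrite /= ?mul1r // act1 act0 addr0. Qed.
Lemma te_mulD : left_distributive te_mul +%R.
Proof.
move=> [p u] [q v] [r w]; congr pair; rewrite /= ?mulrDl //.
by rewrite actDp actD addrACA.
Qed.
Lemma te_neq0 : te_one != 0.
Proof. by apply/eqP => h; have /eqP := congr1 fst h; rewrite oner_eq0. Qed.

HB.instance Definition _ := GRing.Zmodule_isComNzRing.Build trivext
  te_mulA te_mulC te_mul1 te_mulD te_neq0.

Definition te_in (v : V) : trivext := (0, v).
Definition te_poly (p : A) : trivext := (p, 0).
(** Scalars become ring elements too, but the inverses among them stay opaque to [ring]; hence the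
    relations such as [te_cst 4^-1 * 4 = 1] that are supplied by hand later. *)
Definition te_cst (c : K) : trivext := te_poly c%:MP.

Lemma te_inI : injective te_in. Proof. by move=> u v []. Qed.
Lemma te_in0 : te_in 0 = 0. Proof. by []. Qed.
Lemma te_inD u v : te_in (u + v) = te_in u + te_in v.
Proof. by congr pair; rewrite /= addr0. Qed.
Lemma te_inN v : te_in (- v) = - te_in v.
Proof. by congr pair; rewrite /= oppr0. Qed.
Lemma te_inact p v : te_in (act p v) = te_poly p * te_in v.
Proof. by congr pair; rewrite /= ?mulr0 // act0p addr0. Qed.
Lemma te_inZ c v : te_in (c *: v) = te_cst c * te_in v.
Proof.
rewrite -te_inact; congr te_in.
by rewrite -[c%:MP]mulr1 mul_mpolyC actZp act1.
Qed.

Let te_poly_zmod : zmod_morphism te_poly.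
Proof. by move=> p q; congr pair; rewrite /= subr0. Qed.
Let te_poly_mon : monoid_morphism te_poly.
Proof. by split=> // p q; congr pair; rewrite /= !act0 addr0. Qed.
HB.instance Definition _ := GRing.isZmodMorphism.Build A trivext te_poly te_poly_zmod.
HB.instance Definition _ := GRing.isMonoidMorphism.Build A trivext te_poly te_poly_mon.
HB.instance Definition _ :=  GRing.RMorphism.copy te_cst (te_poly \o (@mpolyC 3 K)).

Definition te_inE := (te_inD, te_inN, te_inact, te_inZ, te_in0).
End TrivialExtension.

(** * The Jordan superalgebra and relations in its bimodules *)

Section LinearFacts.
Variables (K : fieldType) (U V : lmodType K) (f : U -> V).
Hypothesis fL : linear f.
Lemma linD u v : f (u + v) = f u + f v.
Proof. by have := fL 1 u v; rewrite !scale1r. Qed.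
Lemma lin0 : f 0 = 0.
Proof. by apply: (addrI (f 0)); rewrite -linD !addr0. Qed.
Lemma linZ a u : f (a *: u) = a *: f u.
Proof. by have := fL a u 0; rewrite lin0 !addr0. Qed.
Lemma linN u : f (- u) = - f u.
Proof. by rewrite -scaleN1r linZ scaleN1r. Qed.
Lemma linB u v : f (u - v) = f u - f v.
Proof. by rewrite linD linN. Qed.
End LinearFacts.

Section JElements.
Variable K : fieldType.
Definition ju : 'M[K]_2 := delta_mx 0 0 - delta_mx 1 1.
Definition ja : 'M[K]_2 := delta_mx 0 1.
Definition jb : 'M[K]_2 := delta_mx 1 0.

Lemma ord2E (i : 'I_2) : i = 0 \/ i = 1.
Proof. by case: i => -[|[|//]] h; [left|right]; apply: val_inj. Qed.

Lemma J_decomp (x : 'M[K]_2) : (2 : K) != 0 ->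
  x = (2^-1 * (x 0 0 + x 1 1)) *: 1%:M + (2^-1 * (x 0 0 - x 1 1)) *: ju
      + x 0 1 *: ja + x 1 0 *: jb.
Proof.
move=> n2; apply/matrixP => i j.
by case: (ord2E i) => ->; case: (ord2E j) => ->; rewrite !mxE /= ?mulr1n ?mulr0n; field.
Qed.

Lemma J_mulE (x y : 'M[K]_2) i j : J_mul x y i j =
  2^-1 * \sum_k (x i k * y k j + ksgn (par11 i (+) par11 k) (par11 k (+) par11 j) * (y i k * x k j)).
Proof. by rewrite !mxE stwist_entry -big_split. Qed.

Lemma J_mulC00 (x y : 'M[K]_2) : J_mul x y 0 0 =
  2^-1 * (2 * x 0 0 * y 0 0 + x 0 1 * y 1 0 - y 0 1 * x 1 0).
Proof.
rewrite J_mulE !big_ord_recl big_ord0 (_ : lift ord0 ord0 = 1); last exact: val_inj.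
rewrite (_ : ord0 = 0); last exact: val_inj.
by rewrite /ksgn /par11 /= expr0 expr1; ring.
Qed.
Lemma J_mulC01 (x y : 'M[K]_2) : J_mul x y 0 1 =
  2^-1 * ((x 0 0 + x 1 1) * y 0 1 + (y 0 0 + y 1 1) * x 0 1).
Proof.
rewrite J_mulE !big_ord_recl big_ord0 (_ : lift ord0 ord0 = 1); last exact: val_inj.
rewrite (_ : ord0 = 0); last exact: val_inj.
by rewrite /ksgn /par11 /= expr0; ring.
Qed.
Lemma J_mulC10 (x y : 'M[K]_2) : J_mul x y 1 0 =
  2^-1 * ((x 0 0 + x 1 1) * y 1 0 + (y 0 0 + y 1 1) * x 1 0).
Proof.
rewrite J_mulE !big_ord_recl big_ord0 (_ : lift ord0 ord0 = 1); last exact: val_inj.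
rewrite (_ : ord0 = 0); last exact: val_inj.
by rewrite /ksgn /par11 /= expr0; ring.
Qed.
Lemma J_mulC11 (x y : 'M[K]_2) : J_mul x y 1 1 =
  2^-1 * (2 * x 1 1 * y 1 1 + x 1 0 * y 0 1 - y 1 0 * x 0 1).
Proof.
rewrite J_mulE !big_ord_recl big_ord0 (_ : lift ord0 ord0 = 1); last exact: val_inj.
rewrite (_ : ord0 = 0); last exact: val_inj.
by rewrite /ksgn /par11 /= expr0 expr1; ring.
Qed.

Lemma J_eq (x y : 'M[K]_2) : x 0 0 = y 0 0 -> x 0 1 = y 0 1 ->
  x 1 0 = y 1 0 -> x 1 1 = y 1 1 -> x = y.
Proof.
move=> h1 h2 h3 h4; apply/matrixP => i j.
by case: (ord2E i) => ->; case: (ord2E j) => ->.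
Qed.

Ltac jtac := move=> n2; apply: J_eq;
  rewrite ?(J_mulC00, J_mulC01, J_mulC10, J_mulC11) !mxE /= ?mulr1n ?mulr0n; field.

Lemma ju_ju : (2 : K) != 0 -> J_mul ju ju = 1%:M. Proof. by jtac. Qed.
Lemma ju_ja : (2 : K) != 0 -> J_mul ju ja = 0. Proof. by jtac. Qed.
Lemma ju_jb : (2 : K) != 0 -> J_mul ju jb = 0. Proof. by jtac. Qed.
Lemma ja_ju : (2 : K) != 0 -> J_mul ja ju = 0. Proof. by jtac. Qed.
Lemma jb_ju : (2 : K) != 0 -> J_mul jb ju = 0. Proof. by jtac. Qed.
Lemma ja_ja : (2 : K) != 0 -> J_mul ja ja = 0. Proof. by jtac. Qed.
Lemma jb_jb : (2 : K) != 0 -> J_mul jb jb = 0. Proof. by jtac. Qed.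
Lemma ja_jb : (2 : K) != 0 -> J_mul ja jb = 2^-1 *: ju. Proof. by jtac. Qed.
Lemma jb_ja : (2 : K) != 0 -> J_mul jb ja = - (2^-1 *: ju). Proof. by jtac. Qed.
Lemma J_1mul (x : 'M[K]_2) : (2 : K) != 0 -> J_mul 1%:M x = x. Proof. by jtac. Qed.
Lemma J_mul0 (x : 'M[K]_2) : (2 : K) != 0 -> J_mul 0 x = 0. Proof. by jtac. Qed.
Lemma J_mull_linear (y : 'M[K]_2) : linear (fun x => J_mul x y).
Proof.
move=> a u v; rewrite /J_mul /jordan_mul (proj1 (@stwist_bilinear K 2 par11) y).
rewrite mulmxDl -scalemxAl addrACA -[a *: _ + a *: _]scalerDr [LHS]scalerDr.
by rewrite !scalerA mulrC.
Qed.

Lemma J_mulx0 (x : 'M[K]_2) : (2 : K) != 0 -> J_mul x 0 = 0. Proof. by jtac. Qed.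

Lemma J_Zmul a (x y : 'M[K]_2) : J_mul (a *: x) y = a *: J_mul x y.
Proof. exact: linZ (J_mull_linear y) a x. Qed.
Lemma J_Nmul (x y : 'M[K]_2) : J_mul (- x) y = - J_mul x y.
Proof. exact: linN (J_mull_linear y) x. Qed.

Lemma J_gr_ju : J_gr false ju.
Proof. by apply: J_eq; rewrite !mxE /= ?subr0. Qed.
Lemma J_gr_ja : J_gr true ja.
Proof. by apply: J_eq; rewrite !mxE. Qed.
Lemma J_gr_jb : J_gr true jb.
Proof. by apply: J_eq; rewrite !mxE. Qed.
Lemma J_gr_1 : J_gr false (1%:M : 'M[K]_2).
Proof. by apply: J_eq; rewrite !mxE. Qed.
End JElements.

Lemma J_mul_gr (K : fieldType) i j (x y : 'M[K]_2) :
  J_gr i x -> J_gr j y -> J_gr (i (+) j) (J_mul x y).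
Proof.
move=> hx hy; rewrite /J_gr /J_mul /jordan_mul (stwistE hx hy).
have gP := @mxgr_grading K 2 par11.
apply: (grZ gP); apply: (grD gP); first exact: mxgr_mul.
by apply: (grZ gP); rewrite addbC; exact: mxgr_mul.
Qed.

Section BimoduleRelations.
Local Opaque J_mul ju ja jb.
Variables (K : fieldType) (M : jordanBimodule K).
Hypothesis n2 : (2 : K) != 0.
Local Notation l := (@jb_l K M).
Local Notation r := (@jb_r K M).

Lemma jb_lL a : linear (l a). Proof. by case: (jb_l_bilin M). Qed.
Lemma jb_lLl m : linear (l^~ m). Proof. by case: (jb_l_bilin M) => h _; exact: h. Qed.
Lemma jb_rL m : linear (r m). Proof. by case: (jb_r_bilin M). Qed.
Lemma jb_rLl a : linear (r^~ a). Proof. by case: (jb_r_bilin M) => h _; exact: h. Qed.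

Lemma jb_lx0 a : l a 0 = 0. Proof. exact: lin0 (jb_lL a). Qed.
Lemma jb_l0x m : l 0 m = 0. Proof. exact: lin0 (jb_lLl m). Qed.
Lemma jb_rx0 m : r m 0 = 0. Proof. exact: lin0 (jb_rL m). Qed.
Lemma jb_r0x a : r 0 a = 0. Proof. exact: lin0 (jb_rLl a). Qed.
Lemma jb_lD a u v : l a (u + v) = l a u + l a v. Proof. exact: linD (jb_lL a) u v. Qed.
Lemma jb_rZ a c v : r (c *: v) a = c *: r v a. Proof. exact: linZ (jb_rLl a) c v. Qed.

Let gr_J i a : J_gr i a -> null_ext_gr i (a, 0 : M).
Proof. by move=> ha; split=> //=; exact: gr0 (sv_grP M) _. Qed.

Let gr_M i m : sv_gr i m -> null_ext_gr i (0 : 'M[K]_2, m : M).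
Proof.
by move=> hm; split=> //=; apply: gr0; exact: mxgr_grading.
Qed.

Lemma jb_l_gr i j a m : J_gr i a -> sv_gr j m -> sv_gr (i (+) j) (l a m).
Proof.
move=> ha hm; case: (jb_jordan M) => _ _ gg _ _.
have [_] := gg i j _ _ (gr_J ha) (gr_M hm).
by rewrite /null_ext_mul /= jb_r0x addr0.
Qed.

Lemma jb_rE i j a m : sv_gr i m -> J_gr j a -> r m a = ksgn i j *: l a m.
Proof.
move=> hm ha; case: (jb_jordan M) => _ _ _ sc _.
have := congr1 snd (sc _ _ _ _ (gr_M hm) (gr_J ha)); rewrite /null_ext_mul /=.
by rewrite jb_lx0 add0r jb_rx0 addr0.
Qed.

Let nJJ x y : null_ext_mul l r (x, 0) (y, 0) = (J_mul x y, 0).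
Proof. by congr pair; rewrite /= jb_lx0 jb_r0x addr0. Qed.
Let nJM x m : null_ext_mul l r (x, 0) (0, m) = (0, l x m).
Proof. by congr pair; rewrite /= ?J_mulx0 // jb_r0x addr0. Qed.
Let nMJ m x : null_ext_mul l r (0, m) (x, 0) = (0, r m x).
Proof. by congr pair; rewrite /= ?J_mul0 // jb_l0x add0r. Qed.

(** Supercommutativity turns the right multiplications into left ones in the Jordan identity with
    last entry m. All signs that involve the degree of m then cancel, so the result extends to
    inhomogeneous m. *)
Lemma jb_identity i j k a b c m : J_gr i a -> J_gr j b -> J_gr k c ->
  l (J_mul a b) (l c m) + ksgn j k *: l (J_mul a c) (l b m)
    + (ksgn i j * ksgn i k) *: l (J_mul b c) (l a m)
  = l (J_mul (J_mul a b) c) m + (ksgn i j * ksgn i k) *: l b (l c (l a m))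
    + ksgn j k *: l a (l c (l b m)).
Proof.
move=> ha hb hc; move: m; apply: (gr_ind (sv_grP M)) => [u v|d m hm].
  rewrite !jb_lD !scalerDr => eu ev.
  have add3 (x1 x2 x3 y1 y2 y3 : M) :
      x1 + y1 + (x2 + y2) + (x3 + y3) = x1 + x2 + x3 + (y1 + y2 + y3).
    by rewrite [RHS]addrACA [x1 + x2 + _]addrACA.
  by rewrite !add3 eu ev.
case: (jb_jordan M) => _ _ _ _ jid.
have {jid} := jid i j k d _ _ _ _ (gr_J ha) (gr_J hb) (gr_J hc) (gr_M hm).
rewrite (nJJ a b) (nJJ a c) (nJM c m).
rewrite  (nJM b m).
rewrite  (nJM a m).
rewrite (nJJ b c). rewrite (nJJ (J_mul a b) c).
rewrite !nJM.
rewrite !nMJ.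
move/(congr1 snd) => /=.
rewrite (jb_rE (jb_l_gr ha hm) (J_mul_gr hb hc)).
rewrite (jb_rE (jb_l_gr ha hm) hc) (jb_rE (jb_l_gr hb hm) hc).
rewrite !jb_rZ.
rewrite (jb_rE (jb_l_gr hc (jb_l_gr ha hm)) hb) (jb_rE (jb_l_gr hc (jb_l_gr hb hm)) ha).
rewrite !scalerA => e; apply: etrans (etrans e _); last first.
  congr (_ + _ *: _ + _ *: _);
  by case: i j k d {ha hb hc hm e} => [] [] [] []; rewrite /ksgn /= ?expr0 ?expr1; ring.
congr (_ + _ + _ *: _);
  by case: i j k d {ha hb hc hm e} => [] [] [] []; rewrite /ksgn /= ?expr0 ?expr1; ring.
Qed.

Definition opH := l (ju K).
Definition opA := l (ja K).
Definition opB := l (jb K).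
Lemma opHL : linear opH. Proof. exact: jb_lL. Qed.
Lemma opAL : linear opA. Proof. exact: jb_lL. Qed.
Lemma opBL : linear opB. Proof. exact: jb_lL. Qed.

Lemma jb_l1 m : l 1%:M m = m. Proof. by case: (jb_unital m). Qed.

Local Notation H := opH.
Local Notation A := opA.
Local Notation B := opB.

Let simp := (ju_ju n2, ju_ja n2, ju_jb n2, ja_ju n2, jb_ju n2, ja_ja n2, jb_jb n2,
  ja_jb n2, jb_ja n2, fun x => @J_1mul K x n2, fun x => @J_mul0 K x n2, @J_Zmul K, @J_Nmul K).
Let l0 m : l 0 m = 0. Proof. exact: lin0 (jb_lLl m). Qed.
Let lZ a x m : l (a *: x) m = a *: l x m. Proof. exact: linZ (jb_lLl m) _ _. Qed.
Let lN x m : l (- x) m = - l x m. Proof. exact: linN (jb_lLl m) _. Qed.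
Let sgE := (lN, lZ, l0, jb_l1, @scaler0 K M, @addr0 M, @add0r M, @scale1r K M,
  @scaleN1r K M, @mulr1 K, @mul1r K, @mulrN K, @mulNr K, @opprK K, @opprK M, @oppr0 M).

Let cancel2 (u v : M) : u + u = v + v -> u = v.
Proof.
move/(congr1 (fun x => 2^-1 *: x)); rewrite -!mulr2n -!scaler_nat !scalerA.
by rewrite mulVf // !scale1r.
Qed.

(** The identity at ([ju], [ju], [ju]) reads 3 H = H + 2 H^3. It is the Peirce decomposition: the
    eigenvalues of H are 1, 0 and -1. *)
Lemma rel_HHH m : H (H (H m)) = H m.
Proof.
have := jb_identity m (@J_gr_ju K) (@J_gr_ju K) (@J_gr_ju K).
rewrite !simp /ksgn /= ?expr0 !sgE -/H => e.
by apply: cancel2; apply: (addrI (H m)); rewrite !addrA e.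
Qed.

(** Together with [rel_AHH] this says that A exchanges the 0-eigenspace of H with the sum of the
    eigenspaces for 1 and -1; likewise for B below. *)
Lemma rel_HAH m : H (A (H m)) = 0.
Proof.
have := jb_identity m (@J_gr_ju K) (@J_gr_ju K) (@J_gr_ja K).
rewrite !simp /ksgn /= ?expr0 !sgE -/H -/A => e.
by apply: cancel2; apply: (addrI (A m)); rewrite !addrA -e !addr0.
Qed.

Lemma rel_HBH m : H (B (H m)) = 0.
Proof.
have := jb_identity m (@J_gr_ju K) (@J_gr_ju K) (@J_gr_jb K).
rewrite !simp /ksgn /= ?expr0 !sgE -/H -/A => e.
by apply: cancel2; apply: (addrI (B m)); rewrite !addrA -e !addr0.
Qed.

Lemma rel_AHH m : A m = A (H (H m)) + H (H (A m)).
Proof.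
have := jb_identity m (@J_gr_ju K) (@J_gr_ja K) (@J_gr_ju K).
by rewrite !simp /ksgn /= ?expr0 !sgE.
Qed.

Lemma rel_BHH m : B m = B (H (H m)) + H (H (B m)).
Proof.
have := jb_identity m (@J_gr_ju K) (@J_gr_jb K) (@J_gr_ju K).
by rewrite !simp /ksgn /= ?expr0 !sgE.
Qed.

Lemma rel_AAH m : A (A (H m)) = H (A (A m)).
Proof.
have := jb_identity m (@J_gr_ju K) (@J_gr_ja K) (@J_gr_ja K).
rewrite !simp /ksgn /= ?expr0 ?expr1 !sgE => /esym/eqP.
by rewrite subr_eq0 => /eqP.
Qed.

Lemma rel_BBH m : B (B (H m)) = H (B (B m)).
Proof.
have := jb_identity m (@J_gr_ju K) (@J_gr_jb K) (@J_gr_jb K).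
rewrite !simp /ksgn /= ?expr0 ?expr1 !sgE => /esym/eqP.
by rewrite subr_eq0 => /eqP.
Qed.

Lemma rel_AAB m : A (A (B m)) = B (A (A m)).
Proof.
have := jb_identity m (@J_gr_ja K) (@J_gr_jb K) (@J_gr_ja K).
rewrite !simp /ksgn /= ?expr0 ?expr1 !sgE subrr => /esym/eqP.
by rewrite subr_eq0 => /eqP.
Qed.

Lemma rel_BBA m : B (B (A m)) = A (B (B m)).
Proof.
have := jb_identity m (@J_gr_jb K) (@J_gr_ja K) (@J_gr_jb K).
rewrite !simp /ksgn /= ?expr0 ?expr1 !sgE addNr => /esym/eqP.
by rewrite subr_eq0 => /eqP.
Qed.

(** The inhomogeneous terms come from the product of [ja] and [jb], which is half of [ju]. The
    quarters of the later constructions originate in this and the next two relations. *)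
Lemma rel_AHB m : A (H (B m)) - B (H (A m)) = 2^-1 *: H (H m) - 2^-1 *: m.
Proof.
have := jb_identity m (@J_gr_ja K) (@J_gr_jb K) (@J_gr_ju K).
rewrite !simp /ksgn /= ?expr0 ?expr1 !sgE => ->.
by rewrite addrAC [_ - _ - _]addrAC subrr sub0r addrC.
Qed.

Lemma rel_ABH m : A (B (H m)) - H (B (A m)) = 2^-1 *: H (H m).
Proof.
have := jb_identity m (@J_gr_ju K) (@J_gr_ja K) (@J_gr_jb K).
by rewrite !simp /ksgn /= ?expr0 ?expr1 !sgE.
Qed.

Lemma rel_BAH m : H (A (B m)) - B (A (H m)) = 2^-1 *: H (H m).
Proof.
have := jb_identity m (@J_gr_ju K) (@J_gr_jb K) (@J_gr_ja K).
rewrite !simp /ksgn /= ?expr0 ?expr1 !sgE => /(congr1 -%R).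
by rewrite opprK opprB => ->.
Qed.

End BimoduleRelations.

(** * The Peirce component as a representation of K[x,y,t] *)

Section KernelSubspace.
Variables (K : fieldType) (U V : vectType K) (f : U -> V).
Hypothesis fL : linear f.

Lemma kersp_exists : exists W : {vspace U}, forall u, (u \in W) = (f u == 0).
Proof.
pose g : {linear U -> V} := HB.pack f (GRing.isLinear.Build K U V *:%R f fL).
by exists (lker (linfun g)) => u; rewrite memv_ker lfunE.
Qed.

Definition kersp := sval (cid kersp_exists).
Lemma mem_kersp u : (u \in kersp) = (f u == 0).
Proof. exact: (svalP (cid kersp_exists)). Qed.
End KernelSubspace.

Section SubGrading.
Variables (K : fieldType) (V : superVect K) (U : {vspace V}).
Hypothesis U_gr : forall i v, v \in U -> grpart (sv_grP V) i v \in U.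

Definition subgr (i : bool) (u : subvs_of U) := sv_gr i (vsval u).

Lemma subgrP : is_grading subgr.
Proof.
pose grP := sv_grP V.
split=> [i|i a u v hu hv|u|u h0 h1].
- by rewrite /subgr linear0; exact: gr0.
- by rewrite /subgr linearP; exact: grZD.
- exists (vsproj U (grpart grP false (vsval u))), (vsproj U (grpart grP true (vsval u))).
  have hK i : vsval (vsproj U (grpart grP i (vsval u))) = grpart grP i (vsval u).
    by rewrite vsprojK // U_gr // subvsP.
  rewrite /subgr !hK.
  split; [exact: grpart_gr|exact: grpart_gr|].
  apply: val_inj; apply: etrans (esym (linearD vsval _ _)).
  by rewrite /= !hK -(grpart_sum grP).
- apply: val_inj; apply: etrans (esym (linear0 (vsval : subvs_of U -> V))).
  exact: (gr_eq0 grP h0 h1).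
Qed.

Definition subSuperVect := SuperVect subgrP.
End SubGrading.

Section PolyactMorph.
Variables (K : fieldType) (n : nat) (V W : lmodType K).
Variables (h : 'I_n -> V -> V) (h' : 'I_n -> W -> W) (f : V -> W).
Hypothesis fL : linear f.
Hypothesis fh : forall i v, f (h i v) = h' i (f v).

Lemma polyact_morph p v : f (polyact h p v) = polyact h' p (f v).
Proof.
rewrite /polyact; elim: (msupp p) => [|m s IH]; first by rewrite !big_nil (lin0 fL).
rewrite !big_cons fL IH; congr (_ *: _ + _); rewrite /monact.
elim: (enum _) => //= i t <-; elim: (m i) => //= k <-; exact: fh.
Qed.
End PolyactMorph.

Lemma polyact_gr (K : fieldType) n (V : lmodType K) (gr : bool -> V -> Prop)
    (h : 'I_n -> V -> V) i p v : is_grading gr ->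
  (forall j u, gr i u -> gr i (h j u)) -> gr i v -> gr i (polyact h p v).
Proof.
move=> grP hg hv; rewrite /polyact; elim: (msupp p) => [|m s IH].
  by rewrite big_nil; exact: gr0.
rewrite big_cons; apply: grZD => //; rewrite /monact.
by elim: (enum _) => //= j t; elim: (m j) => //= k H /H; exact: hg.
Qed.

Section PeircePart.
Variables (K : fieldType) (n2 : (2 : K) != 0) (M : jordanBimodule K).
Local Notation H := (@opH K M).
Local Notation A := (@opA K M).
Local Notation B := (@opB K M).

Definition opT (m : M) : M := A (B m) + B (A m).

Lemma opT_linear : linear opT.
Proof. by move=> a u v; rewrite /opT !(opAL, opBL) scalerDr addrACA. Qed.

Lemma opHsub_linear : linear (fun m => H m - m).
Proof. by move=> a u v; rewrite opHL scalerBr opprD addrACA. Qed.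

Definition peirce11 : {vspace M} := kersp opHsub_linear.

Lemma mem_peirce11 m : (m \in peirce11) = (H m == m).
Proof. by rewrite mem_kersp subr_eq0. Qed.

Lemma opT_A m : opT (A m) = A (opT m).
Proof. by rewrite /opT (linD (@opAL K M)) (rel_AAB n2) addrC. Qed.

Lemma opT_B m : opT (B m) = B (opT m).
Proof. by rewrite /opT (linD (@opBL K M)) (rel_BBA n2) addrC. Qed.

(** Comparing [rel_ABH] with [rel_BAH] eliminates the common term H^2/2. *)
Lemma opT_H m : opT (H m) = H (opT m).
Proof.
have e1 := rel_ABH n2 m; have e2 := rel_BAH n2 m.
rewrite /opT (linD (@opHL K M)) -[A (B (H m))](subrK (H (B (A m)))) e1 -e2.
by rewrite addrAC subrK.
Qed.

Lemma opT_gr i m : sv_gr i m -> sv_gr i (opT m).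
Proof.
move=> hm; apply: (grD (sv_grP M)).
  have := jb_l_gr (J_gr_ja K) (jb_l_gr (J_gr_jb K) hm).
  by rewrite addbA addbb.
have := jb_l_gr (J_gr_jb K) (jb_l_gr (J_gr_ja K) hm).
by rewrite addbA addbb.
Qed.

Lemma opAA_gr i m : sv_gr i m -> sv_gr i (A (A m)).
Proof.
move=> hm; have := jb_l_gr (J_gr_ja K) (jb_l_gr (J_gr_ja K) hm).
by rewrite addbA addbb.
Qed.

Lemma opBB_gr i m : sv_gr i m -> sv_gr i (B (B m)).
Proof.
move=> hm; have := jb_l_gr (J_gr_jb K) (jb_l_gr (J_gr_jb K) hm).
by rewrite addbA addbb.
Qed.

Lemma opH_gr i m : sv_gr i m -> sv_gr i (H m).
Proof. exact: jb_l_gr (J_gr_ju K). Qed.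

Lemma peirce11_gr i m : m \in peirce11 -> grpart (sv_grP M) i m \in peirce11.
Proof.
rewrite !mem_peirce11 => /eqP hm.
have e : m = H (grpart (sv_grP M) false m) + H (grpart (sv_grP M) true m).
  by rewrite -(linD (@opHL K M)) -(grpart_sum (sv_grP M)).
have hg k := opH_gr (grpart_gr (sv_grP M) k m).
have [h0 h1] := grpart_uniq (sv_grP M) (hg false) (hg true) e.
by case: i; apply/eqP; rewrite [in RHS](h0, h1).
Qed.

Definition opX (i : 'I_3) (m : M) : M :=
  if i == 0 then A (A m) else if i == 1 then B (B m) else opT m.

Lemma opX_linear i : linear (opX i).
Proof.
move=> a u v; rewrite /opX; case: ifP => _; first by rewrite !opAL.
by case: ifP => _; [rewrite !opBL|rewrite opT_linear].
Qed.

Lemma opX_gr i d m : sv_gr d m -> sv_gr d (opX i m).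
Proof.
rewrite /opX; case: ifP => _; first exact: opAA_gr.
by case: ifP => _; [exact: opBB_gr|exact: opT_gr].
Qed.

Lemma opX_A i m : opX i (A m) = A (opX i m).
Proof.
rewrite /opX; case: ifP => _ //.
by case: ifP => _; [exact: rel_BBA|exact: opT_A].
Qed.

Lemma opX_B i m : opX i (B m) = B (opX i m).
Proof.
rewrite /opX; case: ifP => _; first exact: rel_AAB.
by case: ifP => _ //; exact: opT_B.
Qed.

Lemma opX_H i m : opX i (H m) = H (opX i m).
Proof.
rewrite /opX; case: ifP => _; first exact: rel_AAH.
by case: ifP => _; [exact: rel_BBH|exact: opT_H].
Qed.

(** Each [opX i] commutes with A and B, and each [opX j] is a polynomial in A and B. *)
Lemma opX_C i j m : opX i (opX j m) = opX j (opX i m).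
Proof.
rewrite [opX j m]/opX [opX j (opX i m)]/opX.
case: ifP => _; first by rewrite !opX_A.
by case: ifP => _; [rewrite !opX_B|rewrite /opT (linD (opX_linear i)) !(opX_A, opX_B)].
Qed.

Definition F_super : superVect K := subSuperVect peirce11_gr.

Definition F_op (i : 'I_3) (v : F_super) : F_super :=
  vsproj peirce11 (opX i (vsval v)).

Lemma F_inP (v : F_super) : H (vsval v) = vsval v.
Proof. by apply/eqP; rewrite -mem_peirce11 subvsP. Qed.

Lemma F_opE i (v : F_super) : vsval (F_op i v) = opX i (vsval v).
Proof. by rewrite vsprojK // mem_peirce11 -opX_H F_inP. Qed.

Lemma F_op_linear i : linear (F_op i).
Proof. by move=> a u v; rewrite /F_op linearP opX_linear linearP. Qed.

Lemma F_op_C i j v : F_op i (F_op j v) = F_op j (F_op i v).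
Proof. by apply: subvs_inj; rewrite !F_opE opX_C. Qed.

Lemma F_act_gr i p (v : F_super) : sv_gr i v -> sv_gr i (polyact F_op p v).
Proof.
move=> hv; apply: (@polyact_gr K 3 F_super _ F_op i p v (sv_grP F_super)) => // j u hu.
by rewrite /F_super /= /subgr F_opE; exact: opX_gr.
Qed.

Definition F_rep : superPolyRep K :=
  SuperPolyRep (polyactP F_op_linear F_op_C) F_act_gr.

Lemma F_act_Xi i (v : F_super) : vsval (polyact F_op 'X_i v) = opX i (vsval v).
Proof. by rewrite polyactXi // F_opE. Qed.

End PeircePart.

Section Restriction.
Variables (K : fieldType) (n2 : (2 : K) != 0) (M N : jordanBimodule K).
Variables (f : M -> N).
Hypothesis fL : linear f.
Hypothesis fH : forall m, f (opH m) = opH (f m).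
Hypothesis fX : forall i m, f (opX i m) = opX i (f m).

(** Only linearity and compatibility with H and the [opX i] are assumed of [f], so that even, odd
    and mixed homomorphisms are restricted by one construction. *)
Definition F_map (v : F_super M) : F_super N := vsproj (peirce11 N) (f (vsval v)).

Lemma F_mapE v : vsval (F_map v) = f (vsval v).
Proof. by rewrite vsprojK // mem_peirce11 -fH F_inP. Qed.

Lemma F_map_linear : linear F_map.
Proof. by move=> a u v; rewrite /F_map linearP fL linearP. Qed.

Lemma F_map_act p v :
  F_map (spr_act (s := F_rep n2 M) p v) = spr_act (s := F_rep n2 N) p (F_map v).
Proof.
apply: (polyact_morph F_map_linear) => i u; apply: subvs_inj.
by rewrite F_opE // !F_mapE F_opE.
Qed.

Lemma F_map_gr i v : (forall i m, sv_gr i m -> sv_gr i (f m)) ->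
  sv_gr i v -> sv_gr i (F_map v).
Proof. by move=> fg hv; rewrite /= /subgr F_mapE; exact: fg. Qed.

End Restriction.

Section HomDeg.
Variables (K : fieldType) (n2 : (2 : K) != 0) (M N : jordanBimodule K).
Variables (d : bool) (f : M -> N).
Hypothesis fP : jb_hom_deg d f.

Lemma jb_hom_lin : linear f. Proof. by case: fP. Qed.

Lemma jb_hom_H m : f (opH m) = opH (f m).
Proof.
case: fP => _ _ h _; rewrite /opH (h _ _ _ (J_gr_ju K)).
by rewrite /ksgn andbF expr0 scale1r.
Qed.

Lemma jb_hom_A m : f (opA m) = ksgn d true *: opA (f m).
Proof. by case: fP => _ _ h _; rewrite /opA (h _ _ _ (J_gr_ja K)). Qed.

Lemma jb_hom_B m : f (opB m) = ksgn d true *: opB (f m).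
Proof. by case: fP => _ _ h _; rewrite /opB (h _ _ _ (J_gr_jb K)). Qed.

(** Each [opX i] is quadratic in A and B, so the sign of an odd homomorphism occurs twice and
    cancels. *)
Lemma jb_hom_X i m : f (opX i m) = opX i (f m).
Proof.
rewrite /opX /opT; case: ifP => _.
  by rewrite !jb_hom_A (linZ (@opAL K N)) scalerA ksgnK scale1r.
case: ifP => _; rewrite ?(linD jb_hom_lin) !(jb_hom_A, jb_hom_B);
by rewrite !(linZ (@opAL K N), linZ (@opBL K N)) !scalerA ksgnK !scale1r.
Qed.

End HomDeg.

Section Hom.
Variables (K : fieldType) (n2 : (2 : K) != 0) (M N : jordanBimodule K).
Variables (f : M -> N).
Hypothesis fP : jb_hom f.

Lemma jb_hom_linear : linear f.
Proof.
case: fP => f0 [f1 [[l0 _ _ _] [l1 _ _ _] fE]] a u v.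
by rewrite !fE l0 l1 scalerDr addrACA.
Qed.

Lemma jb_homH m : f (opH m) = opH (f m).
Proof.
case: fP => f0 [f1 [h0 h1 fE]].
by rewrite !fE (jb_hom_H h0) (jb_hom_H h1) (linD (@opHL K N)).
Qed.

Lemma jb_homX i m : f (opX i m) = opX i (f m).
Proof.
case: fP => f0 [f1 [h0 h1 fE]].
by rewrite !fE (jb_hom_X h0) (jb_hom_X h1) (linD (opX_linear i)).
Qed.
End Hom.

(** * The model bimodule of a representation *)

(* An element of J is given by its coordinates on 1, ju, ja, jb, and          *)
(* ((v, v1), (v2, w)) stands for v + A v1 + B v2 + C w in a bimodule, where   *)
(* v, v1, v2, w are in the Peirce component and C = AB - T/2 - k; k is 1/4.   *)
Section RingModel.
Variables (R : comNzRingType) (X Y T k : R).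
Definition quad : Type := ((R * R) * (R * R))%type.
Definition qadd (m n : quad) : quad :=
  ((m.1.1 + n.1.1, m.1.2 + n.1.2), (m.2.1 + n.2.1, m.2.2 + n.2.2)).
Definition qscale (c : R) (m : quad) : quad :=
  ((c * m.1.1, c * m.1.2), (c * m.2.1, c * m.2.2)).
Definition qJ (x y : quad) : quad :=
  let: ((p, q), (a, b)) := x in let: ((p', q'), (a', b')) := y in
  ((p * p' + q * q', p * q' + q * p' + (k + k) * (a * b' - b * a')),
   (p * a' + a * p', p * b' + b * p')).
Definition ql (x : quad) (m : quad) : quad :=
  let: ((p, q), (a, b)) := x in let: ((v, v1), (v2, w)) := m in
  (((p + q) * v + a * (X * v1 + (k * v2 + (k + k) * (T * v2)))
      + b * ((- k * v1 + (k + k) * (T * v1)) + Y * v2),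
    p * v1 + a * (v - (k * w + (k + k) * (T * w))) - b * (Y * w)),
   (p * v2 + a * (X * w) + b * (v + (- k * w + (k + k) * (T * w))),
    (p - q) * w + a * v2 - b * v1)).

Definition qpar (i : bool) (x : quad) : Prop :=
  if i then x.1 = (0, 0) else x.2 = (0, 0).

Definition sg (i j : bool) : R := if i && j then -1 else 1.

Lemma qJ_identity i j h l (a b c d : quad) :
  qpar i a -> qpar j b -> qpar h c -> qpar l d ->
  qadd (qadd (qJ (qJ a b) (qJ c d)) (qscale (sg j h) (qJ (qJ a c) (qJ b d))))
       (qscale (sg j l * sg h l) (qJ (qJ a d) (qJ b c)))
  = qadd (qadd (qJ (qJ (qJ a b) c) d)
      (qscale (sg j h * sg j l * sg h l) (qJ (qJ (qJ a d) c) b)))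
      (qscale (sg i j * sg i h * sg i l * sg h l) (qJ (qJ (qJ b d) c) a)).
Proof.
case: a b c d => [[p1 q1] [a1 b1]] [[p2 q2] [a2 b2]] [[p3 q3] [a3 b3]] [[p4 q4] [a4 b4]].
case: i; case: j; case: h; case: l; rewrite /qpar /sg /=; move=> [-> ->] [-> ->] [-> ->] [-> ->];
  cbv beta iota zeta delta [qadd qscale qJ ql fst snd]; congr pair; congr pair; ring.
Qed.

(* The Jordan identity of a null extension, with the module element in the    *)
(* last position, and below in the third one.                                 *)
Lemma ql_identity i j h (a b c m : quad) : qpar i a -> qpar j b -> qpar h c ->
  qadd (qadd (ql (qJ a b) (ql c m)) (qscale (sg j h) (ql (qJ a c) (ql b m))))
       (qscale (sg i j * sg i h) (ql (qJ b c) (ql a m)))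
  = qadd (qadd (ql (qJ (qJ a b) c) m) (qscale (sg i j * sg i h) (ql b (ql c (ql a m)))))
       (qscale (sg j h) (ql a (ql c (ql b m)))).
Proof.
case: a b c m => [[p1 q1] [a1 b1]] [[p2 q2] [a2 b2]] [[p3 q3] [a3 b3]] [[v v1] [v2 w]].
case: i; case: j; case: h; rewrite /qpar /sg /=; move=> [-> ->] [-> ->] [-> ->];
  cbv beta iota zeta delta [qadd qscale qJ ql fst snd]; congr pair; congr pair; ring.
Qed.

Lemma ql_commutator i j h (a b c m : quad) : qpar i a -> qpar j b -> qpar h c ->
  qadd (qadd (ql (qJ a b) (ql c m)) (qscale (sg i j * sg i h) (ql (qJ b c) (ql a m))))
       (qscale (sg j h) (ql (qJ a c) (ql b m)))
  = qadd (qadd (qscale (sg i h * sg j h) (ql c (ql (qJ a b) m)))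
       (qscale (sg i j) (ql b (ql (qJ a c) m)))) (ql a (ql (qJ b c) m)).
Proof.
case: a b c m => [[p1 q1] [a1 b1]] [[p2 q2] [a2 b2]] [[p3 q3] [a3 b3]] [[v v1] [v2 w]].
case: i; case: j; case: h; rewrite /qpar /sg /=; move=> [-> ->] [-> ->] [-> ->];
  cbv beta iota zeta delta [qadd qscale qJ ql fst snd]; congr pair; congr pair; ring.
Qed.
End RingModel.

(* Through this representation trivext makes ring a decision procedure for    *)
(* linear identities in V.                                                    *)
Section ZeroRep.
Variables (K : fieldType) (V : vectType K).
Local Notation A := {mpoly K[3]}.

Definition zero_act (p : A) (v : V) : V := p.@[fun=> 0] *: v.
Lemma zero_actP : is_polyrep zero_act.
Proof.
split=> [|v|p q v]; last 2 first.
- by rewrite /zero_act rmorph1 scale1r.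
- by rewrite /zero_act rmorphM scalerA.
split=> [v a p q|p a u v]; rewrite /zero_act.
  by rewrite mevalD mevalZ scalerDl scalerA.
by rewrite scalerDr !scalerA mulrC.
Qed.
Definition zeroRep := PolyRep zero_actP.
End ZeroRep.

Lemma J_mulr_linear (K : fieldType) (x : 'M[K]_2) : linear (J_mul x).
Proof.
move=> a u v; rewrite /J_mul /jordan_mul (proj2 (@stwist_bilinear K 2 par11) x).
rewrite mulmxDr -scalemxAr addrACA -[a *: _ + a *: _]scalerDr [LHS]scalerDr.
by rewrite !scalerA mulrC.
Qed.

Lemma J_supercomm (K : fieldType) i j (x y : 'M[K]_2) :
  J_gr i x -> J_gr j y -> J_mul x y = ksgn i j *: J_mul y x.
Proof.
move=> hx hy; rewrite /J_mul /jordan_mul (stwistE hx hy) (stwistE hy hx).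
rewrite scalerA mulrC -scalerA; congr (_ *: _).
by rewrite scalerDr scalerA ![ksgn j i]ksgnC ksgnK scale1r addrC.
Qed.

(** A certificate for an equation that follows linearly from four others: the coefficients are given
    and [ring] checks the combination. *)
Lemma eq_by_combination (R : pzRingType) (c1 c2 c3 c4 x y x1 y1 x2 y2 x3 y3 x4 y4 : R) :
  x1 = y1 -> x2 = y2 -> x3 = y3 -> x4 = y4 ->
  x - y = c1 * (x1 - y1) + c2 * (x2 - y2) + c3 * (x3 - y3) + c4 * (x4 - y4) ->
  x = y.
Proof.
move=> -> -> -> -> e; apply/eqP; rewrite -subr_eq0 e !subrr !mulr0.
by rewrite !addr0.
Qed.

Section NullExtensionJordan.
Variables (K : fieldType) (M : superVect K).
Variables (l : 'M[K]_2 -> M -> M) (r : M -> 'M[K]_2 -> M).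
Hypothesis l_bilin : bilinear_op l.
Hypothesis r_bilin : bilinear_op r.
Hypothesis l_gr : forall i j x m, J_gr i x -> sv_gr j m -> sv_gr (i (+) j) (l x m).
Hypothesis rE : forall i j m x, sv_gr i m -> J_gr j x -> r m x = ksgn i j *: l x m.
Hypothesis J_identity : forall i j h k (a b c d : 'M[K]_2),
  J_gr i a -> J_gr j b -> J_gr h c -> J_gr k d ->
  J_mul (J_mul a b) (J_mul c d) + ksgn j h *: J_mul (J_mul a c) (J_mul b d)
    + (ksgn j k * ksgn h k) *: J_mul (J_mul a d) (J_mul b c)
  = J_mul (J_mul (J_mul a b) c) d
    + (ksgn j h * ksgn j k * ksgn h k) *: J_mul (J_mul (J_mul a d) c) b
    + (ksgn i j * ksgn i h * ksgn i k * ksgn h k) *: J_mul (J_mul (J_mul b d) c) a.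
Hypothesis l_identity : forall i j h a b c m, J_gr i a -> J_gr j b -> J_gr h c ->
  l (J_mul a b) (l c m) + ksgn j h *: l (J_mul a c) (l b m)
    + (ksgn i j * ksgn i h) *: l (J_mul b c) (l a m)
  = l (J_mul (J_mul a b) c) m + (ksgn i j * ksgn i h) *: l b (l c (l a m))
    + ksgn j h *: l a (l c (l b m)).
Hypothesis l_commutator : forall i j h a b c m,
  J_gr i a -> J_gr j b -> J_gr h c ->
  l (J_mul a b) (l c m) + (ksgn i j * ksgn i h) *: l (J_mul b c) (l a m)
    + ksgn j h *: l (J_mul a c) (l b m)
  = (ksgn i h * ksgn j h) *: l c (l (J_mul a b) m)
    + ksgn i j *: l b (l (J_mul a c) m) + l a (l (J_mul b c) m).

Local Notation nmul := (null_ext_mul l r).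
Local Notation ngr := (@null_ext_gr K M).

Let gJ : is_grading (@J_gr K). Proof. exact: mxgr_grading. Qed.
Let gM := sv_grP M.

Let lD x m n : l x (m + n) = l x m + l x n.
Proof. by case: l_bilin => _ h; exact: linD (h x) m n. Qed.
Let lZ x c m : l x (c *: m) = c *: l x m.
Proof. by case: l_bilin => _ h; exact: linZ (h x) c m. Qed.
Let lZl c x m : l (c *: x) m = c *: l x m.
Proof. by case: l_bilin => h _; exact: linZ (h m) c x. Qed.

Lemma null_ext_gradedop : graded_op ngr ngr ngr nmul.
Proof.
move=> i j u v [hu1 hu2] [hv1 hv2]; split=> /=; first exact: J_mul_gr.
apply: (grD gM); first exact: l_gr.
by rewrite (rE hu2 hv1); apply: (grZ gM); rewrite addbC; exact: l_gr.
Qed.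

Let nmulE i j u v : ngr i u -> ngr j v ->
  nmul u v = (J_mul u.1 v.1, l u.1 v.2 + ksgn i j *: l v.1 u.2).
Proof. by move=> [_ hu] [hv _]; rewrite /null_ext_mul (rE hu hv). Qed.

(** The identity is multilinear and products of two elements of M vanish, so beyond J itself only
    the terms with exactly one entry in M matter. Up to signs it is symmetric in a, b, d: an entry
    of M in one of these places is a case of [l_identity], and in the place of c a case of
    [l_commutator]. The coefficients of the final combination are the Koszul signs of moving that
    entry to the end. *)
Lemma null_ext_identity i j h k a b c d :
  ngr i a -> ngr j b -> ngr h c -> ngr k d ->
  nmul (nmul a b) (nmul c d) + ksgn j h *: nmul (nmul a c) (nmul b d)
    + (ksgn j k * ksgn h k) *: nmul (nmul a d) (nmul b c)
  = nmul (nmul (nmul a b) c) d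
    + (ksgn j h * ksgn j k * ksgn h k) *: nmul (nmul (nmul a d) c) b
    + (ksgn i j * ksgn i h * ksgn i k * ksgn h k) *: nmul (nmul (nmul b d) c) a.
Proof.
move=> ha hb hc hd; have G := null_ext_gradedop.
have [[Ja _] [Jb _] [Jc _] [Jd _]] := And4 ha hb hc hd.
apply: injective_projections; first exact: J_identity.
have e4 := l_identity d.2 Ja Jb Jc.
have e2 := l_identity b.2 Ja Jd Jc.
have e1 := l_identity a.2 Jb Jd Jc.
have e3 := l_commutator c.2 Ja Jb Jd.
rewrite (J_supercomm Jd Jc) lZl in e2.
rewrite (J_supercomm Jd Jc) lZl in e1.
rewrite (nmulE (G _ _ _ _ (G _ _ _ _ ha hb) hc) hd).
rewrite (nmulE (G _ _ _ _ (G _ _ _ _ ha hd) hc) hb).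
rewrite (nmulE (G _ _ _ _ (G _ _ _ _ hb hd) hc) ha).
rewrite (nmulE (G _ _ _ _ ha hb) hc) (nmulE (G _ _ _ _ ha hd) hc).
rewrite (nmulE (G _ _ _ _ hb hd) hc).
rewrite (nmulE (G _ _ _ _ ha hb) (G _ _ _ _ hc hd)).
rewrite (nmulE (G _ _ _ _ ha hc) (G _ _ _ _ hb hd)).
rewrite (nmulE (G _ _ _ _ ha hd) (G _ _ _ _ hb hc)).
rewrite (nmulE ha hb) (nmulE hc hd) (nmulE ha hc) (nmulE hb hd).
rewrite (nmulE ha hd) (nmulE hb hc) /= !(lD, lZ).
move: e1 e2 e3 e4.
move=> /(congr1 (@te_in K (zeroRep M))) e1 /(congr1 (@te_in K (zeroRep M))) e2.
move=> /(congr1 (@te_in K (zeroRep M))) e3 /(congr1 (@te_in K (zeroRep M))) e4.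
apply: (@te_inI K (zeroRep M)); move: e1 e2 e3 e4.
rewrite !(te_inE (zeroRep M)).
pose cst (x : K) := te_cst (zeroRep M) x.
move=> e1 e2 e3 e4.
apply: (eq_by_combination (c1 := cst (ksgn i j * ksgn i h * ksgn i k * ksgn h k))
  (c2 := cst (ksgn j h * ksgn j k * ksgn h k)) (c3 := cst (ksgn h k)) (c4 := 1) e1 e2 e3 e4).
rewrite /cst; clear.
case: i; case: j; case: h; case: k; rewrite /ksgn /= ?expr0 ?expr1; ring.
Qed.

Lemma null_ext_supercomm i j u v : ngr i u -> ngr j v -> nmul u v = ksgn i j *: nmul v u.
Proof.
move=> hu hv; rewrite (nmulE hu hv) (nmulE hv hu).
have [Ju _] := hu; have [Jv _] := hv.
congr pair; first exact: J_supercomm.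
by rewrite /= scalerDr scalerA ![ksgn j i]ksgnC ksgnK scale1r addrC.
Qed.

Lemma null_ext_jordan : is_jordan_superalgebra ngr nmul.
Proof.
have [bl br] := l_bilin; have [rl rr] := r_bilin.
split=> [|||i j u v|i j h k a b c d].
- split=> [i|i a u v [h1 h2] [h3 h4]|[x m]|[x m] [/= h1 h2] [/= h3 h4]].
  + by split; [exact: (gr0 gJ)|exact: (gr0 gM)].
  + by split; [exact: (grZD gJ)|exact: (grZD gM)].
  + exists (grpart gJ false x, grpart gM false m), (grpart gJ true x, grpart gM true m).
    split; try by split; exact: grpart_gr.
    by congr pair; exact: grpart_sum.
  + by rewrite (gr_eq0 gJ h1 h3) (gr_eq0 gM h2 h4).
- split=> [[x m] a [y n] [z p]|[x m] a [y n] [z p]]; congr pair => /=.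
  + exact: J_mull_linear.
  + by rewrite bl rl scalerDr addrACA.
  + exact: J_mulr_linear.
  + by rewrite br rr scalerDr addrACA.
- exact: null_ext_gradedop.
- exact: null_ext_supercomm.
- exact: null_ext_identity.
Qed.
End NullExtensionJordan.

Section JCoordinates.
Variable K : fieldType.
Implicit Types x y : 'M[K]_2.
Definition jp x : K := 2^-1 * (x 0 0 + x 1 1).
Definition jq x : K := 2^-1 * (x 0 0 - x 1 1).
Definition jx x : K := x 0 1.
Definition jy x : K := x 1 0.

Lemma J_coord_inj x y : (2 : K) != 0 ->
  jp x = jp y -> jq x = jq y -> jx x = jx y -> jy x = jy y -> x = y.
Proof.
by move=> n2 h1 h2 h3 h4; rewrite (J_decomp x n2) (J_decomp y n2) -/(jp x) -/(jq x)
   h1 h2 -/(jx x) -/(jy x) h3 h4.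
Qed.

Lemma jp_mul x y : (2 : K) != 0 -> jp (J_mul x y) = jp x * jp y + jq x * jq y.
Proof. by move=> n2; rewrite /jp /jq J_mulC00 J_mulC11; field. Qed.
Lemma jq_mul x y : (2 : K) != 0 -> jq (J_mul x y) =
  jp x * jq y + jq x * jp y + (4^-1 + 4^-1) * (jx x * jy y - jy x * jx y).
Proof.
move=> n2; rewrite /jp /jq /jx /jy J_mulC00 J_mulC11.
by field; rewrite (_ : 4%:R = 2 * 2) ?mulf_neq0 // -natrM.
Qed.
Lemma jx_mul x y : (2 : K) != 0 -> jx (J_mul x y) = jp x * jx y + jx x * jp y.
Proof. by move=> n2; rewrite /jp /jx J_mulC01; field. Qed.
Lemma jy_mul x y : (2 : K) != 0 -> jy (J_mul x y) = jp x * jy y + jy x * jp y.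
Proof. by move=> n2; rewrite /jp /jy J_mulC10; field. Qed.

Lemma jpP a x y : jp (a *: x + y) = a * jp x + jp y.
Proof. by rewrite /jp !mxE; ring. Qed.
Lemma jqP a x y : jq (a *: x + y) = a * jq x + jq y.
Proof. by rewrite /jq !mxE; ring. Qed.
Lemma jxP a x y : jx (a *: x + y) = a * jx x + jx y.
Proof. by rewrite /jx !mxE; ring. Qed.
Lemma jyP a x y : jy (a *: x + y) = a * jy x + jy y.
Proof. by rewrite /jy !mxE; ring. Qed.

Lemma J_even x : J_gr false x -> jx x = 0 /\ jy x = 0.
Proof. by move=> <-; rewrite /jx /jy !mxE. Qed.
Lemma J_odd x : J_gr true x -> jp x = 0 /\ jq x = 0.
Proof. by move=> <-; rewrite /jp /jq !mxE /= addr0 subrr mulr0. Qed.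
End JCoordinates.

Section Model.
Local Opaque J_mul.
Variables (K : fieldType) (n2 : (2 : K) != 0) (V : superPolyRep K).

Definition polyRep_of : polyRep K := PolyRep (spr_actP V).
Local Notation W := polyRep_of.
Local Notation act := (@pr_act K W).

Definition mod_sort : vectType K := ((V * V) * (V * V))%type.

(** The two middle components v1, v2 stand for A v1 and B v2 with A and B odd, so their parity is
    shifted. *)
Definition mod_gr (i : bool) (m : mod_sort) : Prop :=
  [/\ sv_gr i m.1.1, sv_gr (~~ i) m.1.2, sv_gr (~~ i) m.2.1 & sv_gr i m.2.2].

Lemma mod_grP : is_grading mod_gr.
Proof.
have gP := sv_grP V.
split=> [i|i a u v [h1 h2 h3 h4] [k1 k2 k3 k4]|[[v1 v2] [v3 v4]]|[[v1 v2] [v3 v4]]].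
- by split; exact: (gr0 gP).
- by split; exact: (grZD gP).
- pose p := grpart gP.
  exists ((p false v1, p true v2), (p true v3, p false v4)),
         ((p true v1, p false v2), (p false v3, p true v4)).
  split; try by split; exact: grpart_gr.
  congr pair; congr pair => /=; rewrite [LHS](grpart_sum gP) //=; exact: addrC.
move=> [/= h1 h2 h3 h4] [/= k1 k2 k3 k4].
by rewrite (gr_eq0 gP h1 k1) (gr_eq0 gP h2 k2) (gr_eq0 gP h3 k3) (gr_eq0 gP h4 k4).
Qed.

Definition modV : superVect K := SuperVect mod_grP.

(** The operator T/2 + c. The half is written as a sum of two quarters to match [k + k] in [ql],
    which leaves a single scalar atom to [ring]. *)
Definition mod_s (c : K) (v : V) : V := c *: v + (4^-1 + 4^-1) *: act 'X_2 v.

Definition mod_l (x : 'M[K]_2) (m : modV) : modV :=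
  let: ((v, v1), (v2, w)) := m in
  (((jp x + jq x) *: v + jx x *: (act 'X_0 v1 + mod_s 4^-1 v2)
      + jy x *: (mod_s (- 4^-1) v1 + act 'X_1 v2),
    jp x *: v1 + jx x *: (v - mod_s 4^-1 w) - jy x *: act 'X_1 w),
   (jp x *: v2 + jx x *: act 'X_0 w + jy x *: (v + mod_s (- 4^-1) w),
    (jp x - jq x) *: w + jx x *: v2 - jy x *: v1)).

Arguments mod_l : simpl never.

(** The parity involution. It lets [mod_r] encode the sign rule of [mod_rE] by a formula that also
    makes sense on inhomogeneous elements. *)
Definition mod_sgn (m : modV) : modV := grpart mod_grP false m - grpart mod_grP true m.

Definition mod_r (m : modV) (x : 'M[K]_2) : modV :=
  mod_l (mxpart par11 false x) m + mod_l (mxpart par11 true x) (mod_sgn m).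

Local Notation R := (trivext W).
Local Notation te := (@te_cst K W).
Definition te4 (m : modV) : quad R :=
  ((te_in (V := W) m.1.1, te_in (V := W) m.1.2), (te_in (V := W) m.2.1, te_in (V := W) m.2.2)).
Definition te4J (x : 'M[K]_2) : quad R :=
  ((te (jp x), te (jq x)), (te (jx x), te (jy x))).

Lemma te4I : injective te4.
Proof. by move=> [[v v1] [v2 w]] [[u u1] [u2 z]] [-> -> -> ->]. Qed.

Lemma te_cstI : injective te.
Proof. by move=> a b /(congr1 fst) /= h; rewrite -(mpolyCK 3 a) h mpolyCK. Qed.

Lemma te4JI : injective te4J.
Proof.
move=> x y h; apply: J_coord_inj => //; apply: te_cstI.
- by have := congr1 (fun q : quad R => q.1.1) h.
- by have := congr1 (fun q : quad R => q.1.2) h.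
- by have := congr1 (fun q : quad R => q.2.1) h.
- by have := congr1 (fun q : quad R => q.2.2) h.
Qed.

Lemma te4D m n : te4 (m + n) = qadd (te4 m) (te4 n).
Proof. by rewrite /te4 /= !te_inD. Qed.
Lemma te4Z c m : te4 (c *: m) = qscale (te c) (te4 m).
Proof. by rewrite /te4 /= !te_inZ. Qed.

Local Notation Xr := (te_poly W 'X_0).
Local Notation Yr := (te_poly W 'X_1).
Local Notation Tr := (te_poly W 'X_2).
Local Notation kr := (te 4^-1).

Lemma te4_l x m : te4 (mod_l x m) = ql Xr Yr Tr kr (te4J x) (te4 m).
Proof.
case: m => [[v v1] [v2 w]]; rewrite /te4 /te4J /mod_l /ql /mod_s /=.
congr pair; congr pair; rewrite !(te_inE W); ring.
Qed.

Lemma te4J_mul x y : te4J (J_mul x y) = qJ kr (te4J x) (te4J y).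
Proof.
rewrite /te4J jp_mul // jq_mul // jx_mul // jy_mul // /qJ.
congr pair; congr pair; ring.
Qed.

Lemma te4J_D (x y : 'M[K]_2) : te4J (x + y) = qadd (te4J x) (te4J y).
Proof.
have e := scale1r x; rewrite /te4J -{1 2 3 4}e jpP jqP jxP jyP !mul1r.
by rewrite /qadd /= !(rmorphD te).
Qed.

Lemma te4J_Z c (x : 'M[K]_2) : te4J (c *: x) = qscale (te c) (te4J x).
Proof.
have z0 : te4J 0 = ((0, 0), (0, 0)).
  by rewrite /te4J /jp /jq /jx /jy !mxE subr0 addr0 mulr0 !rmorph0.
have := te4J_D (c *: x) 0; rewrite addr0 => _.
rewrite /te4J -[c *: x]addr0 jpP jqP jxP jyP.
by rewrite /jp /jq /jx /jy !mxE subr0 addr0 mulr0 !addr0 /qscale /= !(rmorphM te).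
Qed.

Lemma te4J_lin3 (x : 'M[K]_2) a (y : 'M[K]_2) b (z : 'M[K]_2) : te4J (x + a *: y + b *: z) =
  qadd (qadd (te4J x) (qscale (te a) (te4J y))) (qscale (te b) (te4J z)).
Proof. by rewrite !te4J_D !te4J_Z. Qed.

Lemma te4J_par i x : J_gr i x -> qpar i (te4J x).
Proof.
by case: i => hx; rewrite /qpar /te4J /=; [have [-> ->] := J_odd hx|have [-> ->] := J_even hx];
  rewrite rmorph0.
Qed.

Lemma mod_l_bilin : bilinear_op mod_l.
Proof.
split=> [m a x y|x a m n]; apply: te4I; rewrite !(te4_l, te4D, te4Z).
  rewrite te4J_D te4J_Z.
  case: (te4J x) (te4J y) (te4 m) => [[? ?] [? ?]] [[? ?] [? ?]] [[? ?] [? ?]].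
  rewrite /qadd /qscale /ql /=; congr pair; congr pair; ring.
case: (te4J x) (te4 m) (te4 n) => [[? ?] [? ?]] [[? ?] [? ?]] [[? ?] [? ?]].
rewrite /qadd /qscale /ql /=; congr pair; congr pair; ring.
Qed.

Lemma mod_sgnE i m : mod_gr i m -> mod_sgn m = ksgn i true *: m.
Proof.
move=> hm; rewrite /mod_sgn !(grpart_id mod_grP _ hm) /ksgn.
by case: i {hm}; rewrite /= ?sub0r ?subr0 ?expr0 ?expr1 ?scale1r ?scaleN1r.
Qed.

Lemma mod_rE i j m x : mod_gr i m -> J_gr j x -> mod_r m x = ksgn i j *: mod_l x m.
Proof.
move=> hm hx; rewrite /mod_r !(mxgr_part _ hx) (mod_sgnE hm).
have [bl br] := mod_l_bilin.
have l0 n : mod_l 0 n = 0 by exact: (lin0 (bl n)).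
case: j hx => hx /=; rewrite l0 ?add0r ?addr0; first exact: (linZ (br x)).
by rewrite /ksgn andbF expr0 scale1r.
Qed.

Lemma mod_l_gr i j x m : J_gr i x -> mod_gr j m -> mod_gr (i (+) j) (mod_l x m).
Proof.
have gP := sv_grP V.
have gs k c v : sv_gr k v -> sv_gr k (mod_s c v).
  by move=> hv; apply: (grZD gP) => //; apply: (grZ gP); exact: spr_even.
have gX k p v : sv_gr k v -> sv_gr k (act p v) by exact: spr_even.
case: m => [[v v1] [v2 w]] hx [/= h1 h2 h3 h4]; case: i hx => hx.
  have [ep eq] := J_odd hx; rewrite /mod_l ep eq !addr0 ?subrr !scale0r !add0r.
  rewrite addTb; split=> /=; rewrite ?negbK;
    by do ?[apply: (grD gP)|apply: (grN gP)|apply: (grZ gP)|exact: gs|exact: gX]; auto.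
have [ex ey] := J_even hx; rewrite /mod_l ex ey !scale0r !subr0 !addr0.
by rewrite addFb; split=> /=; apply: (grZ gP).
Qed.

Lemma mod_r_bilin : bilinear_op mod_r.
Proof.
have [bl br] := mod_l_bilin.
have sl : linear mod_sgn.
  by move=> a m n; rewrite /mod_sgn !grpart_linear scalerBr opprD addrACA.
split=> [x a m n|m a x y]; rewrite /mod_r.
  by rewrite sl !br scalerDr addrACA.
by rewrite !mxpart_linear !bl scalerDr addrACA.
Qed.

Let teM a b : te (a * b) = te a * te b. Proof. exact: rmorphM. Qed.

Lemma te_ksgn i j : te (ksgn i j) = sg R i j.
Proof. by rewrite /ksgn /sg; case: (i && j); rewrite ?expr1 ?expr0 ?rmorphN1 ?rmorph1. Qed.

Local Opaque ksgn te4J te4.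

Lemma J_identity i j h k (a b c d : 'M[K]_2) :
  J_gr i a -> J_gr j b -> J_gr h c -> J_gr k d ->
  J_mul (J_mul a b) (J_mul c d) + ksgn j h *: J_mul (J_mul a c) (J_mul b d)
    + (ksgn j k * ksgn h k) *: J_mul (J_mul a d) (J_mul b c)
  = J_mul (J_mul (J_mul a b) c) d
    + (ksgn j h * ksgn j k * ksgn h k) *: J_mul (J_mul (J_mul a d) c) b
    + (ksgn i j * ksgn i h * ksgn i k * ksgn h k) *: J_mul (J_mul (J_mul b d) c) a.
Proof.
move=> ha hb hc hd; apply: te4JI.
apply: etrans (te4J_lin3 _ _ _ _ _) (etrans _ (esym (te4J_lin3 _ _ _ _ _))).
rewrite !teM !te_ksgn; have := te4J_mul; move: (@J_mul K) => mul mulE.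
by rewrite !mulE; apply: qJ_identity; exact: te4J_par.
Qed.

Lemma mod_l_identity i j h a b c m : J_gr i a -> J_gr j b -> J_gr h c ->
  mod_l (J_mul a b) (mod_l c m) + ksgn j h *: mod_l (J_mul a c) (mod_l b m)
    + (ksgn i j * ksgn i h) *: mod_l (J_mul b c) (mod_l a m)
  = mod_l (J_mul (J_mul a b) c) m
    + (ksgn i j * ksgn i h) *: mod_l b (mod_l c (mod_l a m))
    + ksgn j h *: mod_l a (mod_l c (mod_l b m)).
Proof.
move=> ha hb hc; apply: te4I.
rewrite !(te4D, te4Z) !teM !te_ksgn; move: te4_l te4J_mul.
move: mod_l (@J_mul K) => act mul actE mulE.
by rewrite !(actE, mulE); apply: ql_identity; exact: te4J_par.
Qed.

Lemma mod_l_commutator i j h a b c m : J_gr i a -> J_gr j b -> J_gr h c ->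
  mod_l (J_mul a b) (mod_l c m)
    + (ksgn i j * ksgn i h) *: mod_l (J_mul b c) (mod_l a m)
    + ksgn j h *: mod_l (J_mul a c) (mod_l b m)
  = (ksgn i h * ksgn j h) *: mod_l c (mod_l (J_mul a b) m)
    + ksgn i j *: mod_l b (mod_l (J_mul a c) m) + mod_l a (mod_l (J_mul b c) m).
Proof.
move=> ha hb hc; apply: te4I.
rewrite !(te4D, te4Z) !teM !te_ksgn; move: te4_l te4J_mul.
move: mod_l (@J_mul K) => act mul actE mulE.
by rewrite !(actE, mulE); apply: ql_commutator; exact: te4J_par.
Qed.

Lemma mod_jordan :
  is_jordan_superalgebra (@null_ext_gr K modV) (null_ext_mul mod_l mod_r).
Proof.
apply: null_ext_jordan.
- exact: mod_l_bilin.
- exact: mod_r_bilin.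
- exact: mod_l_gr.
- exact: mod_rE.
- exact: J_identity.
- exact: mod_l_identity.
- exact: mod_l_commutator.
Qed.

Lemma mod_unital m : mod_l 1%:M m = m /\ mod_r m 1%:M = m.
Proof.
have h : mod_l 1%:M m = m.
  case: m => [[v v1] [v2 w]]; rewrite /mod_l.
  have -> : jp (1%:M : 'M[K]_2) = 1 by rewrite /jp !mxE /= !mulr1n -[1 + 1]/(2) mulVf.
  have -> : jq (1%:M : 'M[K]_2) = 0 by rewrite /jq !mxE /= subrr mulr0.
  have -> : jx (1%:M : 'M[K]_2) = 0 by rewrite /jx !mxE.
  have -> : jy (1%:M : 'M[K]_2) = 0 by rewrite /jy !mxE.
  by rewrite !addr0 !subr0 !scale0r !scale1r !addr0 !subr0.
split=> //; rewrite /mod_r !(mxgr_part _ (J_gr_1 K)) /=.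
have [bl _] := mod_l_bilin.
by rewrite h (lin0 (bl _)) addr0.
Qed.

Definition modJ : jordanBimodule K :=
  JordanBimodule mod_l_bilin mod_r_bilin mod_jordan mod_unital.

Let mod_simp := (@scale0r K V, @scale1r K V, @scaleN1r K V, @add0r V, @addr0 V,
  @sub0r V, @subr0 V, @add0r K, @addr0 K, @sub0r K, @subr0 K).

Lemma modH (m : modJ) : opH m = ((m.1.1, 0), (0, - m.2.2)).
Proof.
case: m => [[v v1] [v2 w]]; rewrite /opH /= /mod_l.
have -> : jp (ju K) = 0 by rewrite /jp !mxE /= subr0 sub0r subrr mulr0.
have -> : jq (ju K) = 1 by rewrite /jq !mxE /= subr0 sub0r opprK -[1 + 1]/(2) mulVf.
have -> : jx (ju K) = 0 by rewrite /jx !mxE /= subr0.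
have -> : jy (ju K) = 0 by rewrite /jy !mxE /= subr0.
by rewrite !mod_simp oppr0.
Qed.

Lemma modA (m : modJ) : opA m =
  ((act 'X_0 m.1.2 + mod_s 4^-1 m.2.1, m.1.1 - mod_s 4^-1 m.2.2),
   (act 'X_0 m.2.2, m.2.1)).
Proof.
case: m => [[v v1] [v2 w]]; rewrite /opA /= /mod_l.
have -> : jp (ja K) = 0 by rewrite /jp !mxE /= addr0 mulr0.
have -> : jq (ja K) = 0 by rewrite /jq !mxE /= subr0 mulr0.
have -> : jx (ja K) = 1 by rewrite /jx !mxE.
have -> : jy (ja K) = 0 by rewrite /jy !mxE.
by rewrite !mod_simp oppr0 !mod_simp.
Qed.

Lemma modB (m : modJ) : opB m =
  ((mod_s (- 4^-1) m.1.2 + act 'X_1 m.2.1, - act 'X_1 m.2.2),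
   (m.1.1 + mod_s (- 4^-1) m.2.2, - m.1.2)).
Proof.
case: m => [[v v1] [v2 w]]; rewrite /opB /= /mod_l.
have -> : jp (jb K) = 0 by rewrite /jp !mxE /= addr0 mulr0.
have -> : jq (jb K) = 0 by rewrite /jq !mxE /= subr0 mulr0.
have -> : jx (jb K) = 0 by rewrite /jx !mxE.
have -> : jy (jb K) = 1 by rewrite /jy !mxE.
by rewrite !mod_simp oppr0 !mod_simp.
Qed.

End Model.

(** * Reconstruction of a bimodule from its Peirce component *)

Section NilpotentAction.
Variables (K : fieldType) (V : polyRep K).
Local Notation act := (@pr_act K V).

Lemma act_exp p n v : act (p ^+ n) v = iter n (act p) v.
Proof. by elim: n => [|n IH]; [rewrite expr0 act1|rewrite exprS actM IH]. Qed.

Variables (P : V -> Prop) (x t p q : {mpoly K[3]}).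
Hypotheses (P0 : P 0) (PD : forall u v, P u -> P v -> P (u + v)).
Hypothesis Pact : forall r u, P u -> P (act r u).
Hypotheses (x_nil : nilpotent_op (act x)) (t_nil : nilpotent_op (act t)).

(* Nakayama: the operator [x p + t q] is nilpotent. *)
Lemma nilpotent_absorb u : P (u - act (x * p + t * q) u) -> P u.
Proof.
move=> Pu; have [a ha] := x_nil; have [b hb] := t_nil.
have ge_N i j : (a + b <= i + j)%N -> P (act (x ^+ i * t ^+ j) u).
  move=> le; case: (leqP a i) => [ai|ia].
    by rewrite -(subnK ai) exprD -mulrA mulrC -mulrA actM act_exp ha.
  have bj : (b <= j)%N by rewrite leqNgt; apply: contraL le => jb; rewrite -ltnNge -addSn leq_add // ltnW.
  by rewrite -(subnK bj) exprD mulrA mulrC actM act_exp hb.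
(* Downward induction on the degree of x^i t^j: monomials of degree at least a + b kill u, and u is
   its image under 1 - (x p + t q) plus p x u + q t u. *)
have step k : forall i j, (a + b <= i + j + k)%N -> P (act (x ^+ i * t ^+ j) u).
  elim: k => [|k IH] i j le; first by apply: ge_N; rewrite -[(i + j)%N]addn0.
  set m := x ^+ i * t ^+ j.
  have -> : act m u = act m (u - act (x * p + t * q) u)
      + (act p (act (x ^+ i.+1 * t ^+ j) u) + act q (act (x ^+ i * t ^+ j.+1) u)).
    by apply: te_inI; rewrite /m !te_inE !exprS; ring.
  apply: PD; first exact: Pact.
  apply: PD; apply: Pact; apply: IH; first by rewrite addSn addSnnS.
  by rewrite -addnA addSnnS addnA.
have := @step (a + b)%N 0%N 0%N; rewrite !expr0 mulr1 act1; apply.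
by rewrite add0n.
Qed.

End NilpotentAction.

Lemma half_quarter (K : fieldType) : (2 : K) != 0 -> 4^-1 + 4^-1 = 2^-1 :> K.
Proof.
move=> n2; have n4 : (4 : K) != 0 by rewrite (natrM _ 2 2) mulf_neq0.
by field; rewrite ?n2 ?n4.
Qed.

Lemma eq0_by_combination (R : pzRingType) (c1 c2 c3 x x1 x2 x3 : R) :
  x1 = 0 -> x2 = 0 -> x3 = 0 -> x = c1 * x1 + c2 * x2 + c3 * x3 -> x = 0.
Proof. by move=> -> -> -> ->; rewrite !mulr0 !addr0. Qed.

Section Psi.
Variables (K : fieldType) (n2 : (2 : K) != 0) (M : jordanBimodule K).
Local Notation H := (@opH K M).
Local Notation A := (@opA K M).
Local Notation B := (@opB K M).
Local Notation T := (@opT K M).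
Local Notation V := (F_rep n2 M).
Local Notation MV := (modJ n2 V).

Definition opS (c : K) (m : M) : M := c *: m + (4^-1 + 4^-1) *: T m.

(** The last summand is C w with C = AB - T/2 - 1/4. By [rel_BAH], H A B w = B A w + w/2 on the
    Peirce component, and the shift 1/4 is what makes H C w = - C w. So the four summands lie in the
    H-eigenspaces for 1, 0, 0, -1. *)
Definition Psi (x : MV) : M :=
  vsval x.1.1 + A (vsval x.1.2) + B (vsval x.2.1)
    + (A (B (vsval x.2.2)) - opS 4^-1 (vsval x.2.2)).

Let AD := linD (@opAL K M). Let AZ := linZ (@opAL K M).
Let AN := linN (@opAL K M).
Let BD := linD (@opBL K M). Let BZ := linZ (@opBL K M).
Let BN := linN (@opBL K M).
Let HD := linD (@opHL K M). Let HZ := linZ (@opHL K M).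
Let HN := linN (@opHL K M).
Let opE := (AD, AZ, AN, BD, BZ, BN, HD, HZ, HN).

Let te_quarter : te_cst (zeroRep M) 4^-1 * 4%:R = 1.
Proof.
rewrite -(rmorph_nat (te_cst (zeroRep M)) 4) -rmorphM mulVf ?rmorph1 //.
by rewrite (natrM _ 2 2) mulf_neq0.
Qed.

Ltac mring := apply: (@te_inI K (zeroRep M)); rewrite !(te_inE (zeroRep M));
  apply: subr0_eq; ring: te_quarter.

Lemma Psi_linear : linear Psi.
Proof.
move=> a [[v v1] [v2 w]] [[u u1] [u2 z]]; rewrite /Psi /opS /opT /=.
rewrite !linearP /= !opE; mring.
Qed.

Lemma actX0 (v : V) : vsval (pr_act (p := polyRep_of V) 'X_0 v) = A (A (vsval v)).
Proof. exact: (F_act_Xi n2 0 v). Qed.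
Lemma actX1 (v : V) : vsval (pr_act (p := polyRep_of V) 'X_1 v) = B (B (vsval v)).
Proof. exact: (F_act_Xi n2 1 v). Qed.
Lemma actX2 (v : V) : vsval (pr_act (p := polyRep_of V) 'X_2 v) = T (vsval v).
Proof. exact: (F_act_Xi n2 2 v). Qed.

Let vsD (u v : V) : vsval (u + v) = vsval u + vsval v. Proof. exact: linearD. Qed.
Let vs0 : vsval (0 : V) = 0. Proof. exact: linear0. Qed.
Let vsN (u : V) : vsval (- u) = - vsval u. Proof. exact: linearN. Qed.
Let vsZ c (u : V) : vsval (c *: u) = c *: vsval u. Proof. exact: linearZ. Qed.

Lemma mod_sE c (v : V) : vsval (mod_s c v) = opS c (vsval v).
Proof. by rewrite /mod_s vsD !vsZ actX2. Qed.

Let vsDs c (u v : V) : vsval (u + mod_s c v) = vsval u + opS c (vsval v).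
Proof. by rewrite -mod_sE; exact: vsD. Qed.
Let vsBs c (u v : V) : vsval (u - mod_s c v) = vsval u - opS c (vsval v).
Proof. by rewrite -mod_sE -vsN; exact: vsD. Qed.
Let vssD c (u v : V) : vsval (mod_s c u + v) = opS c (vsval u) + vsval v.
Proof. by rewrite -mod_sE; exact: vsD. Qed.

Let PsiE v v1 v2 w : Psi ((v, v1), (v2, w)) = vsval v + A (vsval v1) + B (vsval v2)
    + (A (B (vsval w)) - opS 4^-1 (vsval w)).
Proof. by []. Qed.

Let modAE v v1 v2 w : opA (((v, v1), (v2, w)) : MV) =
  ((pr_act (p := polyRep_of V) 'X_0 v1 + mod_s 4^-1 v2, v - mod_s 4^-1 w),
   (pr_act (p := polyRep_of V) 'X_0 w, v2)).
Proof. exact: modA. Qed.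

Let modBE v v1 v2 w : opB (((v, v1), (v2, w)) : MV) =
  ((mod_s (- 4^-1) v1 + pr_act (p := polyRep_of V) 'X_1 v2,
    - pr_act (p := polyRep_of V) 'X_1 w), (v + mod_s (- 4^-1) w, - v1)).
Proof. exact: modB. Qed.

Let modHE v v1 v2 w : opH (((v, v1), (v2, w)) : MV) = ((v, 0), (0, - w)).
Proof. exact: modH. Qed.

Lemma Psi_A x : Psi (opA x) = A (Psi x).
Proof.
case: x => [[v v1] [v2 w]]; rewrite modAE !PsiE.
rewrite vsDs vsBs !actX0 /opS /opT !opE !rel_AAB //; mring.
Qed.

Lemma Psi_B x : Psi (opB x) = B (Psi x).
Proof.
case: x => [[v v1] [v2 w]]; rewrite modBE !PsiE.
rewrite vssD vsDs !vsN !actX1 /opS /opT !opE !rel_BBA //; mring.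
Qed.

Lemma Psi_H x : Psi (opH x) = H (Psi x).
Proof.
case: x => [[v v1] [v2 w]]; rewrite modHE !PsiE vs0 vsN.
have h := @F_inP K M.
have HS c u : H (opS c u) = opS c (H u) by rewrite /opS HD !HZ opT_H.
have HA (u : V) : H (A (vsval u)) = 0 by rewrite -{1}(h u) rel_HAH.
have HB (u : V) : H (B (vsval u)) = 0 by rewrite -{1}(h u) rel_HBH.
have := rel_BAH n2 (vsval w); rewrite !h => /eqP; rewrite subr_eq => /eqP HABw.
rewrite 4!HD HN HS !h HA HB HABw /opS /opT !opE (lin0 (@opAL K M)) (lin0 (@opBL K M)) -(half_quarter n2).
mring.
Qed.

Lemma Psi_gr i x : sv_gr i x -> sv_gr i (Psi x).
Proof.
case: x => [[v v1] [v2 w]] [/= hv hv1 hv2 hw]; have gP := sv_grP M.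
have hA j u : sv_gr (~~ j) u -> sv_gr j (A u).
  by move=> /(jb_l_gr (J_gr_ja K)); rewrite addTb negbK.
have hB j u : sv_gr (~~ j) u -> sv_gr j (B u).
  by move=> /(jb_l_gr (J_gr_jb K)); rewrite addTb negbK.
rewrite /Psi /=; apply: (grD gP); first apply: (grD gP); first apply: (grD gP) => //.
- exact: hA.
- exact: hB.
apply: (grD gP); first by apply: hA; apply: hB; rewrite negbK.
by apply: (grN gP); apply: (grZD gP) => //; apply: (grZ gP); exact: opT_gr.
Qed.

Section Nilpotent.
Hypothesis M_nil : forall i : 'I_3, nilpotent_op (@opX K M i).

(** All of M, and not only its Peirce component, is a module over the polynomial ring; this is what
    allows [nilpotent_absorb] inside M. *)
Definition opX_rep : polyRep K := PolyRep (polyactP (@opX_linear K M) (@opX_C K n2 M)).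

Lemma opX_actE (i : 'I_3) m : pr_act (p := opX_rep) 'X_i m = opX i m.
Proof. exact: polyactXi. Qed.

Lemma opX_rep_nil (i : 'I_3) : nilpotent_op (@pr_act K opX_rep 'X_i).
Proof.
have [n hn] := M_nil i; exists n => m; rewrite -[RHS](hn m).
by elim: n {hn} => //= n ->; exact: opX_actE.
Qed.

Lemma F_nil (i : 'I_3) : nilpotent_op (@pr_act K (polyRep_of V) 'X_i).
Proof.
have [n hn] := M_nil i; exists n => v; apply: subvs_inj.
apply: etrans (esym (linear0 (vsval : V -> M))).
apply: etrans (hn (vsval v)); elim: n {hn} => //= n <-; exact: F_act_Xi.
Qed.

(* [16 (X_0 X_1 - s s')], for [s = T/2 + 1/4] and [s' = T/2 - 1/4] acting as   *)
(* products of A and B on the Peirce components, is 1 minus this polynomial.  *)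
Definition disc_nil : {mpoly K[3]} :=
  'X_0 * (- (16%:R *: 'X_1)) + 'X_2 * (4%:R *: 'X_2).

Let te_quarterV : te_cst (polyRep_of V) 4^-1 * 4%:R = 1.
Proof.
rewrite -(rmorph_nat (te_cst (polyRep_of V)) 4) -rmorphM mulVf ?rmorph1 //.
by rewrite (natrM _ 2 2) mulf_neq0.
Qed.

Let te_sixteenthV :
  1 - te_cst (polyRep_of V) 4^-1 * te_cst (polyRep_of V) 4^-1 * 16%:R = 0.
Proof. by rewrite (natrM _ 4 4) mulrACA te_quarterV mulr1 subrr. Qed.

(** Cramer's rule: the system has determinant XY - s s', and elimination gives (1 - [disc_nil]) v1 =
    (1 - [disc_nil]) v2 = 0. Then [nilpotent_absorb] applies, the property being the vanishing of a
    vector. *)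
Let disc0 (v1 v2 : V) :
  pr_act (p := polyRep_of V) 'X_0 v1 + mod_s 4^-1 v2 = 0 ->
  mod_s (- 4^-1) v1 + pr_act (p := polyRep_of V) 'X_1 v2 = 0 ->
  v1 = 0 /\ v2 = 0.
Proof.
have abs u : u - pr_act (p := polyRep_of V) disc_nil u = 0 -> u = 0.
  apply: (@nilpotent_absorb K (polyRep_of V) (fun u => u = 0)) => //.
  - by move=> ? ? -> ->; rewrite addr0.
  - by move=> r ? ->; rewrite act0.
  - exact: (F_nil 0).
  - exact: (F_nil 2).
have te_disc : te_poly (polyRep_of V) disc_nil =
    - (16%:R * (te_poly (polyRep_of V) 'X_0 * te_poly (polyRep_of V) 'X_1))
    + 4%:R * te_poly (polyRep_of V) 'X_2 ^+ 2.
  rewrite /disc_nil !scaler_nat; ring.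
move=> /(congr1 (@te_in K (polyRep_of V))) + /(congr1 (@te_in K (polyRep_of V))).
rewrite /mod_s !(te_inE (polyRep_of V)) => e1 e2.
set X := te_poly _ 'X_0 in e1 e2 te_disc; set Y := te_poly _ 'X_1 in e1 e2 te_disc.
set T' := te_poly _ 'X_2 in e1 e2 te_disc.
pose k := te_cst (polyRep_of V) 4^-1.
split; apply: abs; apply: (@te_inI K (polyRep_of V));
  rewrite te_inD te_inN te_inact te_disc te_in0.
  (* The first two coefficients form a row of 16 times the adjugate matrix; the third one accounts
     for 16 (1/4)^2 = 1. *)
  refine (@eq0_by_combination _ (16%:R * Y) (- 16%:R * (k + (k + k) * T'))
    ((1 - 4%:R * T' ^+ 2) * @te_in K (polyRep_of V) v1) _ _ _ _ e1 e2 te_sixteenthV _).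
  by rewrite /k; ring.
refine (@eq0_by_combination _ (- 16%:R * (- k + (k + k) * T')) (16%:R * X)
  ((1 - 4%:R * T' ^+ 2) * @te_in K (polyRep_of V) v2) _ _ _ _ e1 e2 te_sixteenthV _).
by rewrite /k; ring.
Qed.

(** The kernel is stable under A, B and H. Applying H once and twice isolates the first coordinate,
    and A and B feed combinations of the others into it, so [disc0] kills v1 and v2. A second round
    gives s w = 0 and s' w = 0, hence w = 0 because s - s' = 1/2. *)
Lemma Psi_inj : injective Psi.
Proof.
have P0 : Psi 0 = 0 by exact: lin0 Psi_linear.
suff ker x : Psi x = 0 -> x = 0.
  move=> x y e; apply/eqP; rewrite -subr_eq0; apply/eqP/ker.
  by rewrite (linB Psi_linear) e subrr.
have kA y : Psi y = 0 -> Psi (opA y) = 0 by move=> e; rewrite Psi_A e (lin0 (@opAL K M)).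
have kB y : Psi y = 0 -> Psi (opB y) = 0 by move=> e; rewrite Psi_B e (lin0 (@opBL K M)).
have kH y : Psi y = 0 -> Psi (opH y) = 0 by move=> e; rewrite Psi_H e (lin0 (@opHL K M)).
have k1 y : Psi y = 0 -> y.1.1 = 0.
  case: y => [[v v1] [v2 w]] /= e.
  have eH := kH _ e; have eHH := kH _ eH; apply: subvs_inj; rewrite vs0.
  move: eH eHH; rewrite !modHE !PsiE !vs0 !vsN.
  rewrite !(lin0 (@opAL K M), lin0 (@opBL K M)) !addr0 !opprK.
  set c := A (B (vsval w)) - _ => eH eHH.
  have vv : vsval v + vsval v = 0.
    rewrite -[X in X + _](addrK c) eHH add0r addrC.
    apply: etrans eH; congr (_ + _); rewrite /c /opS /opT BN !AN BN.
    mring.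
  have : 2%:R *: vsval v = 0 by rewrite scaler_nat mulr2n.
  by move/eqP; rewrite scaler_eq0 (negPf n2) => /eqP.
have k23 y : Psi y = 0 -> y.1.2 = 0 /\ y.2.1 = 0.
  case: y => [[v v1] [v2 w]] e; have := k1 _ e => /= v0.
  by have := k1 _ (kA _ e); have := k1 _ (kB _ e); rewrite modAE modBE => ? ?; exact: disc0.
case: x => [[v v1] [v2 w]] e; have [/= v10 v20] := k23 _ e; have /= v0 := k1 _ e.
have [sA _] := k23 _ (kA _ e); have [_ sB] := k23 _ (kB _ e).
rewrite modAE in sA; rewrite modBE in sB; rewrite /= v0 sub0r in sA; rewrite /= v0 add0r in sB.
have w0 : w = 0.
  have : 2%:R *: w = 0; last by move/eqP; rewrite scaler_eq0 (negPf n2) => /eqP.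
  apply: etrans (_ : 4%:R *: - (- mod_s 4^-1 w + mod_s (- 4^-1) w) = 0); last first.
    by rewrite sA sB addr0 oppr0 scaler0.
  apply: (@te_inI K (polyRep_of V)); rewrite /mod_s !(te_inE (polyRep_of V)).
  apply: subr0_eq; have q : 1 - te_cst (polyRep_of V) 4^-1 * 4%:R = 0.
    by rewrite te_quarterV subrr.
  refine (@eq0_by_combination _ 0 0 (2%:R * @te_in K (polyRep_of V) w) _ 0 0 _ erefl erefl q _).
  by ring.
by rewrite v0 v10 v20 w0.
Qed.

Definition in_Psi (m : M) : Prop := exists x, m = Psi x.

Let SD m m' : in_Psi m -> in_Psi m' -> in_Psi (m + m').
Proof. by move=> [x ->] [y ->]; exists (x + y); rewrite (linD Psi_linear). Qed.
Let SZ c m : in_Psi m -> in_Psi (c *: m).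
Proof. by move=> [x ->]; exists (c *: x); rewrite (linZ Psi_linear). Qed.
Let SN m : in_Psi m -> in_Psi (- m).
Proof. by rewrite -scaleN1r; exact: SZ. Qed.
Let SA m : in_Psi m -> in_Psi (A m).
Proof. by move=> [x ->]; exists (opA x); rewrite Psi_A. Qed.
Let SB m : in_Psi m -> in_Psi (B m).
Proof. by move=> [x ->]; exists (opB x); rewrite Psi_B. Qed.
Let SH m : in_Psi m -> in_Psi (H m).
Proof. by move=> [x ->]; exists (opH x); rewrite Psi_H. Qed.
Let S_half m : in_Psi (2%:R *: m) -> in_Psi m.
Proof. by move/(SZ 2^-1); rewrite scalerA mulVf // scale1r. Qed.
Let SX i m : in_Psi m -> in_Psi (opX i m).
Proof.
rewrite /opX /opT => hm; case: ifP => _; first by do 2!apply: SA.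
by case: ifP => _; [do 2!apply: SB|apply: SD; [apply/SA/SB|apply/SB/SA]].
Qed.
Let S0 : in_Psi 0. Proof. by exists 0; rewrite (lin0 Psi_linear). Qed.
Let Sact p m : in_Psi m -> in_Psi (pr_act (p := opX_rep) p m).
Proof.
move=> hm; rewrite /= /polyact; elim: (msupp p) => [|u s IH]; first by rewrite big_nil.
rewrite big_cons; apply: SD => //; apply: SZ; rewrite /monact.
by elim: (enum _) => //= j t; elim: (u j) => //= k h /h; exact: SX.
Qed.

Let S_peirce1 m : H m = m -> in_Psi m.
Proof.
move=> /eqP; rewrite -mem_peirce11 => hm; exists ((vsproj (peirce11 M) m, 0), (0, 0)).
rewrite PsiE vsprojK // !vs0 /opS /opT !(lin0 (@opAL K M), lin0 (@opBL K M)).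
by rewrite !(scaler0, addr0, oppr0).
Qed.

(** When H m = 0, both H A m + A m and H B m + B m are fixed by H, hence in the image. Then A(H B m
    + B m) - B(H A m + A m), which [rel_AHB] identifies with 2 (AB - s) m, is in the image as well,
    and so is (BA - s') m, its opposite half. *)
Let S_peirce0 m : H m = 0 -> in_Psi m.
Proof.
move=> Hm.
have A0 : A 0 = 0 by exact: lin0 (@opAL K M). have B0 : B 0 = 0 by exact: lin0 (@opBL K M).
have HH0 : H (H m) = 0 by rewrite Hm (lin0 (@opHL K M)).
have hA : in_Psi (H (A m) + A m).
  apply: S_peirce1; rewrite HD addrC; congr (_ + _).
  by rewrite [RHS](rel_AHH n2) HH0 A0 add0r.
have hB : in_Psi (H (B m) + B m).
  apply: S_peirce1; rewrite HD addrC; congr (_ + _).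
  by rewrite [RHS](rel_BHH n2) HH0 B0 add0r.
have e := rel_AHB n2 m; rewrite HH0 scaler0 sub0r in e.
have d1 : in_Psi (A (B m) - opS 4^-1 m).
  apply: S_half; have := SD (SA hB) (SN (SB hA)); congr in_Psi.
  have -> : A (H (B m) + B m) = A (H (B m)) - B (H (A m)) + B (H (A m)) + A (B m).
    by rewrite AD subrK.
  by rewrite e BD -(half_quarter n2) /opS /opT; mring.
have d2 : in_Psi (B (A m) - opS (- 4^-1) m).
  have := SN d1; congr in_Psi; rewrite /opS /opT; mring.
(* This element is (XY - s s') m: the two terms s BA m cancel, as s commutes with A and B, and BAAB
   = XY. Multiplied by 16 it is m minus the image of m under [disc_nil]. *)
have d3 : in_Psi (B (A (A (B m) - opS 4^-1 m)) + opS 4^-1 (B (A m) - opS (- 4^-1) m)).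
  apply: SD; first by apply/SB/SA.
  by apply: SD; apply: SZ => //; exact: (SX 2).
apply: (@nilpotent_absorb K opX_rep in_Psi 'X_0 'X_2 (- (16%:R *: 'X_1)) (4%:R *: 'X_2)) => //.
- exact: opX_rep_nil.
- exact: opX_rep_nil.
have := SZ 16%:R d3; congr in_Psi.
have ox0 u : opX (0 : 'I_3) u = A (A u) by [].
have ox1 u : opX (1 : 'I_3) u = B (B u) by [].
have ox2 u : opX (2 : 'I_3) u = A (B u) + B (A u) by [].
rewrite -scaleNr actDp !actM !actZp !actZ !opX_actE ox0 ox1 !ox2 /opS /opT !opE.
rewrite !(rel_AAB n2, =^~ rel_BBA n2).
have q : 1 - te_cst (zeroRep M) 4^-1 * te_cst (zeroRep M) 4^-1 * 16%:R = 0.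
  by rewrite (natrM _ 4 4) mulrACA te_quarter mulr1 subrr.
apply: (@te_inI K (zeroRep M)); rewrite !(te_inE (zeroRep M)); apply: subr0_eq.
pose tM := @te_in K (zeroRep M).
refine (@eq0_by_combination _ 0 0 (4%:R * (tM (A (B (A (B m)))) + tM (B (A (B (A m))))
  + 2%:R * tM (B (B (A (A m))))) - tM m) _ 0 0 _ erefl erefl q _).
by rewrite /tM; ring.
Qed.

(** H^3 = H splits m into eigenvectors of H. For the eigenvalue -1, [rel_BAH] writes u/2 as H A B u
    + B A u, where A u and B u lie in the 0-eigenspace already treated. *)
Lemma Psi_surj m : in_Psi m.
Proof.
have -> : m = 2^-1 *: (H (H m) + H m) + 2^-1 *: (H (H m) - H m) + (m - H (H m)).
  rewrite -scalerDr addrACA subrr addr0 -mulr2n -(scaler_nat 2) scalerA.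
  by rewrite mulVf // scale1r addrC subrK.
apply: SD; last by apply: S_peirce0; rewrite (linB (@opHL K M)) rel_HHH // subrr.
apply: SD; apply: SZ; first by apply: S_peirce1; rewrite HD rel_HHH // addrC.
set u := H (H m) - H m.
have Hu : H u = - u by rewrite /u (linB (@opHL K M)) rel_HHH // opprB.
have hA : in_Psi (A u).
  by apply: S_peirce0; rewrite -[u]opprK -Hu AN HN rel_HAH // oppr0.
have hB : in_Psi (B u).
  by apply: S_peirce0; rewrite -[u]opprK -Hu BN HN rel_HBH // oppr0.
have := SD (SH (SA hB)) (SB hA); have := rel_BAH n2 u.
rewrite Hu HN Hu opprK AN BN opprK => -> /(SZ 2%:R).
by rewrite scalerA mulfV // scale1r.
Qed.

Definition PsiV (m : M) : MV := sval (cid (Psi_surj m)).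
Lemma PsiVK m : Psi (PsiV m) = m.
Proof. exact: (esym (svalP (cid (Psi_surj m)))). Qed.
Lemma PsiK x : PsiV (Psi x) = x.
Proof. by apply: Psi_inj; rewrite PsiVK. Qed.
End Nilpotent.
End Psi.

(** * A module over a central extension of sl(2|2) *)

(* 2 x 2 matrices as nested pairs, row by row. *)
Definition mx2 (T : Type) : Type := ((T * T) * (T * T))%type.
Definition map2 (S T : Type) (f : S -> T) (A : mx2 S) : mx2 T :=
  ((f A.1.1, f A.1.2), (f A.2.1, f A.2.2)).
(* The four blocks of an element of sl(2|2), and two central coordinates. *)
Record blocks (S : Type) := Blocks {
  bP : mx2 S; bB : mx2 S; bC : mx2 S; bQ : mx2 S; bx : S; by_ : S }.
Definition map_blocks (S T : Type) (f : S -> T) (X : blocks S) : blocks T :=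
  Blocks (map2 f (bP X)) (map2 f (bB X)) (map2 f (bC X)) (map2 f (bQ X))
    (f (bx X)) (f (by_ X)).

(* nF and nG are traceless matrices, see t3mx; nbe and nga are the odd blocks. *)
Record nvec (T : Type) := Nvec {
  nF : T * T * T; nG : T * T * T; nbe : mx2 T; nga : mx2 T; nd : T * T * T }.
Definition map3 (S T : Type) (f : S -> T) (u : S * S * S) : T * T * T :=
  (f u.1.1, f u.1.2, f u.2).
Definition map_nvec (S T : Type) (f : S -> T) (n : nvec S) : nvec T :=
  Nvec (map3 f (nF n)) (map3 f (nG n)) (map2 f (nbe n)) (map2 f (nga n)) (map3 f (nd n)).

(** * The deformed action on the derivations of psl(2|2) *)

Section Action.
Variables (S : Type) (T : zmodType) (sc : S -> T -> T) (ox oy ot : T -> T).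
Local Notation "a ** v" := (sc a v) (at level 40).

Definition m2add (A B : mx2 T) : mx2 T :=
  ((A.1.1 + B.1.1, A.1.2 + B.1.2), (A.2.1 + B.2.1, A.2.2 + B.2.2)).
Definition m2opp : mx2 T -> mx2 T := map2 -%R.
Definition m2l (A : mx2 S) (B : mx2 T) : mx2 T :=
  ((A.1.1 ** B.1.1 + A.1.2 ** B.2.1, A.1.1 ** B.1.2 + A.1.2 ** B.2.2),
   (A.2.1 ** B.1.1 + A.2.2 ** B.2.1, A.2.1 ** B.1.2 + A.2.2 ** B.2.2)).
Definition m2r (A : mx2 T) (B : mx2 S) : mx2 T :=
  ((B.1.1 ** A.1.1 + B.2.1 ** A.1.2, B.1.2 ** A.1.1 + B.2.2 ** A.1.2),
   (B.1.1 ** A.2.1 + B.2.1 ** A.2.2, B.1.2 ** A.2.1 + B.2.2 ** A.2.2)).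
Definition m2adj (A : mx2 T) : mx2 T := ((A.2.2, - A.1.2), (- A.2.1, A.1.1)).
(* [A adj(B)] and [adj(A) B], the adjugate being applied to the scalar matrix. *)
Definition m2radj (A : mx2 T) (B : mx2 S) : mx2 T :=
  ((B.2.2 ** A.1.1 - B.2.1 ** A.1.2, B.1.1 ** A.1.2 - B.1.2 ** A.1.1),
   (B.2.2 ** A.2.1 - B.2.1 ** A.2.2, B.1.1 ** A.2.2 - B.1.2 ** A.2.1)).
Definition m2ladj (A : mx2 S) (B : mx2 T) : mx2 T :=
  ((A.2.2 ** B.1.1 - A.1.2 ** B.2.1, A.2.2 ** B.1.2 - A.1.2 ** B.2.2),
   (A.1.1 ** B.2.1 - A.2.1 ** B.1.1, A.1.1 ** B.2.2 - A.2.1 ** B.1.2)).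
Definition m2scal (A : mx2 S) (d : T) : mx2 T := map2 (fun a => a ** d) A.
Definition m2scal_adj (A : mx2 S) (d : T) : mx2 T :=
  ((A.2.2 ** d, - (A.1.2 ** d)), (- (A.2.1 ** d), A.1.1 ** d)).
Definition m2tr (A : mx2 T) : T := A.1.1 + A.2.2.
(* Twice the traceless part. *)
Definition m2tl (A : mx2 T) : T * T * T :=
  (A.1.1 - A.2.2, A.1.2 + A.1.2, A.2.1 + A.2.1).
Definition t3mx (F : T * T * T) : mx2 T := ((F.1.1, F.1.2), (F.2, - F.1.1)).
Definition t3add (u v : T * T * T) : T * T * T :=
  (u.1.1 + v.1.1, u.1.2 + v.1.2, u.2 + v.2).

(* Twice the action on [nvec], to avoid divisions.  The even blocks act by    *)
(* commutators and a central term.  For ox = oy = ot = 0 this is the adjoint  *)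
(* action on the derivations of psl(2|2), d being the outer sl(2).            *)
Definition nact2 (X : blocks S) (n : nvec T) : nvec T :=
  let: Blocks P B C Q a b := X in
  let F := t3mx (nF n) in let G := t3mx (nG n) in
  let be := nbe n in let ga := nga n in let: (d1, d2, d4) := nd n in
  let z m := P.1.1 ** ot m + P.2.2 ** ot m + a ** ox m + b ** oy m in
  let dbl := map2 (fun m => m + m) in
  let p1 m := m + ot m in let q1 m := m - ot m in
  let w1 := m2tr (m2l B (m2adj be)) in let w2 := m2tr (m2l B ga) + m2tr (m2r be C) in
  let w3 := m2tr (m2l C (m2adj ga)) in
  Nvec
    (m2tl (m2add (m2add (m2add (m2l P F) (m2opp (m2r F P))) (map2 z F))
      (m2add (m2add (map2 ox (m2l B (m2adj be))) (map2 p1 (m2l B ga)))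
        (m2add (m2opp (map2 oy (m2r (m2adj ga) C))) (map2 q1 (m2r be C))))))
    (m2tl (m2add (m2add (m2add (m2l Q G) (m2opp (m2r G Q))) (map2 z G))
      (m2add (m2r ga B) (m2l C be))))
    (dbl (m2add (m2add (m2add (m2l P be) (m2opp (m2r be Q))) (map2 z be))
      (m2add (m2add (m2opp (m2r F B)) (map2 p1 (m2l B G)))
        (m2add (map2 oy (m2ladj C G)) (m2add (m2scal B d1) (m2scal_adj C d4))))))
    (dbl (m2add (m2add (m2add (m2l Q ga) (m2opp (m2r ga P))) (map2 z ga))
      (m2add (m2add (m2l C F) (m2opp (map2 q1 (m2r G C))))
        (m2add (map2 ox (m2radj G B)) (m2add (m2scal_adj B d2) (m2opp (m2scal C d1)))))))
    (t3add (z d1 + z d1, z d2 + z d2, z d4 + z d4)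
      (ox w1 - oy w3, ox w2 + (ot w3 + ot w3), (ot w1 + ot w1) + oy w2)).

(* The module is cut out by the vanishing of this function. *)
Definition nconstr (n : nvec T) : T :=
  let: (d1, d2, d4) := nd n in ox d4 - oy d2 - (ot d1 + ot d1).
End Action.

Section ActionMorphism.
Variables (S S' : Type) (T T' : zmodType) (g : S -> S') (f : T -> T').
Variables (sc : S -> T -> T) (ox oy ot : T -> T).
Variables (sc' : S' -> T' -> T') (ox' oy' ot' : T' -> T').
Hypotheses (fD : {morph f : u v / u + v}) (fN : {morph f : u / - u}).
Hypotheses (fsc : forall a v, f (sc a v) = sc' (g a) (f v)).
Hypotheses (fx : {morph f : v / ox v >-> ox' v}) (fy : {morph f : v / oy v >-> oy' v}).
Hypothesis ft : {morph f : v / ot v >-> ot' v}.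

Local Notation f2 := (map2 f).
Local Notation g2 := (map2 g).
Local Notation f3 := (map3 f).

Let m2addf A B : f2 (m2add A B) = m2add (f2 A) (f2 B).
Proof. by rewrite /map2 /m2add /= !fD. Qed.
Let m2lf A B : f2 (m2l sc A B) = m2l sc' (g2 A) (f2 B).
Proof. by rewrite /map2 /m2l /= !fD !fsc. Qed.
Let m2rf A B : f2 (m2r sc A B) = m2r sc' (f2 A) (g2 B).
Proof. by rewrite /map2 /m2r /= !fD !fsc. Qed.
Let m2adjf A : f2 (m2adj A) = m2adj (f2 A).
Proof. by rewrite /map2 /m2adj /= !fN. Qed.
Let m2radjf A B : f2 (m2radj sc A B) = m2radj sc' (f2 A) (g2 B).
Proof. by rewrite /map2 /m2radj /= !fD !fN !fsc. Qed.
Let m2ladjf A B : f2 (m2ladj sc A B) = m2ladj sc' (g2 A) (f2 B).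
Proof. by rewrite /map2 /m2ladj /= !fD !fN !fsc. Qed.
Let m2scalf A d : f2 (m2scal sc A d) = m2scal sc' (g2 A) (f d).
Proof. by rewrite /map2 /m2scal /= !fsc. Qed.
Let m2scal_adjf A d : f2 (m2scal_adj sc A d) = m2scal_adj sc' (g2 A) (f d).
Proof. by rewrite /map2 /m2scal_adj /= !fN !fsc. Qed.
Let m2trf A : f (m2tr A) = m2tr (f2 A).
Proof. exact: fD. Qed.
Let m2tlf A : f3 (m2tl A) = m2tl (f2 A).
Proof. by rewrite /map3 /m2tl /= !fD fN. Qed.
Let t3mxf F : f2 (t3mx F) = t3mx (f3 F).
Proof. by rewrite /map2 /t3mx /= fN. Qed.
Let m2fun_f (h : T -> T) h' A : (forall v, f (h v) = h' (f v)) -> f2 (map2 h A) = map2 h' (f2 A).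
Proof. by move=> e; rewrite /map2 /= !e. Qed.

(** [nact2] is a fixed formula, hence natural in its coefficients. This carries the action from V to
    [trivext], where its identities are checked. *)
Lemma nact2_morph X n : map_nvec f (nact2 sc ox oy ot X n) =
  nact2 sc' ox' oy' ot' (map_blocks g X) (map_nvec f n).
Proof.
case: n X => [F G b c [[d1 d2] d4]] [P B C Q u v].
have zf m : f (sc P.1.1 (ot m) + sc P.2.2 (ot m) + sc u (ox m) + sc v (oy m)) =
    sc' (g P.1.1) (ot' (f m)) + sc' (g P.2.2) (ot' (f m)) + sc' (g u) (ox' (f m))
      + sc' (g v) (oy' (f m)) by rewrite !fD !fsc fx fy !ft.
have p1f m : f (m + ot m) = f m + ot' (f m) by rewrite fD ft.
have q1f m : f (m - ot m) = f m - ot' (f m) by rewrite fD fN ft.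
have dblf m : f (m + m) = f m + f m by exact: fD.
have opf A : f2 (m2opp A) = m2opp (f2 A) by exact: m2fun_f.
have nF2 A : f2 (map2 (fun m => sc P.1.1 (ot m) + sc P.2.2 (ot m) + sc u (ox m) + sc v (oy m)) A) =
    map2 (fun m => sc' (g P.1.1) (ot' m) + sc' (g P.2.2) (ot' m) + sc' (g u) (ox' m)
      + sc' (g v) (oy' m)) (f2 A) by exact: m2fun_f.
have P1 A : f2 (map2 (fun m => m + ot m) A) = map2 (fun m => m + ot' m) (f2 A).
  exact: m2fun_f.
have Q1 A : f2 (map2 (fun m => m - ot m) A) = map2 (fun m => m - ot' m) (f2 A).
  exact: m2fun_f.
have X1 A : f2 (map2 ox A) = map2 ox' (f2 A) by exact: m2fun_f.
have Y1 A : f2 (map2 oy A) = map2 oy' (f2 A) by exact: m2fun_f.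
have D1 A : f2 (map2 (fun m => m + m) A) = map2 (fun m => m + m) (f2 A).
  exact: m2fun_f.
rewrite /nact2 /map_blocks /map_nvec; cbv beta iota zeta delta [nF nG nbe nga nd bP bB bC bQ bx by_].
pose E := (m2addf, opf, m2lf, m2rf, m2adjf, m2radjf, m2ladjf, m2scalf, m2scal_adjf, t3mxf).
congr Nvec.
- by rewrite m2tlf !E nF2 P1 Q1 X1 Y1 !E.
- by rewrite m2tlf !E nF2 !E.
- by rewrite D1 !E nF2 P1 Y1 !E.
- by rewrite D1 !E nF2 Q1 X1 !E.
rewrite /map3 /t3add /= !(zf, fD, fN, fx, fy, ft, m2trf, m2lf, m2rf, m2adjf).
by [].
Qed.

End ActionMorphism.

(* Parity: [p i v] is meant as "v has degree i". *)
Section ActionParity.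
Variables (K : pzRingType) (T : lmodType K) (ox oy ot : T -> T) (p : bool -> T -> Prop).
Hypotheses (p0 : forall i, p i 0) (pD : forall i u v, p i u -> p i v -> p i (u + v)).
Hypotheses (pN : forall i u, p i u -> p i (- u)).
Hypothesis pZ : forall i (a : K) u, p i u -> p i (a *: u).
Hypotheses (px : forall i u, p i u -> p i (ox u)) (py : forall i u, p i u -> p i (oy u)).
Hypothesis pt : forall i u, p i u -> p i (ot u).
Local Notation sc := (fun (a : K) (v : T) => a *: v).

Definition par2 i (A : mx2 T) := [/\ p i A.1.1, p i A.1.2, p i A.2.1 & p i A.2.2].
Definition par3 i (u : T * T * T) := [/\ p i u.1.1, p i u.1.2 & p i u.2].
Definition nparity i (n : nvec T) :=
  [/\ par3 i (nF n), par3 i (nG n), par2 (~~ i) (nbe n), par2 (~~ i) (nga n) & par3 i (nd n)].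

Let P2D i A B : par2 i A -> par2 i B -> par2 i (m2add A B).
Proof. by move=> [? ? ? ?] [? ? ? ?]; split; exact: pD. Qed.
Let P2N i A : par2 i A -> par2 i (m2opp A).
Proof. by move=> [? ? ? ?]; split; exact: pN. Qed.
Let P2f i (f : T -> T) A : (forall u, p i u -> p i (f u)) -> par2 i A -> par2 i (map2 f A).
Proof. by move=> pf [? ? ? ?]; split; exact: pf. Qed.
Let P2l i A B : par2 i B -> par2 i (m2l sc A B).
Proof. by move=> [? ? ? ?]; split; apply: pD; exact: pZ. Qed.
Let P2r i A B : par2 i A -> par2 i (m2r sc A B).
Proof. by move=> [? ? ? ?]; split; apply: pD; exact: pZ. Qed.
Let P2adj i A : par2 i A -> par2 i (m2adj A).
Proof. by move=> [? ? ? ?]; split=> //; exact: pN. Qed.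
Let P2radj i A B : par2 i A -> par2 i (m2radj sc A B).
Proof. by move=> [? ? ? ?]; split; apply: pD; do ?apply: pN; exact: pZ. Qed.
Let P2ladj i A B : par2 i B -> par2 i (m2ladj sc A B).
Proof. by move=> [? ? ? ?]; split; apply: pD; do ?apply: pN; exact: pZ. Qed.
Let P2s i A d : p i d -> par2 i (m2scal sc A d).
Proof. by move=> ?; split; exact: pZ. Qed.
Let P2sa i A d : p i d -> par2 i (m2scal_adj sc A d).
Proof. by move=> ?; split; do ?apply: pN; exact: pZ. Qed.
Let P2tr i A : par2 i A -> p i (m2tr A).
Proof. by move=> [? ? ? ?]; exact: pD. Qed.
Let P3tl i A : par2 i A -> par3 i (m2tl A).
Proof. by move=> [? ? ? ?]; split; apply: pD => //; exact: pN. Qed.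
Let P2mx i F : par3 i F -> par2 i (t3mx F).
Proof. by move=> [? ? ?]; split=> //; exact: pN. Qed.
Let P3D i u v : par3 i u -> par3 i v -> par3 i (t3add u v).
Proof. by move=> [? ? ?] [? ? ?]; split; exact: pD. Qed.

Lemma nact2_parity d i X n : nparity i n ->
  (if d then [/\ bP X = ((0, 0), (0, 0)), bQ X = ((0, 0), (0, 0)), bx X = 0 & by_ X = 0]
   else bB X = ((0, 0), (0, 0)) /\ bC X = ((0, 0), (0, 0))) ->
  nparity (d (+) i) (nact2 sc ox oy ot X n).
Proof.
case: n X => [F G b c [[d1 d2] d4]] [P B C Q x y] [/= hF hG hb hc [/= h1 h2 h4]].
have l0 j A : par2 j (m2l sc ((0, 0), (0, 0)) A).
  by split; rewrite /= !scale0r addr0; exact: p0.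
have r0 j A : par2 j (m2r sc A ((0, 0), (0, 0))).
  by split; rewrite /= !scale0r addr0; exact: p0.
have s0 j v : par2 j (m2scal sc ((0, 0), (0, 0)) v).
  by split; rewrite /= !scale0r; exact: p0.
have sa0 j v : par2 j (m2scal_adj sc ((0, 0), (0, 0)) v).
  by split; rewrite /= !scale0r ?oppr0; exact: p0.
have la0 j A : par2 j (m2ladj sc ((0, 0), (0, 0)) A).
  by split; rewrite /= !scale0r subr0; exact: p0.
have ra0 j A : par2 j (m2radj sc A ((0, 0), (0, 0))).
  by split; rewrite /= !scale0r subr0; exact: p0.
have q1 j u : p j u -> p j (u + ot u) by move=> h; apply: pD => //; exact: pt.
have q2 j u : p j u -> p j (u - ot u) by move=> h; apply: pD => //; apply: pN; exact: pt.
have q3 j u : p j u -> p j (u + u) by move=> h; exact: pD.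
have nn j : ~~ ~~ j = j by exact: negbK.
have z0 j u : p j (0 *: u) by rewrite scale0r; exact: p0.
have eF := P2mx hF; have eG := P2mx hG.
case: d => /=.
  move=> [-> -> -> ->].
  have z j : forall u, p j (0 *: ot u + 0 *: ot u + 0 *: ox u + 0 *: oy u).
    by move=> u; do ?apply: pD; exact: z0.
  have mz j A : par2 j (map2 (fun m => 0 *: ot m + 0 *: ot m + 0 *: ox m + 0 *: oy m) A).
    by split; exact: z.
    split; rewrite /= ?nn.
  - apply: P3tl; apply: P2D; first by apply: P2D => //; apply: P2D => //; apply: P2N.
    apply: P2D; apply: P2D; do ?apply: P2N;
    (apply: P2f; [by move=> ?; do ?[exact: px|exact: py|exact: q1|exact: q2]|]).
    + by apply: P2l; exact: P2adj.
    + exact: P2l.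
    + by apply: P2r; exact: P2adj.
    + exact: P2r.
  - apply: P3tl; apply: P2D; first by apply: P2D => //; apply: P2D => //; apply: P2N.
    by apply: P2D; [exact: P2r|exact: P2l].
  - apply: P2f; first exact: q3.
    apply: P2D; first by apply: P2D => //; apply: P2D => //; apply: P2N.
    apply: P2D; first by apply: P2D; [apply: P2N; exact: P2r|apply: P2f; [exact: q1|exact: P2l]].
    apply: P2D; first by apply: P2f; [exact: py|exact: P2ladj].
    by apply: P2D; [exact: P2s|exact: P2sa].
  - apply: P2f; first exact: q3.
    apply: P2D; first by apply: P2D => //; apply: P2D => //; apply: P2N.
    apply: P2D; first by apply: P2D; [exact: P2l|apply: P2N; apply: P2f; [exact: q2|exact: P2r]].
    apply: P2D; first by apply: P2f; [exact: px|exact: P2radj].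
    by apply: P2D; [exact: P2sa|apply: P2N; exact: P2s].
  - apply: P3D; first by split; exact: q3.
    have w1 : p (~~ i) (m2tr (m2l sc B (m2adj b))) by apply: P2tr; apply: P2l; exact: P2adj.
    have w2 : p (~~ i) (m2tr (m2l sc B c) + m2tr (m2r sc b C)).
      by apply: pD; apply: P2tr; [exact: P2l|exact: P2r].
    have w3 : p (~~ i) (m2tr (m2l sc C (m2adj c))) by apply: P2tr; apply: P2l; exact: P2adj.
    split; rewrite /=; apply: pD; do ?[apply: pN]; do ?[apply: px|apply: py] => //.
    + by apply: q3; exact: pt.
    + by apply: q3; exact: pt.
move=> [-> ->].
have z j u : p j u -> p j (P.1.1 *: ot u + P.2.2 *: ot u + x *: ox u + y *: oy u).
  by move=> h; do ?apply: pD; apply: pZ; [exact: pt|exact: pt|exact: px|exact: py].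
split; rewrite /=.
- apply: P3tl; apply: P2D.
    apply: P2D; last exact: P2f (z i) _.
    by apply: P2D; [exact: P2l|apply: P2N; exact: P2r].
  apply: P2D; apply: P2D; do ?apply: P2N;
    (apply: P2f; [by move=> ?; do ?[exact: px|exact: py|exact: q1|exact: q2]|]) => //.
- apply: P3tl; apply: P2D.
    apply: P2D; last exact: P2f (z i) _.
    by apply: P2D; [exact: P2l|apply: P2N; exact: P2r].
  by apply: P2D.
- apply: P2f; first exact: q3.
  apply: P2D.
    apply: P2D; last exact: P2f (z (~~ i)) _.
    by apply: P2D; [exact: P2l|apply: P2N; exact: P2r].
  apply: P2D; first by apply: P2D; [exact: P2N|apply: P2f; [exact: q1|]].
  by apply: P2D; [apply: P2f; [exact: py|]|exact: P2D].
- apply: P2f; first exact: q3.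
  apply: P2D.
    apply: P2D; last exact: P2f (z (~~ i)) _.
    by apply: P2D; [exact: P2l|apply: P2N; exact: P2r].
  apply: P2D; first by apply: P2D; [|apply: P2N; apply: P2f; [exact: q2|]].
  by apply: P2D; [apply: P2f; [exact: px|]|apply: P2D; [|exact: P2N]].
- apply: P3D; first by split; apply: q3; exact: z.
  have w1 : p i (m2tr (m2l sc ((0, 0), (0, 0)) (m2adj b))) by apply: P2tr; exact: l0.
  have w2 : p i (m2tr (m2l sc ((0, 0), (0, 0)) c) + m2tr (m2r sc b ((0, 0), (0, 0)))).
    by apply: pD; apply: P2tr; [exact: l0|exact: r0].
  have w3 : p i (m2tr (m2l sc ((0, 0), (0, 0)) (m2adj c))) by apply: P2tr; exact: l0.
  split; rewrite /=; apply: pD; do ?[apply: pN]; do ?[apply: px|apply: py] => //.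
  + by apply: q3; exact: pt.
  + by apply: q3; exact: pt.
Qed.
End ActionParity.

Section RingIdentities.
Variables (R : comNzRingType) (x y t : R).
Local Notation mul := (@GRing.mul R).
Local Notation rN := (nact2 mul (mul x) (mul y) (mul t)).
Local Notation mm := (m2l mul).

Definition nadd (m n : nvec R) : nvec R :=
  Nvec (t3add (nF m) (nF n)) (t3add (nG m) (nG n)) (m2add (nbe m) (nbe n))
    (m2add (nga m) (nga n)) (t3add (nd m) (nd n)).
Definition nscale (c : R) : nvec R -> nvec R := map_nvec (mul c).
Definition m2sub (A B : mx2 R) := m2add A (m2opp B).
Definition z2 : mx2 R := ((0, 0), (0, 0)).
(* The polarization of the determinant. *)
Definition m2pol (A B : mx2 R) : R :=
  A.1.1 * B.2.2 + A.2.2 * B.1.1 - A.1.2 * B.2.1 - A.2.1 * B.1.2.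
Definition r_ev P Q a b := Blocks P z2 z2 Q a b.
Definition r_od B C := Blocks z2 B C z2 (0 : R) 0.

(* The even and the odd part of the action, without the vanishing terms,      *)
(* which would slow down ring.                                                *)
Definition ev_act (P Q : mx2 R) (a b : R) (n : nvec R) : nvec R :=
  let z m := (P.1.1 + P.2.2) * (t * m) + a * (x * m) + b * (y * m) in
  let: (f, fp, fm) := nF n in let: (g, gp, gm) := nG n in
  let sl2 (A : mx2 R) (u up um : R) :=
    ((A.1.2 * um - A.2.1 * up) + (A.1.2 * um - A.2.1 * up) + (z u + z u),
     (A.1.1 * up - A.2.2 * up - (A.1.2 * u + A.1.2 * u))
       + (A.1.1 * up - A.2.2 * up - (A.1.2 * u + A.1.2 * u)) + (z up + z up),
     (A.2.1 * u + A.2.1 * u + A.2.2 * um - A.1.1 * um)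
       + (A.2.1 * u + A.2.1 * u + A.2.2 * um - A.1.1 * um) + (z um + z um)) in
  let dbl := map2 (fun m => m + m) in
  let: (d1, d2, d4) := nd n in
  Nvec (sl2 P f fp fm) (sl2 Q g gp gm)
    (dbl (m2add (m2sub (m2l mul P (nbe n)) (m2r mul (nbe n) Q)) (map2 z (nbe n))))
    (dbl (m2add (m2sub (m2l mul Q (nga n)) (m2r mul (nga n) P)) (map2 z (nga n))))
    (z d1 + z d1, z d2 + z d2, z d4 + z d4).

Definition od_act (B C : mx2 R) (n : nvec R) : nvec R :=
  let F := t3mx (nF n) in let G := t3mx (nG n) in
  let be := nbe n in let ga := nga n in let: (d1, d2, d4) := nd n in
  let dbl := map2 (fun m => m + m) in
  let p1 m := m + t * m in let q1 m := m - t * m in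
  let w1 := m2pol B be in let w2 := m2tr (m2l mul B ga) + m2tr (m2r mul be C) in
  let w3 := m2pol C ga in
  Nvec
    (m2tl (m2add (m2add (map2 (mul x) (m2l mul B (m2adj be))) (map2 p1 (m2l mul B ga)))
        (m2add (m2opp (map2 (mul y) (m2r mul (m2adj ga) C))) (map2 q1 (m2r mul be C)))))
    (m2tl (m2add (m2r mul ga B) (m2l mul C be)))
    (dbl (m2add (m2add (m2opp (m2r mul F B)) (map2 p1 (m2l mul B G)))
        (m2add (map2 (mul y) (m2ladj mul C G))
          (m2add (m2scal mul B d1) (m2scal_adj mul C d4)))))
    (dbl (m2add (m2add (m2l mul C F) (m2opp (map2 q1 (m2r mul G C))))
        (m2add (map2 (mul x) (m2radj mul G B))
          (m2add (m2scal_adj mul B d2) (m2opp (m2scal mul C d1))))))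
    (x * w1 - y * w3, x * w2 + (t * w3 + t * w3), t * w1 + t * w1 + y * w2).

Definition bladd (X Y : blocks R) := Blocks (m2add (bP X) (bP Y)) (m2add (bB X) (bB Y))
  (m2add (bC X) (bC Y)) (m2add (bQ X) (bQ Y)) (bx X + bx Y) (by_ X + by_ Y).

(** The action of the lift of h, diagonal with eigenvalues 1, 0 and -1; see [nact_hblk] with k =
    1/2. *)
Definition wt (T : zmodType) (n : nvec T) : nvec T :=
  let: Nvec (f, fp, fm) (g, gp, gm) ((b1, b2), (b3, b4)) ((c1, c2), (c3, c4)) d := n in
  Nvec (0, fp, - fm) (0, gp, - gm) ((0, b2), (- b3, 0)) ((0, c2), (- c3, 0)) (0, 0, 0).

Ltac nunfold := cbv beta iota zeta delta [nact2 m2add m2opp m2l m2r m2adj m2radj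
  m2ladj m2scal m2scal_adj m2tr m2tl t3mx t3add map2 map3 map_nvec map_blocks nadd
  nscale bladd m2sub z2 m2pol r_ev r_od nF nG nbe nga nd bP bB bC bQ bx by_ nconstr
  ev_act od_act wt fst snd].
Ltac nsplit := congr Nvec; [congr pair; [congr pair|]|congr pair; [congr pair|]
    |congr pair; congr pair|congr pair; congr pair|congr pair; [congr pair|]].
Ltac nring := nunfold; nsplit; ring.
Ltac ndestruct n :=
  case: n => [[[? ?] ?] [[? ?] ?] [[? ?] [? ?]] [[? ?] [? ?]] [[? ?] ?]].
Ltac bdestruct X :=
  case: X => [[[? ?] [? ?]] [[? ?] [? ?]] [[? ?] [? ?]] [[? ?] [? ?]] ? ?].

Lemma rN_ev P Q a b n : rN (r_ev P Q a b) n = ev_act P Q a b n.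
Proof.
case: P Q => [[p1 p2] [p3 p4]] [[q1 q2] [q3 q4]].
case: n => [[[f fp] fm] [[g gp] gm] [[b1 b2] [b3 b4]] [[c1 c2] [c3 c4]] [[d1 d2] d4]].
nring.
Qed.

Lemma rN_od B C n : rN (r_od B C) n = od_act B C n.
Proof.
case: B C => [[x1 x2] [x3 x4]] [[y1 y2] [y3 y4]].
case: n => [[[f fp] fm] [[g gp] gm] [[b1 b2] [b3 b4]] [[c1 c2] [c3 c4]] [[d1 d2] d4]].
nring.
Qed.

(** The factor 2 on the right accounts for [nact2] being twice an action. The central terms act as
    multiplications and drop out of the commutator. *)
Lemma nact_ee P Q a b P' Q' a' b' n :
  nadd (rN (r_ev P Q a b) (rN (r_ev P' Q' a' b') n))
       (nscale (-1) (rN (r_ev P' Q' a' b') (rN (r_ev P Q a b) n)))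
  = nscale 2%:R (rN (r_ev (m2sub (mm P P') (mm P' P)) (m2sub (mm Q Q') (mm Q' Q)) 0 0) n).
Proof.
rewrite !rN_ev; case: P Q P' Q' => [[p1 p2] [p3 p4]] [[q1 q2] [q3 q4]] [[p1' p2'] [p3' p4']]
  [[q1' q2'] [q3' q4']].
case: n => [[[f fp] fm] [[g gp] gm] [[b1 b2] [b3 b4]] [[c1 c2] [c3 c4]] [[d1 d2] d4]].
nring.
Qed.

(* The vanishing of the supertrace is solved for the last diagonal entry. *)
Lemma nact_eo p1 p2 p3 p4 q1 q2 q3 a b B C n :
  let P := ((p1, p2), (p3, p4)) in let Q := ((q1, q2), (q3, p1 + p4 - q1)) in
  nadd (rN (r_ev P Q a b) (rN (r_od B C) n))
       (nscale (-1) (rN (r_od B C) (rN (r_ev P Q a b) n)))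
  = nscale 2%:R (rN (r_od (m2sub (mm P B) (mm B Q)) (m2sub (mm Q C) (mm C P))) n).
Proof.
case: B C => [[x1 x2] [x3 x4]] [[y1 y2] [y3 y4]].
case: n => [[[f fp] fm] [[g gp] gm] [[b1 b2] [b3 b4]] [[c1 c2] [c3 c4]] [[d1 d2] d4]] P Q.
rewrite !rN_ev !rN_od /P /Q.
nring.
Qed.

Lemma nact_oo B C B' C' n : nconstr (mul x) (mul y) (mul t) n = 0 ->
  nadd (rN (r_od B C) (rN (r_od B' C') n)) (rN (r_od B' C') (rN (r_od B C) n))
  = nscale 2%:R (rN (r_ev (m2add (mm B C') (mm B' C)) (m2add (mm C B') (mm C' B))
                   (m2pol B B') (m2pol C C')) n).
Proof.
rewrite !rN_ev !rN_od; case: B C B' C' => [[x1 x2] [x3 x4]] [[y1 y2] [y3 y4]] [[x1' x2'] [x3' x4']]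
  [[y1' y2'] [y3' y4']].
case: n => [[[f fp] fm] [[g gp] gm] [[b1 b2] [b3 b4]] [[c1 c2] [c3 c4]] [[d1 d2] d4]] L.
(* The relation holds modulo the constraint. Writing P for BC' + B'C, the multiples of the
   constraint to remove are 2 [m2tl] P in [nF], and 2 tr P, 4 [m2pol] C C', -4 [m2pol] B B' in [nd];
   the other coordinates have no defect. *)
have by_L c u v : u = v + c * (x * d4 - y * d2 - (t * d1 + t * d1)) -> u = v.
  by move=> ->; rewrite [X in c * X]L mulr0 addr0.
nunfold; congr Nvec.
- congr pair; [congr pair|].
  + by apply: (by_L (2%:R * (x1 * y1' + x2 * y3' + x1' * y1 + x2' * y3
      - (x3 * y2' + x4 * y4' + x3' * y2 + x4' * y4)))); ring.
  + by apply: (by_L (4%:R * (x1 * y2' + x2 * y4' + x1' * y2 + x2' * y4))); ring.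
  + by apply: (by_L (4%:R * (x3 * y1' + x4 * y3' + x3' * y1 + x4' * y3))); ring.
- congr pair; [congr pair|]; ring.
- congr pair; congr pair; ring.
- congr pair; congr pair; ring.
- congr pair; [congr pair|].
  + by apply: (by_L (2%:R * (x1 * y1' + x2 * y3' + x1' * y1 + x2' * y3
      + (x3 * y2' + x4 * y4' + x3' * y2 + x4' * y4)))); ring.
  + by apply: (by_L (4%:R * (y1 * y4' + y4 * y1' - y2 * y3' - y3 * y2'))); ring.
  + by apply: (by_L (- 4%:R * (x1 * x4' + x4 * x1' - x2 * x3' - x3 * x2'))); ring.
Qed.
Lemma rN_linear_l c X Y n :
  rN (bladd (map_blocks (mul c) X) Y) n = nadd (nscale c (rN X n)) (rN Y n).
Proof. ndestruct n; bdestruct X; bdestruct Y. nring. Qed.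

Lemma rN_linear_r c X m n :
  rN X (nadd (nscale c m) n) = nadd (nscale c (rN X m)) (rN X n).
Proof. ndestruct n; ndestruct m; bdestruct X. nring. Qed.

Lemma rN_scale c X m : rN X (nscale c m) = nscale c (rN X m).
Proof. ndestruct m; bdestruct X. nring. Qed.

Lemma nscale_lin (h a : R) (p q : nvec R) :
  nscale h (nadd (nscale a p) q) = nadd (nscale a (nscale h p)) (nscale h q).
Proof. ndestruct p; ndestruct q. nring. Qed.

Lemma nscaleA (a b : R) (n : nvec R) : nscale a (nscale b n) = nscale (a * b : R) n.
Proof. ndestruct n. nring. Qed.

Lemma nscale_add (h : R) (p q : nvec R) : nscale h (nadd p q) = nadd (nscale h p) (nscale h q).
Proof. ndestruct p; ndestruct q. nring. Qed.

(** The odd blocks contribute nothing to the constraint, since x (2 t w1 + y w2) - y (x w2 + 2 t w3)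
    - 2 t (x w1 - y w3) = 0. The even part multiplies it by the doubled central scalar, which is
    read off from the goal. *)
Lemma nconstr_rN X n : nconstr (mul x) (mul y) (mul t) n = 0 ->
  nconstr (mul x) (mul y) (mul t) (rN X n) = 0.
Proof.
ndestruct n; bdestruct X; nunfold => L.
match type of L with ?l = _ => match goal with |- ?g = _ =>
  match goal with |- context [?a * (t * ?d) + ?b * (t * ?d) + ?u * (x * ?d) + ?w * (y * ?d)] =>
   refine (@eq_by_combination _ (2%:R * (a * t + b * t + u * x + w * y)) 0 0 0 g 0 l 0
     0 0 0 0 0 0 L erefl erefl erefl _) end end end.
ring.
Qed.
Lemma nact_hblk k n :
  nact2 mul (mul x) (mul y) (mul t) (r_ev ((k, 0), (0, - k)) ((k, 0), (0, - k)) 0 0) n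
  = nscale (4%:R * k) (wt n).
Proof.
rewrite rN_ev.
case: n => [[[f fp] fm] [[g gp] gm] [[b1 b2] [b3 b4]] [[c1 c2] [c3 c4]] [[d1 d2] d4]].
by nunfold; nsplit; ring.
Qed.

(** The action of [x, f] on the eigenspace for h = 1. In the coordinates 4 v, 2 v1, 2 v2, - w it
    becomes [ql], with the factors -4, -4, 2 in front of X, Y, T. One half and one quarter enter as
    elements [H] and [k] subject to a relation, because R has no division. *)
Lemma nact_dblk X Y T H k P Q q r v v1 v2 w : 2%:R * H = 1 -> 4%:R * k = 1 ->
  nscale H (nact2 mul (mul (- 4%:R * X)) (mul (- 4%:R * Y)) (mul (2%:R * T))
    (Blocks (((P + Q) * H, 0), (0, - ((P + Q) * H))) ((q * H, 0), (0, - (q * H)))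
      ((r * H, 0), (0, - (r * H))) (((P - Q) * H, 0), (0, - ((P - Q) * H))) 0 0)
    (Nvec (0, 4%:R * v, 0) (0, - w, 0) ((0, 2%:R * v1), (0, 0)) ((0, 2%:R * v2), (0, 0)) (0, 0, 0)))
  = Nvec (0, 4%:R * ((P + Q) * v + q * (X * v1 + (k * v2 + (k + k) * (T * v2)))
               + r * (- k * v1 + (k + k) * (T * v1) + Y * v2)), 0)
      (0, - ((P - Q) * w + q * v2 - r * v1), 0)
      ((0, 2%:R * (P * v1 + q * (v - (k * w + (k + k) * (T * w))) - r * (Y * w))), (0, 0))
      ((0, 2%:R * (P * v2 + q * (X * w) + r * (v + (- k * w + (k + k) * (T * w))))), (0, 0))
      (0, 0, 0).
Proof.
move=> h2 h4.
have e1 : 2%:R * H - 1 = 0 by rewrite h2 subrr.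
have e2 : H - 2%:R * k = 0.
  have e4 : 4%:R * k - 1 = 0 by rewrite h4 subrr.
  apply: (@eq0_by_combination _ (2%:R * k) (- H) 0 _ _ _ 0 e1 e4 _) => //; ring.
nunfold; nsplit; do 1?ring; apply: subr0_eq.
- pose E := 4%:R * ((P + Q) * v) + 4%:R * (q * (X * v1)) + (1 + 2%:R * T) * q * v2
    + 4%:R * (r * (Y * v2)) - (1 - 2%:R * T) * r * v1.
  pose G := q * v2 + 2%:R * T * q * v2 - r * v1 + 2%:R * T * r * v1.
  apply: (@eq0_by_combination _ ((2%:R * H + 1) * E - G) (2%:R * G) 0 _ _ _ 0 e1 e2 _) => //.
  rewrite /E /G; ring.
- apply: (@eq0_by_combination _ (- ((2%:R * H + 1) * ((P - Q) * w + q * v2 - r * v1))) 0 0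
    _ _ 0 0 e1 _ _) => //.
  ring.
- pose E := 4%:R * (P * v1) + 4%:R * (q * v) - (1 + 2%:R * T) * q * w - 4%:R * (r * (Y * w)).
  apply: (@eq0_by_combination _ (H * E + 2%:R * (P * v1 + q * v - r * (Y * w)))
    (- ((1 + 2%:R * T) * q * w)) 0 _ _ _ 0 e1 e2 _) => //.
  rewrite /E; ring.
- pose E := 4%:R * (P * v2) + 4%:R * (r * v) - (1 - 2%:R * T) * r * w + 4%:R * (q * (X * w)).
  apply: (@eq0_by_combination _ (H * E + 2%:R * (P * v2 + r * v + q * (X * w)))
    (- ((1 - 2%:R * T) * r * w)) 0 _ _ _ 0 e1 e2 _) => //.
  rewrite /E; ring.
Qed.
(** Central elements act through polynomials in x, y, t without constant term, which makes them
    nilpotent as soon as x, y, t are. *)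
Lemma nact_scalar c a b n :
  nact2 mul (mul x) (mul y) (mul t) (r_ev ((c, 0), (0, c)) ((c, 0), (0, c)) a b) n
  = nscale (2%:R * (2%:R * c * t + a * x + b * y)) n.
Proof.
rewrite rN_ev.
case: n => [[[f fp] fm] [[g gp] gm] [[b1 b2] [b3 b4]] [[c1 c2] [c3 c4]] [[d1 d2] d4]].
by nunfold; nsplit; ring.
Qed.
End RingIdentities.

(** * The central extension E and its two cocycles *)

Section CentralExtension.
Variable K : fieldType.
Local Notation par := par22.
Local Notation sl22 := (sl K par22).

Definition o0 : 'I_4 := @Ordinal 4 0 isT.
Definition o1 : 'I_4 := @Ordinal 4 1 isT.
Definition o2 : 'I_4 := @Ordinal 4 2 isT.
Definition o3 : 'I_4 := @Ordinal 4 3 isT.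

Lemma sum4 (V : nmodType) (F : 'I_4 -> V) : \sum_i F i = F o0 + F o1 + F o2 + F o3.
Proof.
rewrite !big_ord_recl big_ord0 addr0 !addrA.
by congr (F _ + F _ + F _ + F _); apply: val_inj.
Qed.

Definition E_sort : lmodType K := (sl22 * (K^o * K^o))%type.

Definition blk (M : 'M[K]_4) (a b : K) : blocks K := Blocks
  ((M o0 o0, M o0 o1), (M o1 o0, M o1 o1)) ((M o0 o2, M o0 o3), (M o1 o2, M o1 o3))
  ((M o2 o0, M o2 o1), (M o3 o0, M o3 o1)) ((M o2 o2, M o2 o3), (M o3 o2, M o3 o3)) a b.
Definition blocks_of (u : E_sort) : blocks K := blk (sl_val u.1) u.2.1 u.2.2.

Lemma ord4E (i : 'I_4) : [\/ i = o0, i = o1, i = o2 | i = o3].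
Proof.
case: i => -[|[|[|[|//]]]] h; [constructor 1|constructor 2|constructor 3|constructor 4];
  exact: val_inj.
Qed.

Lemma blocks_of_inj u v : blocks_of u = blocks_of v -> u = v.
Proof.
case: u v => [[A hA] [a b]] [[B hB] [c d]]; rewrite /blocks_of /blk /= => -[].
move=> ? ? ? ? ? ? ? ? ? ? ? ? ? ? ? ? -> ->; congr pair; apply: val_inj => /=.
by apply/matrixP => i j; case: (ord4E i) => ->; case: (ord4E j) => ->.
Qed.

Local Notation mul := (@GRing.mul K).
Local Notation "A *2 B" := (m2l mul A B) (at level 40).
Local Notation "A -2 B" := (m2sub A B) (at level 50).
Local Notation "A +2 B" := (m2add A B) (at level 50).

Definition E_br (u v : E_sort) : E_sort :=
  (sl_bracket u.1 v.1, (m2pol (bB (blocks_of u)) (bB (blocks_of v)),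
                        m2pol (bC (blocks_of u)) (bC (blocks_of v)))).
Definition Elie_gr (i : bool) (u : E_sort) : Prop :=
  sl_gr i u.1 /\ (i -> u.2 = 0).

Definition b_even (X : blocks K) := bB X = z2 K /\ bC X = z2 K.
Definition b_odd (X : blocks K) :=
  [/\ bP X = z2 K, bQ X = z2 K, bx X = 0 & by_ X = 0].

Lemma E_even u : Elie_gr false u -> b_even (blocks_of u).
Proof.
move=> [h _]; have e i j : sl_val u.1 i j = mxpart par false (sl_val u.1) i j by rewrite h.
by split; rewrite /= !e !mxE.
Qed.

Lemma E_odd u : Elie_gr true u -> b_odd (blocks_of u).
Proof.
move=> [h h0]; have e i j : sl_val u.1 i j = mxpart par true (sl_val u.1) i j by rewrite h.
by split; rewrite /= ?h0 // !e !mxE.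
Qed.

Lemma E_trace u : let X := blocks_of u in
  (bQ X).2.2 = (bP X).1.1 + (bP X).2.2 - (bQ X).1.1.
Proof.
have := sl_valP u.1; rewrite unfold_in /supertrace sum4 => /eqP /= h.
apply: subr0_eq; rewrite -[RHS]oppr0 -[in RHS]h /ksgn /=.
by rewrite expr0 expr1; ring.
Qed.

Ltac bunfold := cbv beta iota zeta delta [blocks_of blk E_br sl_bracket sl_val bP bB bC bQ
  bx by_ m2sub m2add m2opp map2 z2 m2l m2pol fst snd].

Lemma blocks_even_l u v : b_even (blocks_of u) ->
  let X := blocks_of u in let Y := blocks_of v in
  blocks_of (E_br u v) = Blocks (bP X *2 bP Y -2 bP Y *2 bP X) (bP X *2 bB Y -2 bB Y *2 bQ X)
    (bQ X *2 bC Y -2 bC Y *2 bP X) (bQ X *2 bQ Y -2 bQ Y *2 bQ X) 0 0.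
Proof.
case: u v => [[A hA] [a b]] [[B hB] [c d]]; bunfold => -[[e1 e2 e3 e4] [e5 e6 e7 e8]] /=.
rewrite !mxE !sum4 !stwist_entry !sum4 !e1 !e2 !e3 !e4 !e5 !e6 !e7 !e8 /ksgn /= ?expr0 ?expr1.
congr Blocks; do ?[congr pair; congr pair]; ring.
Qed.

Lemma blocks_even_r u v : b_even (blocks_of v) ->
  let X := blocks_of u in let Y := blocks_of v in
  blocks_of (E_br u v) = Blocks (bP X *2 bP Y -2 bP Y *2 bP X) (bB X *2 bQ Y -2 bP Y *2 bB X)
    (bC X *2 bP Y -2 bQ Y *2 bC X) (bQ X *2 bQ Y -2 bQ Y *2 bQ X) 0 0.
Proof.
case: u v => [[A hA] [a b]] [[B hB] [c d]]; bunfold => -[[e1 e2 e3 e4] [e5 e6 e7 e8]] /=.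
rewrite !mxE !sum4 !stwist_entry !sum4 !e1 !e2 !e3 !e4 !e5 !e6 !e7 !e8 /ksgn /= ?expr0 ?expr1.
congr Blocks; do ?[congr pair; congr pair]; ring.
Qed.

Lemma blocks_odd u v : b_odd (blocks_of u) -> b_odd (blocks_of v) ->
  let X := blocks_of u in let Y := blocks_of v in
  blocks_of (E_br u v) = Blocks (bB X *2 bC Y +2 bB Y *2 bC X) (z2 K) (z2 K)
    (bC X *2 bB Y +2 bC Y *2 bB X) (m2pol (bB X) (bB Y)) (m2pol (bC X) (bC Y)).
Proof.
case: u v => [[A hA] [a b]] [[B hB] [c d]]; bunfold.
move=> [[e1 e2 e3 e4] [e5 e6 e7 e8] _ _] [[e1' e2' e3' e4'] [e5' e6' e7' e8'] _ _] /=.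
rewrite !mxE !sum4 !stwist_entry !sum4 !e1 !e2 !e3 !e4 !e5 !e6 !e7 !e8.
rewrite !e1' !e2' !e3' !e4' !e5' !e6' !e7' !e8' /ksgn /= ?expr0 ?expr1.
congr Blocks; do ?[congr pair; congr pair]; ring.
Qed.

Arguments blocks_of : simpl never.

Definition badd (X Y : blocks K) := Blocks (bP X +2 bP Y) (bB X +2 bB Y) (bC X +2 bC Y)
  (bQ X +2 bQ Y) (bx X + bx Y) (by_ X + by_ Y).

Lemma blocks_linear a u v :
  blocks_of (a *: u + v) = badd (map_blocks (mul a) (blocks_of u)) (blocks_of v).
Proof.
case: u v => [[A hA] [b c]] [[B hB] [d d']]; bunfold.
by rewrite /map_blocks /badd /m2add /map2 /= !mxE.
Qed.

Lemma blocks_scale a u : blocks_of (a *: u) = map_blocks (mul a) (blocks_of u).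
Proof.
case: u => [[A hA] [b c]]; bunfold.
by rewrite /map_blocks /map2 /= !mxE.
Qed.

Lemma m2pol_linear (R : comNzRingType) a (A B C : mx2 R) :
  m2pol (m2add (map2 (GRing.mul a) A) B) C = a * m2pol A C + m2pol B C.
Proof.
by case: A B C => [[? ?] [? ?]] [[? ?] [? ?]] [[? ?] [? ?]];
  rewrite /m2pol /m2add /map2 /=; ring.
Qed.

Lemma m2polC (R : comNzRingType) (A B : mx2 R) : m2pol A B = m2pol B A.
Proof.
by case: A B => [[? ?] [? ?]] [[? ?] [? ?]]; rewrite /m2pol /=; ring.
Qed.

Lemma m2pol0 (R : comNzRingType) (A : mx2 R) : m2pol (z2 R) A = 0.
Proof. by rewrite /m2pol /= !mul0r !addr0 !subr0. Qed.

Lemma m2pol0r (R : comNzRingType) (A : mx2 R) : m2pol A (z2 R) = 0.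
Proof. by rewrite m2polC m2pol0. Qed.

(** The infinitesimal substitution B |-> PB - BQ multiplies the determinant form by tr P - tr Q,
    which is zero when the supertrace vanishes. This is the cocycle condition. *)
Lemma m2pol_invariant (R : comNzRingType) (P Q A B : mx2 R) :
  Q.2.2 = P.1.1 + P.2.2 - Q.1.1 ->
  m2pol A (m2sub (m2l GRing.mul P B) (m2l GRing.mul B Q))
  + m2pol (m2sub (m2l GRing.mul P A) (m2l GRing.mul A Q)) B = 0.
Proof.
case: P Q A B => [[? ?] [? ?]] [[? ?] [? ?]] [[? ?] [? ?]] [[? ?] [? ?]] /= ->.
by rewrite /m2pol /m2sub /m2add /m2opp /m2l /map2 /=; ring.
Qed.

Lemma polB_linear a u v w : m2pol (bB (blocks_of (a *: u + v))) (bB (blocks_of w))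
  = a * m2pol (bB (blocks_of u)) (bB (blocks_of w))
    + m2pol (bB (blocks_of v)) (bB (blocks_of w)).
Proof. by rewrite blocks_linear m2pol_linear. Qed.

Lemma polC_linear a u v w : m2pol (bC (blocks_of (a *: u + v))) (bC (blocks_of w))
  = a * m2pol (bC (blocks_of u)) (bC (blocks_of w))
    + m2pol (bC (blocks_of v)) (bC (blocks_of w)).
Proof. by rewrite blocks_linear m2pol_linear. Qed.

Lemma E_bilin : bilinear_op E_br.
Proof.
have [_ [sl sr] _ _ _] := @sl_lie K 4 par.
split=> [w a u v|w a u v]; apply: injective_projections; [exact: sl| |exact: sr|].
  by apply: injective_projections; [exact: polB_linear|exact: polC_linear].
apply: injective_projections; rewrite /E_br [X in X = _]m2polC.
  by apply: etrans (polB_linear _ _ _ _) _; congr (_ * _ + _); rewrite m2polC.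
by apply: etrans (polC_linear _ _ _ _) _; congr (_ * _ + _); rewrite m2polC.
Qed.

Lemma E_grading : is_grading Elie_gr.
Proof.
have gs := @sl_grading K 4 par.
split=> [i|i a u v [h1 h2] [h3 h4]|[A [b c]]|u [h1 h2] [h3 h4]].
- by split=> //; exact: (gr0 gs).
- split; first exact: (grZD gs).
  move=> i1; apply: etrans (_ : a *: u.2 + v.2 = 0); first by [].
  by rewrite h2 // h4 // scaler0 addr0.
- exists (grpart gs false A, (b, c)), (grpart gs true A, 0).
  split; [by split=> //; exact: grpart_gr|by split=> //; exact: grpart_gr|].
  apply: injective_projections; first exact: grpart_sum.
  by apply: injective_projections; rewrite /= addr0.
- case: u {h2} h1 h3 h4 => A b h1 h3 h4.
  by apply: injective_projections; [exact: (gr_eq0 gs h1 h3)|rewrite h4].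
Qed.

Lemma E_br2 u v : (E_br u v).2 =
  (m2pol (bB (blocks_of u)) (bB (blocks_of v)), m2pol (bC (blocks_of u)) (bC (blocks_of v))).
Proof. by []. Qed.

Lemma E_br_gr : graded_op Elie_gr Elie_gr Elie_gr E_br.
Proof.
have [_ _ gg _ _] := @sl_lie K 4 par.
move=> i j u v hu hv; split; first by case: hu hv => hu _ [hv _]; exact: gg.
have pol0 x y : Elie_gr false x -> (E_br x y).2 = 0.
  by move=> /E_even[eB eC]; rewrite E_br2 eB eC !m2pol0.
have pol0r x y : Elie_gr false y -> (E_br x y).2 = 0.
  by move=> /E_even[eB eC]; rewrite E_br2 eB eC !m2pol0r.
by case: i hu => hu; case: j hv => hv //= _; [exact: pol0r|exact: pol0].
Qed.

Lemma E_skew i j u v : Elie_gr i u -> Elie_gr j v -> E_br u v = - (ksgn i j *: E_br v u).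
Proof.
have [_ _ _ sk _] := @sl_lie K 4 par.
move=> hu hv; apply: injective_projections.
  by case: hu hv => hu _ [hv _]; exact: sk.
have -> : (- (ksgn i j *: E_br v u)).2 = - (ksgn i j *: (E_br v u).2) by [].
rewrite !E_br2 ![m2pol _ (_ (blocks_of u))]m2polC.
case: i hu => [/E_odd hu|/E_even[eB eC]]; last first.
  by rewrite eB eC !(m2pol0, m2pol0r) scaler0 oppr0.
case: j hv => [/E_odd hv|/E_even[eB eC]]; last first.
  by rewrite eB eC !(m2pol0, m2pol0r) scaler0 oppr0.
by rewrite /ksgn /= expr1 scaleN1r opprK.
Qed.

(** The matrix part is the Jacobi identity of sl(2|2). The central coordinates vanish by parity
    unless exactly two of u, v, w are odd; then the even one acts by B |-> PB - BQ and C |-> QC -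
    CP, and the identity reduces to [m2pol_invariant], with P and Q exchanged for the block C. *)
Lemma E_jacobi i j u v w : Elie_gr i u -> Elie_gr j v ->
  E_br u (E_br v w) = E_br (E_br u v) w + ksgn i j *: E_br v (E_br u w).
Proof.
have [_ _ _ _ jac] := @sl_lie K 4 par.
move=> hu hv; apply: injective_projections.
  by case: hu hv => hu _ [hv _]; exact: jac.
have [bl br] := E_bilin.
have sgD c (x y : E_sort) : (x + c *: y).2 = x.2 + c *: y.2 by [].
move: w; apply: (gr_ind E_grading) => [w w'|k w hw].
  rewrite !sgD !(linD (br _)) => e e'.
  have e2 (x y : E_sort) : (x + y).2 = x.2 + y.2 by [].
  by rewrite !e2 e e' scalerDr addrACA.
have hvw := E_br_gr hv hw; have huw := E_br_gr hu hw; have huv := E_br_gr hu hv.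
have trw := E_trace w; have tru := E_trace u; have trv := E_trace v.
have pairD (a b c d e f : K) s : a = c + s * e -> b = d + s * f ->
    ((a, b) : K^o * K^o) = (c, d) + s *: ((e, f) : K^o * K^o) by move=> -> ->.
have tr' (P Q : mx2 K) : Q.2.2 = P.1.1 + P.2.2 - Q.1.1 -> P.2.2 = Q.1.1 + Q.2.2 - P.1.1.
  by move=> ->; ring.
have kTT : ksgn true true = -1 :> K by rewrite /ksgn expr1.
have kTF : ksgn true false = 1 :> K by rewrite /ksgn expr0.
have kFT : ksgn false true = 1 :> K by rewrite /ksgn expr0.
have kFF : ksgn false false = 1 :> K by rewrite /ksgn expr0.
have negpol (A B C : mx2 K) : m2pol A (B -2 C) = - m2pol A (C -2 B).
  by case: A B C => [[? ?] [? ?]] [[? ?] [? ?]] [[? ?] [? ?]];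
    rewrite /m2pol /m2sub /m2add /m2opp /map2 /=; ring.
have inv P Q A B : Q.2.2 = P.1.1 + P.2.2 - Q.1.1 ->
    m2pol A (P *2 B -2 B *2 Q) = - m2pol B (P *2 A -2 A *2 Q).
  by move=> h; apply/eqP; rewrite -addr_eq0 [X in _ + X]m2polC m2pol_invariant.
rewrite sgD !E_br2; apply: pairD.
  case: i hu huw huv => hu huw huv; case: j hv hvw huv => hv hvw huv;
    case: k hw hvw huw => hw hvw huw; rewrite ?kTT ?kTF ?kFT ?kFF ?mul1r.
  - by rewrite (E_even hvw).1 (E_even huv).1 (E_even huw).1 !(m2pol0, m2pol0r) mulr0 addr0.
  - rewrite (E_even huv).1 m2pol0 add0r !blocks_even_r; try exact: E_even.
    by rewrite !(negpol _ (bB _ *2 _)) /= inv // mulN1r.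
  - rewrite (E_even hv).1 m2pol0 addr0 blocks_even_l ?blocks_even_r; try exact: E_even.
    by rewrite /= inv // [RHS]m2polC [RHS]negpol.
  - by rewrite (E_even hvw).1 (E_even hw).1 (E_even hv).1 !(m2pol0, m2pol0r) addr0.
  - rewrite (E_even hu).1 m2pol0 !blocks_even_l; try exact: E_even.
    by rewrite /= addrC m2pol_invariant //.
  - by rewrite (E_even hu).1 (E_even hw).1 (E_even huw).1 !(m2pol0, m2pol0r) addr0.
  - by rewrite (E_even hu).1 (E_even huv).1 (E_even hv).1 !(m2pol0, m2pol0r) addr0.
  - by rewrite (E_even hu).1 (E_even hw).1 (E_even hv).1 !(m2pol0, m2pol0r) addr0.
  case: i hu huw huv => hu huw huv; case: j hv hvw huv => hv hvw huv;
    case: k hw hvw huw => hw hvw huw; rewrite ?kTT ?kTF ?kFT ?kFF ?mul1r.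
  - by rewrite (E_even hvw).2 (E_even huv).2 (E_even huw).2 !(m2pol0, m2pol0r) mulr0 addr0.
  - rewrite (E_even huv).2 m2pol0 add0r !blocks_even_r; try exact: E_even.
    by rewrite !(negpol _ (bC _ *2 _)) /= (inv _ _ _ _ (tr' _ _ trw)) mulN1r.
  - rewrite (E_even hv).2 m2pol0 addr0 blocks_even_l ?blocks_even_r; try exact: E_even.
    by rewrite /= (inv _ _ _ _ (tr' _ _ trv)) [RHS]m2polC [RHS]negpol.
  - by rewrite (E_even hvw).2 (E_even hw).2 (E_even hv).2 !(m2pol0, m2pol0r) addr0.
  - rewrite (E_even hu).2 m2pol0 !blocks_even_l; try exact: E_even.
    by rewrite /= addrC (m2pol_invariant _ _ (tr' _ _ tru)).
  - by rewrite (E_even hu).2 (E_even hw).2 (E_even huw).2 !(m2pol0, m2pol0r) addr0.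
  - by rewrite (E_even hu).2 (E_even huv).2 (E_even hv).2 !(m2pol0, m2pol0r) addr0.
  - by rewrite (E_even hu).2 (E_even hw).2 (E_even hv).2 !(m2pol0, m2pol0r) addr0.
Qed.

Lemma E_lie : is_lie_superalgebra Elie_gr E_br.
Proof.
split; [exact: E_grading|exact: E_bilin|exact: E_br_gr|exact: E_skew|].
by move=> i j x y z; exact: E_jacobi.
Qed.

Definition Elie : lieSuperalgebra K := LieSuperalgebra E_lie.

(** Its kernel consists of the scalar matrices and the two extra coordinates, so it has dimension 3,
    as Z has. *)
Definition E_proj (u : Elie) : psl22 K := psl_class u.1.

Lemma psl_class0 (x : sl22) : psl_class x = 0 :> psl22 K -> exists c, sl_val x = c%:M.
Proof.
have -> : (0 : psl22 K) = psl_class (0 : sl22).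
  have h := @psl_class_linear K 4 par (-1) 0 0.
  by move: h; rewrite scaler0 addr0 => ->; rewrite scaleN1r addNr.
by move=> /psl_class_eq; rewrite subr0 => /sl_scalarP.
Qed.

Lemma blocks_scalar (u : E_sort) c : sl_val u.1 = c%:M ->
  blocks_of u = Blocks ((c, 0), (0, c)) (z2 K) (z2 K) ((c, 0), (0, c)) u.2.1 u.2.2.
Proof. by move=> h; rewrite /blocks_of h /blk !mxE. Qed.

Lemma blocks0 : blocks_of 0 = Blocks (z2 K) (z2 K) (z2 K) (z2 K) 0 0.
Proof. by rewrite /blocks_of /blk /= !mxE. Qed.

Lemma E_proj_central : central_extension E_proj.
Proof.
split.
- split=> [a u v|i u [h _]|u v]; first exact: psl_class_linear.
    by exists u.1.
  exact: (esym (psl_bracket_class _ _)).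
- by move=> y; exists (repr y, 0); exact: psl_classK.
move=> u /psl_class0[c hc] v; apply: blocks_of_inj.
have hb := blocks_scalar hc.
rewrite blocks_even_l ?hb // blocks0.
case: (blocks_of v) => [[[? ?] [? ?]] [[? ?] [? ?]] [[? ?] [? ?]] [[? ?] [? ?]] ? ?].
bunfold; congr Blocks; congr pair; congr pair; ring.
Qed.
End CentralExtension.

(** * The E-module attached to a representation V *)

Section NModule.
Variables (K : fieldType) (n2 : (2 : K) != 0) (V : superPolyRep K).
Local Notation W := (polyRep_of V).
Local Notation R := (trivext W).
Local Notation te := (@te_cst K W).

(** A nested product inherits the [vectType] structure that [superVect] asks for; [toN] and [ofN]
    pass to and from the record in which the formulas are written. *)
Definition Nb : vectType K :=
  (((V * V * V) * (V * V * V)) * (((V * V) * (V * V)) * ((V * V) * (V * V))) * (V * V * V))%type.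
Definition toN (n : Nb) : nvec V :=
  let: (((F, G), (b, c)), d) := n in Nvec F G b c d.
Definition ofN (n : nvec V) : Nb := (((nF n, nG n), (nbe n, nga n)), nd n).
Lemma ofNK n : toN (ofN n) = n. Proof. by case: n. Qed.

(* With these normalizations, x = {E13, E24}, y = {E31, E42} and 2 t is the   *)
(* action of the identity matrix.                                             *)
Definition ax (v : V) : V := (- 4%:R) *: pr_act (p := W) 'X_0 v.
Definition ay (v : V) : V := (- 4%:R) *: pr_act (p := W) 'X_1 v.
Definition at_ (v : V) : V := 2%:R *: pr_act (p := W) 'X_2 v.

Definition rho (u : E_sort K) (n : Nb) : Nb :=
  2^-1 *: ofN (nact2 (fun c v => c *: v) ax ay at_ (blocks_of u) (toN n)).

Definition nconstrV (n : Nb) : V := nconstr ax ay at_ (toN n).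

Definition teN (n : Nb) : nvec R := map_nvec (@te_in K W) (toN n).

Lemma teN_inj : injective teN.
Proof.
move=> [[[[[f1 f2] f3] [[g1 g2] g3]] [[[b1 b2] [b3 b4]] [[c1 c2] [c3 c4]]]] [[d1 d2] d3]].
move=> [[[[[f1' f2'] f3'] [[g1' g2'] g3']] [[[b1' b2'] [b3' b4']] [[c1' c2'] [c3' c4']]]] [[d1' d2'] d3']].
rewrite /teN /map_nvec /map3 /map2 /=.
by case; do 17!move=> ->.
Qed.

Definition xr : R := te (- 4%:R) * te_poly W 'X_0.
Definition yr : R := te (- 4%:R) * te_poly W 'X_1.
Definition tr : R := te 2%:R * te_poly W 'X_2.
Local Notation mul := (@GRing.mul R).
Local Notation rN := (nact2 mul (mul xr) (mul yr) (mul tr)).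

Lemma teN_scale c n : teN (c *: n) = nscale (te c) (teN n).
Proof.
case: n => [[[[[f1 f2] f3] [[g1 g2] g3]] [[[b1 b2] [b3 b4]] [[c1 c2] [c3 c4]]]] [[d1 d2] d3]].
by rewrite /teN /nscale /map_nvec /map3 /map2 /= !te_inZ.
Qed.

Lemma teN_add m n : teN (m + n) = nadd (teN m) (teN n).
Proof.
case: m => [[[[[f1 f2] f3] [[g1 g2] g3]] [[[b1 b2] [b3 b4]] [[c1 c2] [c3 c4]]]] [[d1 d2] d3]].
case: n => [[[[[f1' f2'] f3'] [[g1' g2'] g3']] [[[b1' b2'] [b3' b4']] [[c1' c2'] [c3' c4']]]] [[d1' d2'] d3']].
by rewrite /teN /nadd /map_nvec /map3 /map2 /m2add /t3add /= !te_inD.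
Qed.

Lemma te_axE v : te_in (V := W) (ax v) = xr * te_in (V := W) v.
Proof. by rewrite /ax te_inZ te_inact mulrA. Qed.
Lemma te_ayE v : te_in (V := W) (ay v) = yr * te_in (V := W) v.
Proof. by rewrite /ay te_inZ te_inact mulrA. Qed.
Lemma te_atE v : te_in (V := W) (at_ v) = tr * te_in (V := W) v.
Proof. by rewrite /at_ te_inZ te_inact mulrA. Qed.

Lemma teN_act X (n : nvec V) :
  map_nvec (@te_in K W) (nact2 (fun c v => c *: v) ax ay at_ X n)
  = rN (map_blocks te X) (map_nvec (@te_in K W) n).
Proof.
apply: nact2_morph; [exact: te_inD| |exact: te_inZ|exact: te_axE|exact: te_ayE|exact: te_atE].
by move=> v; apply: te_inN.
Qed.

Lemma teN_rho u n : teN (rho u n) = nscale (te 2^-1) (rN (map_blocks te (blocks_of u)) (teN n)).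
Proof. by rewrite /rho teN_scale /teN ofNK teN_act. Qed.

Lemma te_blocks_linear a u v : map_blocks te (blocks_of (a *: u + v)) =
  bladd (map_blocks (mul (te a)) (map_blocks te (blocks_of u))) (map_blocks te (blocks_of v)).
Proof.
rewrite blocks_linear.
case: (blocks_of u) (blocks_of v) => [[[? ?] [? ?]] [[? ?] [? ?]] [[? ?] [? ?]] [[? ?] [? ?]] ? ?]
  [[[? ?] [? ?]] [[? ?] [? ?]] [[? ?] [? ?]] [[? ?] [? ?]] ? ?].
by rewrite /badd /bladd /map_blocks /map2 /m2add /= !(rmorphD te) !(rmorphM te).
Qed.

Lemma te_nconstr n : te_in (V := W) (nconstrV n) = nconstr (mul xr) (mul yr) (mul tr) (teN n).
Proof.
case: n => [[[[[f1 f2] f3] [[g1 g2] g3]] [[[b1 b2] [b3 b4]] [[c1 c2] [c3 c4]]]] [[d1 d2] d3]].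
rewrite /nconstrV /teN /nconstr /map_nvec /map3 /= !(te_inD, te_inN).
by rewrite te_axE te_ayE !te_atE.
Qed.

Lemma nconstrV_linear : linear nconstrV.
Proof.
move=> a m n; apply: (@te_inI K W).
rewrite te_nconstr teN_add teN_scale te_inD te_inZ !te_nconstr.
case: (teN m) (teN n) => [[[? ?] ?] [[? ?] ?] [[? ?] [? ?]] [[? ?] [? ?]] [[? ?] ?]]
  [[[? ?] ?] [[? ?] ?] [[? ?] [? ?]] [[? ?] [? ?]] [[? ?] ?]].
by rewrite /nconstr /nadd /nscale /map_nvec /map3 /t3add /=; ring.
Qed.

Lemma rho_bilin : bilinear_op rho.
Proof.
split=> [n a u v|u a m n]; apply: teN_inj; rewrite teN_rho [RHS]teN_add.
  rewrite [in RHS](teN_scale a (rho u n)) !teN_rho (te_blocks_linear a u v).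
  by rewrite rN_linear_l nscale_lin.
rewrite [in RHS](teN_scale a (rho u m)) !teN_rho teN_add teN_scale.
by rewrite rN_linear_r nscale_lin.
Qed.

Lemma rho_constr u n : nconstrV n = 0 -> nconstrV (rho u n) = 0.
Proof.
move=> h; apply: (@te_inI K W); rewrite te_nconstr teN_rho -rN_scale.
apply: nconstr_rN.
have := te_nconstr (2^-1 *: n); rewrite teN_scale => <-.
by rewrite (linZ nconstrV_linear) h scaler0.
Qed.

Let te_half : te 2^-1 * 2%:R = 1.
Proof. by rewrite -(rmorph_nat te 2) -rmorphM mulVf ?rmorph1. Qed.

(** Turns a relation between doubled actions over [trivext] into one for [rho]: the two halves in a
    product of two [rho] reduce the factor 2 to the single half of [rho w]. *)
Let rho_rel c u v w n :
  nadd (rN (map_blocks te (blocks_of u)) (rN (map_blocks te (blocks_of v)) (teN n)))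
    (nscale (te (- c)) (rN (map_blocks te (blocks_of v)) (rN (map_blocks te (blocks_of u)) (teN n))))
  = nscale 2%:R (rN (map_blocks te (blocks_of w)) (teN n)) ->
  rho w n = rho u (rho v n) - c *: rho v (rho u n).
Proof.
move=> e; apply: teN_inj; rewrite -scaleNr teN_add (teN_scale (- c) (rho v (rho u n))) !teN_rho.
rewrite !rN_scale !nscaleA.
set P := rN _ (rN _ _) in e *; set Q := rN _ (rN _ _) in e *.
apply: etrans (_ : nscale (te 2^-1 * te 2^-1) (nadd P (nscale (te (- c)) Q)) = _).
  by rewrite e nscaleA -mulrA te_half mulr1.
by rewrite nscale_add nscaleA [_ * te (- c)]mulrC mulrA.
Qed.

Lemma map_blocks_even (X : blocks K) : b_even X ->
  map_blocks te X = r_ev (map2 te (bP X)) (map2 te (bQ X)) (te (bx X)) (te (by_ X)).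
Proof.
case: X => [P B C Q a b] [/= -> ->].
by rewrite /map_blocks /r_ev /map2 /z2 /= rmorph0.
Qed.

Lemma map_blocks_odd (X : blocks K) : b_odd X ->
  map_blocks te X = r_od (map2 te (bB X)) (map2 te (bC X)).
Proof.
case: X => [P B C Q a b] [/= -> -> -> ->].
by rewrite /map_blocks /r_od /map2 /z2 /= rmorph0.
Qed.

Lemma te_m2 (P Q P' Q' : mx2 K) :
  map2 te (m2sub (m2l GRing.mul P Q) (m2l GRing.mul P' Q')) =
  m2sub (m2l mul (map2 te P) (map2 te Q)) (m2l mul (map2 te P') (map2 te Q')).
Proof.
case: P Q P' Q' => [[? ?] [? ?]] [[? ?] [? ?]] [[? ?] [? ?]] [[? ?] [? ?]].
rewrite /m2sub /m2add /m2opp /m2l /map2 /=; congr pair; congr pair; ring.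
Qed.

Lemma te_m2add (P Q P' Q' : mx2 K) :
  map2 te (m2add (m2l GRing.mul P Q) (m2l GRing.mul P' Q')) =
  m2add (m2l mul (map2 te P) (map2 te Q)) (m2l mul (map2 te P') (map2 te Q')).
Proof.
case: P Q P' Q' => [[? ?] [? ?]] [[? ?] [? ?]] [[? ?] [? ?]] [[? ?] [? ?]].
rewrite /m2add /m2l /map2 /=; congr pair; congr pair; ring.
Qed.

Lemma te_m2pol (A B : mx2 K) : te (m2pol A B) = m2pol (map2 te A) (map2 te B).
Proof.
by case: A B => [[? ?] [? ?]] [[? ?] [? ?]]; rewrite /m2pol /map2 /=; ring.
Qed.

Lemma te_trace (u : E_sort K) : let X := blocks_of u in
  map2 te (bQ X) = (((te (bQ X).1.1), te (bQ X).1.2),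
    (te (bQ X).2.1, te (bP X).1.1 + te (bP X).2.2 - te (bQ X).1.1)).
Proof. by rewrite /map2 (E_trace u) /= !(rmorphD te, rmorphN te). Qed.

Let rho_eo u v n : Elie_gr false u -> Elie_gr true v ->
  rho (E_br u v) n = rho u (rho v n) - rho v (rho u n).
Proof.
move=> hu hv; rewrite -[rho v (rho u n)]scale1r; apply: rho_rel.
have bu := E_even hu; have bv := E_odd hv.
rewrite (blocks_even_l _ bu) (map_blocks_even bu) (map_blocks_odd bv).
rewrite (map_blocks_odd (X := Blocks _ _ _ _ _ _)); last first.
  case: bv => -> -> _ _; split => //=;
  by rewrite /m2sub /m2l /m2add /m2opp /map2 /= !(mulr0, mul0r, addr0, oppr0).
rewrite !te_m2 te_trace rmorphN1.
case: (blocks_of u) => [[[p1 p2] [p3 p4]] B C [[q1 q2] [q3 q4]] a b].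
exact: nact_eo.
Qed.

Let rho_oe u v n : Elie_gr true u -> Elie_gr false v ->
  rho (E_br u v) n = rho u (rho v n) - rho v (rho u n).
Proof.
move=> hu hv; rewrite (E_skew hu hv) /ksgn /= expr0 scale1r.
have [rl _] := rho_bilin.
by rewrite (linN (rl n)) (rho_eo _ hv hu) opprB.
Qed.

Let rho_ee u v n : Elie_gr false u -> Elie_gr false v ->
  rho (E_br u v) n = rho u (rho v n) - rho v (rho u n).
Proof.
move=> hu hv; rewrite -[rho v (rho u n)]scale1r; apply: rho_rel.
have bu := E_even hu; have bv := E_even hv.
rewrite (blocks_even_l _ bu) (map_blocks_even bu) (map_blocks_even bv).
rewrite (map_blocks_even (X := Blocks _ _ _ _ _ _)); last first.
  case: bv => -> ->; split => //=;
  by rewrite /m2sub /m2l /m2add /m2opp /map2 /= !(mulr0, mul0r, addr0, oppr0).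
by rewrite !te_m2 rmorph0 rmorphN1; exact: nact_ee.
Qed.

Let rho_oo u v n : nconstrV n = 0 -> Elie_gr true u -> Elie_gr true v ->
  rho (E_br u v) n = rho u (rho v n) + rho v (rho u n).
Proof.
move=> hn hu hv; rewrite -[rho v (rho u n)]scale1r -[1 in RHS]opprK scaleNr.
apply: rho_rel.
have bu := E_odd hu; have bv := E_odd hv.
rewrite (blocks_odd bu bv) (map_blocks_odd bu) (map_blocks_odd bv).
rewrite (map_blocks_even (X := Blocks _ _ _ _ _ _)) //.
rewrite !te_m2add !te_m2pol opprK rmorph1.
have sc1 p : nscale 1 p = p :> nvec R.
  case: p => [[[? ?] ?] [[? ?] ?] [[? ?] [? ?]] [[? ?] [? ?]] [[? ?] ?]].
  by rewrite /nscale /map_nvec /map3 /map2 /= !mul1r.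
by rewrite sc1; apply: nact_oo; rewrite -te_nconstr hn.
Qed.

Lemma rho_br i j u v n : nconstrV n = 0 -> Elie_gr i u -> Elie_gr j v ->
  rho (E_br u v) n = rho u (rho v n) - ksgn i j *: rho v (rho u n).
Proof.
move=> hn; case: i; case: j => hu hv; rewrite /ksgn /= ?expr0 ?expr1.
- by rewrite scaleN1r opprK; exact: rho_oo.
- by rewrite scale1r; exact: rho_oe.
- by rewrite scale1r; exact: rho_eo.
- by rewrite scale1r; exact: rho_ee.
Qed.

Definition Nb_gr (i : bool) (n : Nb) : Prop :=
  let: Nvec F G b c d := toN n in let g := sv_gr (s := V) in
  [/\ [/\ g i F.1.1, g i F.1.2 & g i F.2], [/\ g i G.1.1, g i G.1.2 & g i G.2],
      [/\ g (~~ i) b.1.1, g (~~ i) b.1.2, g (~~ i) b.2.1 & g (~~ i) b.2.2],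
      [/\ g (~~ i) c.1.1, g (~~ i) c.1.2, g (~~ i) c.2.1 & g (~~ i) c.2.2]
    & [/\ g i d.1.1, g i d.1.2 & g i d.2]].

Lemma Nb_grP : is_grading Nb_gr.
Proof.
have gP := sv_grP V.
split.
- by move=> i; rewrite /Nb_gr /=; split; split; exact: (gr0 gP).
- move=> i a [[[[[? ?] ?] [[? ?] ?]] [[[? ?] [? ?]] [[? ?] [? ?]]]] [[? ?] ?]].
  move=> [[[[[? ?] ?] [[? ?] ?]] [[[? ?] [? ?]] [[? ?] [? ?]]]] [[? ?] ?]].
  rewrite /Nb_gr /= => -[[? ? ?] [? ? ?] [? ? ? ?] [? ? ? ?] [? ? ?]].
  move=> [[? ? ?] [? ? ?] [? ? ? ?] [? ? ? ?] [? ? ?]].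
  by split; split; exact: (grZD gP).
- move=> [[[[[f1 f2] f3] [[g1 g2] g3]] [[[b1 b2] [b3 b4]] [[c1 c2] [c3 c4]]]] [[d1 d2] d3]].
  pose p i := grpart gP i; pose e i := map3 (p i); pose o i := map2 (p (~~ i)).
  pose w i : Nb := ofN (Nvec (e i (f1, f2, f3)) (e i (g1, g2, g3)) (o i ((b1, b2), (b3, b4)))
    (o i ((c1, c2), (c3, c4))) (e i (d1, d2, d3))).
  exists (w false), (w true); split.
  + by rewrite /Nb_gr /=; split; split; exact: grpart_gr.
  + by rewrite /Nb_gr /=; split; split; exact: grpart_gr.
  have s v : v = p false v + p true v by exact: grpart_sum.
  have s' v : v = p true v + p false v by rewrite addrC -s.
  by do ?congr pair; rewrite /=; do ?[exact: s|exact: s'].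
- move=> [[[[[? ?] ?] [[? ?] ?]] [[[? ?] [? ?]] [[? ?] [? ?]]]] [[? ?] ?]].
  rewrite /Nb_gr /= => -[[h1 h2 h3] [h4 h5 h6] [h7 h8 h9 h10] [h11 h12 h13 h14] [h15 h16 h17]].
  move=> [[k1 k2 k3] [k4 k5 k6] [k7 k8 k9 k10] [k11 k12 k13 k14] [k15 k16 k17]].
  rewrite (gr_eq0 gP h1 k1) (gr_eq0 gP h2 k2) (gr_eq0 gP h3 k3) (gr_eq0 gP h4 k4).
  rewrite (gr_eq0 gP h5 k5) (gr_eq0 gP h6 k6) (gr_eq0 gP h7 k7) (gr_eq0 gP h8 k8).
  rewrite (gr_eq0 gP h9 k9) (gr_eq0 gP h10 k10) (gr_eq0 gP h11 k11) (gr_eq0 gP h12 k12).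
  rewrite (gr_eq0 gP h13 k13) (gr_eq0 gP h14 k14) (gr_eq0 gP h15 k15) (gr_eq0 gP h16 k16).
  by rewrite (gr_eq0 gP h17 k17).
Qed.

Definition NbV : superVect K := SuperVect Nb_grP.

Lemma Nb_gr_parity i n : Nb_gr i n <-> nparity (sv_gr (s := V)) i (toN n).
Proof. by case: n => [[[F G] [b c]] d]; split. Qed.

Lemma rho_gr i j u n : Elie_gr i u -> Nb_gr j n -> Nb_gr (i (+) j) (rho u n).
Proof.
have gP := sv_grP V.
move=> hu /Nb_gr_parity hn; apply: (grZ Nb_grP); apply/Nb_gr_parity; rewrite ofNK.
have key := @nact2_parity K V ax ay at_ (sv_gr (s := V)) (gr0 gP) (grD gP) (grN gP).
have act_gr p k v : sv_gr (s := V) k v -> sv_gr k (pr_act (p := W) p v) by exact: spr_even.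
apply: key hn _; first by move=> k a v; exact: (grZ gP).
- by move=> k v h; apply: (grZ gP); exact: act_gr.
- by move=> k v h; apply: (grZ gP); exact: act_gr.
- by move=> k v h; apply: (grZ gP); exact: act_gr.
by case: i hu => [/E_odd|/E_even].
Qed.

End NModule.

(** * The model bimodules are in the image of Jor *)

Section NilpotentSum.
Variables (K : fieldType) (V : polyRep K).
Local Notation act := (@pr_act K V).

Lemma nilpotent_act_add p q :
  nilpotent_op (act p) -> nilpotent_op (act q) -> nilpotent_op (act (p + q)).
Proof.
move=> [a ha] [b hb]; exists (a + b)%N => v; rewrite -act_exp exprDn.
have z (i : 'I_(a + b).+1) : act (p ^+ (a + b - i) * q ^+ i) v = 0.
  case: (leqP b i) => [bi|ib].
    by rewrite -(subnK bi) exprD mulrA actM [act (q ^+ b) v]act_exp hb act0.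
  have le : (a <= a + b - i)%N by rewrite leq_subRL 1?addnC ?leq_add2l ltnW // ltn_addl.
  by rewrite -(subnK le) exprD mulrAC actM [act (p ^+ a) v]act_exp ha act0.
elim/big_ind: _ => [|x y hx hy|i _]; first exact: act0p.
  by rewrite actDp hx hy addr0.
by rewrite -scaler_nat actZp z scaler0.
Qed.

Lemma nilpotent_act_scale c p : nilpotent_op (act p) -> nilpotent_op (act (c *: p)).
Proof.
move=> [a ha]; exists a => v; rewrite -act_exp exprZn actZp act_exp ha.
exact: scaler0.
Qed.
End NilpotentSum.

Section LiftBlocks.
Variables (K : fieldType) (n2 : (2 : K) != 0).
Local Notation "2^-1" := (GRing.inv (2%:R : K)).
Implicit Type u : Elie K.

Lemma E_proj_lift u x : E_proj u = psl_class x ->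
  exists c, sl_val u.1 = sl_val x + c%:M.
Proof.
move=> /psl_class_eq /sl_scalarP[c hc]; exists c.
by rewrite -hc addrC subrK.
Qed.

(** A lift to E is known up to a scalar matrix c and two central coordinates; the brackets computed
    below remove this indeterminacy. *)
Lemma blocks_iota u a : E_proj u = psl_iota a -> exists c b1 b2, blocks_of u =
  Blocks ((c, a 0 0), (0, c)) ((0, a 0 1), (0, 0)) ((0, a 1 0), (0, 0)) ((c, a 1 1), (0, c)) b1 b2.
Proof.
move=> /E_proj_lift[c hc]; exists c, u.2.1, u.2.2.
rewrite /blocks_of hc /blk /= /iota_mx !mxE /=.
by rewrite !(mulr1, mulr0, addr0, add0r).
Qed.

Lemma blocks_e u : E_proj u = psl_e K -> exists c b1 b2, blocks_of u =
  Blocks ((c, 1), (0, c)) (z2 K) (z2 K) ((c, 1), (0, c)) b1 b2.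
Proof.
by rewrite -psl_iota1 => /blocks_iota; rewrite !mxE.
Qed.

Lemma blocks_f u : E_proj u = psl_f K -> exists c b1 b2, blocks_of u =
  Blocks ((c, 0), (2^-1, c)) (z2 K) (z2 K) ((c, 0), (2^-1, c)) b1 b2.
Proof.
move=> /E_proj_lift[c hc]; exists c, u.2.1, u.2.2.
rewrite /blocks_of hc /blk /= /f_mx !mxE /=.
by rewrite !(mulr1, mulr0, addr0, add0r).
Qed.

Definition hblk (k : K) : blocks K :=
  Blocks ((k, 0), (0, - k)) (z2 K) (z2 K) ((k, 0), (0, - k)) 0 0.
Definition fblk : blocks K :=
  Blocks ((0, 0), (2^-1, 0)) (z2 K) (z2 K) ((0, 0), (2^-1, 0)) 0 0.
Definition xblk (p q r s : K) : blocks K :=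
  Blocks ((0, p), (0, 0)) ((0, q), (0, 0)) ((0, r), (0, 0)) ((0, s), (0, 0)) 0 0.
Definition dblk (p q r s : K) : blocks K :=
  Blocks ((p, 0), (0, - p)) ((q, 0), (0, - q)) ((r, 0), (0, - r)) ((s, 0), (0, - s)) 0 0.

Ltac m2calc := cbv beta iota zeta delta [hblk fblk xblk dblk map_blocks m2sub m2add m2opp m2l
  map2 z2 bP bB bC bQ bx by_ fst snd];
  congr Blocks; try (congr pair; congr pair); first [ring | by field].

Lemma blocks_ef u v : E_proj u = psl_e K -> E_proj v = psl_f K ->
  blocks_of (E_br u v) = hblk 2^-1.
Proof.
move=> /blocks_e[c [b1 [b2 hu]]] /blocks_f[d [b3 [b4 hv]]].
rewrite blocks_even_l ?hu // hv; m2calc.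
Qed.

(** In [ghat] one has f = - [h, f]. The unknown scalars of [blocks_f] cancel in the bracket, so the
    image of f in E is known exactly, central part included. *)
Lemma blocks_hf u v : blocks_of u = hblk 2^-1 -> E_proj v = psl_f K ->
  blocks_of (- E_br u v) = fblk.
Proof.
move=> hu /blocks_f[d [b3 [b4 hv]]].
rewrite -scaleN1r blocks_scale blocks_even_l ?hu // hv; m2calc.
Qed.

Lemma blocks_hx u v a : blocks_of u = hblk 2^-1 -> E_proj v = psl_iota a ->
  blocks_of (E_br u v) = xblk (a 0 0) (a 0 1) (a 1 0) (a 1 1).
Proof.
move=> hu /blocks_iota[d [b3 [b4 hv]]].
rewrite blocks_even_l ?hu // hv; m2calc.
Qed.

Lemma blocks_xf u v p q r s : blocks_of u = xblk p q r s -> blocks_of v = fblk ->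
  blocks_of (E_br u v) = dblk (p * 2^-1) (q * 2^-1) (r * 2^-1) (s * 2^-1).
Proof.
move=> hu hv.
rewrite blocks_even_r ?hv // hu; m2calc.
Qed.
End LiftBlocks.

(** * The constrained module, pulled back to [ghat] *)

Section PullBack.
Variables (K : fieldType) (n2 : (2 : K) != 0) (V : superPolyRep K).
Variables (ghat : lieSuperalgebra K) (phi : ghat -> Elie K).
Hypothesis phiH : is_lie_hom phi.
Local Notation U := (kersp (@nconstrV_linear K V)).

Lemma nconstrV_gr i n : Nb_gr i n -> sv_gr i (@nconstrV K V n).
Proof.
have gP := sv_grP V.
have act_gr p k v : sv_gr (s := V) k v -> sv_gr k (pr_act (p := polyRep_of V) p v).
  exact: spr_even.
case: n => [[[F G] [b c]] [[d1 d2] d3]] [_ _ _ _ [h1 h2 h3]].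
rewrite /nconstrV /nconstr /=.
by do ?[apply: (grD gP)|apply: (grN gP)]; apply: (grZ gP); exact: act_gr.
Qed.

(** The constraint is an even map, so it vanishes on each parity component separately. *)
Lemma NU_gr i (n : NbV V) : n \in U -> grpart (sv_grP (NbV V)) i n \in U.
Proof.
pose gP := sv_grP (NbV V).
have kE (m : NbV V) : (m \in U) = (nconstrV m == 0) by exact: mem_kersp.
rewrite !kE {1}(grpart_sum gP n) => /eqP.
rewrite (linD (@nconstrV_linear K V)) => /eqP.
have h j := nconstrV_gr (grpart_gr gP j n).
rewrite addr_eq0 => /eqP e.
have e1 : nconstrV (grpart gP true n) = 0.
  apply: (gr_eq0 (sv_grP V) (h true)); rewrite -[X in sv_gr _ X]opprK -e.
  exact: (grN (sv_grP V) (h false)).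
by case: i; rewrite ?e ?e1 ?oppr0.
Qed.

Definition NU : superVect K := subSuperVect NU_gr.

Definition NU_act (x : ghat) (n : NU) : NU := vsproj U (rho (phi x) (vsval n)).

Lemma NU_in (n : NU) : nconstrV (vsval n) = 0.
Proof. by apply/eqP; rewrite -(mem_kersp (@nconstrV_linear K V)) subvsP. Qed.

Lemma NU_actE x n : vsval (NU_act x n) = rho (phi x) (vsval n).
Proof. by rewrite vsprojK // mem_kersp rho_constr // NU_in. Qed.

Lemma NU_bilin : bilinear_op NU_act.
Proof.
have [pL _ _] := phiH; have [rl rr] := @rho_bilin K V.
split=> [n a x y|x a m n]; rewrite /NU_act.
  by rewrite pL rl linearP.
by rewrite linearP rr linearP.
Qed.

Lemma NU_act_gr : graded_op (@lie_gr K ghat) (@sv_gr K NU) (@sv_gr K NU) NU_act.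
Proof.
have [_ pg _] := phiH => i j x n hx hn.
have : Nb_gr (i (+) j) (rho (phi x) (vsval n)) by apply: rho_gr => //; exact: pg.
by rewrite -NU_actE.
Qed.

Lemma NU_br i j x y n : lie_gr i x -> lie_gr j y ->
  NU_act (lie_br x y) n = NU_act x (NU_act y n) - ksgn i j *: NU_act y (NU_act x n).
Proof.
have [_ pg pb] := phiH => hx hy; apply: subvs_inj.
have e (u w : NU) c : vsval (u - c *: w) = vsval u - c *: vsval w by rewrite linearB linearZ.
rewrite e !NU_actE pb.
exact: (rho_br n2 (NU_in n) (pg _ _ hx) (pg _ _ hy)).
Qed.

Definition NU_mod : lieModule ghat := LieModule NU_bilin NU_act_gr NU_br.
End PullBack.

Section Weights.
Variables (K : fieldType) (n2 : (2 : K) != 0) (V : superPolyRep K).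
Local Notation W := (polyRep_of V).
Local Notation te := (@te_cst K W).
Local Notation "2^-1" := (GRing.inv (2%:R : K)).
Local Notation ti := (te_in (V := W)).
Local Notation R := (trivext W).

Lemma te_nat n : te n%:R = n%:R. Proof. exact: rmorph_nat. Qed.

Lemma rho_hE u (n : Nb V) : blocks_of u = hblk 2^-1 -> rho u n = ofN (wt (toN n)).
Proof.
move=> hu; apply: teN_inj; rewrite teN_rho hu.
have -> : map_blocks te (hblk 2^-1) = r_ev ((te 2^-1, 0), (0, - te 2^-1))
    ((te 2^-1, 0), (0, - te 2^-1)) 0 0.
  by rewrite /map_blocks /hblk /r_ev /map2 /z2 /= rmorph0 rmorphN.
rewrite nact_hblk nscaleA.
have -> : te 2^-1 * (4%:R * te 2^-1) = 1.
  rewrite mulrCA -rmorphM -te_nat -rmorphM -invfM -(natrM K 2 2) mulfV ?rmorph1 //.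
  by rewrite (natrM _ 2 2) mulf_neq0.
case: n => [[[[[f1 f2] f3] [[g1 g2] g3]] [[[b1 b2] [b3 b4]] [[c1 c2] [c3 c4]]]] [[d1 d2] d3]].
by rewrite /teN /nscale /map_nvec /map3 /map2 /= !mul1r !te_inN.
Qed.

Lemma weight_eq (v : V) (c k : K) : c != k -> c *: v = k *: v -> v = 0.
Proof.
move=> ck /eqP; rewrite -subr_eq0 -scalerBl scaler_eq0 subr_eq0 (negPf ck) /=.
exact: eqP.
Qed.

Lemma wt_eigen u (n : Nb V) c : blocks_of u = hblk 2^-1 -> rho u n = c *: n -> n != 0 ->
  [\/ c = -1, c = 0 | c = 1].
Proof.
move=> /(rho_hE n) ->.
case: n => [[[[[f1 f2] f3] [[g1 g2] g3]] [[[b1 b2] [b3 b4]] [[c1 c2] [c3 c4]]]] [[d1 d2] d3]].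
rewrite /wt /ofN /=; case=> F1 F2 F3 G1 G2 G3 B1 B2 B3 B4 C1 C2 C3 C4 D1 D2 D3.
case: (eqVneq c (-1)) => [|cm]; first by constructor 1.
case: (eqVneq c 0) => [|c0]; first by constructor 2.
case: (eqVneq c 1) => [|cp]; first by constructor 3.
have z (v : V) : 0 = c *: v -> v = 0.
  by move=> e; apply: (weight_eq c0); rewrite -e scale0r.
have p (v : V) : v = c *: v -> v = 0.
  by move=> e; apply: (weight_eq cp); rewrite -e scale1r.
have m (v : V) : - v = c *: v -> v = 0.
  by move=> e; apply: (weight_eq cm); rewrite -e scaleN1r.
rewrite (z _ F1) (p _ F2) (m _ F3) (z _ G1) (p _ G2) (m _ G3) (z _ B1) (p _ B2) (m _ B3)
  (z _ B4) (z _ C1) (p _ C2) (m _ C3) (z _ C4) (z _ D1) (z _ D2) (z _ D3).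
by case/eqP.
Qed.

(* The eigenspace N[1], parametrized by the model bimodule. *)
Definition top (m : modV V) : Nb V := let: ((v, v1), (v2, w)) := m in
  ofN (Nvec (0, 4%:R *: v, 0) (0, - w, 0) ((0, 2%:R *: v1), (0, 0)) ((0, 2%:R *: v2), (0, 0))
    (0, 0, 0)).

Lemma top_linear : linear top.
Proof.
move=> a [[v v1] [v2 w]] [[v' v1'] [v2' w']].
do ?apply: injective_projections; rewrite /= ?scaler0 ?addr0 ?scalerDr ?opprD ?scalerN //;
  by rewrite !scalerA mulrC.
Qed.

Let n4 : (4 : K) != 0. Proof. by rewrite (natrM _ 2 2) mulf_neq0. Qed.

Lemma scale_inj (c : K) (v v' : V) : c != 0 -> c *: v = c *: v' -> v = v'.
Proof. by move=> c0 /(congr1 (GRing.scale c^-1)); rewrite !scalerA mulVf ?scale1r. Qed.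

Lemma top_inj : injective top.
Proof.
move=> [[v v1] [v2 w]] [[v' v1'] [v2' w']]; rewrite /top /ofN /=.
by case=> /(scale_inj n4) -> /oppr_inj -> /(scale_inj n2) -> /(scale_inj n2) ->.
Qed.

Lemma top_constr m : nconstrV (top m) = 0.
Proof.
case: m => [[v v1] [v2 w]]; apply: (@te_inI K W); rewrite te_nconstr.
by rewrite /top /nconstr /= !te_in0 !mulr0 addr0 !subr0.
Qed.

Lemma top_gr i m : mod_gr i m -> Nb_gr i (top m).
Proof.
have gP := sv_grP V; case: m => [[v v1] [v2 w]] [h1 h2 h3 h4]; split; split => /=;
  do ?[exact: (gr0 gP)|exact: (grZ gP)|exact: (grN gP)].
Qed.

Lemma top_weight u n : blocks_of u = hblk 2^-1 -> rho u n = n <-> exists m, n = top m.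
Proof.
move=> hu; rewrite (rho_hE n hu); split=> [|[[[v v1] [v2 w]] ->]]; last first.
  by rewrite /top /wt /ofN /= !oppr0.
case: n => [[[[[f1 f2] f3] [[g1 g2] g3]] [[[b1 b2] [b3 b4]] [[c1 c2] [c3 c4]]]] [[d1 d2] d3]].
have m (v : V) : - v = v -> v = 0 :> V.
  move=> e; apply: (scale_inj n2); rewrite scaler0 -[2%:R]/(1 + 1) scalerDl scale1r.
  by rewrite -{1}e addNr.
rewrite /wt /ofN /=; case=> <- /m -> <- /m -> <- /m -> <- <- /m -> <- <- <- <-.
exists ((4^-1 *: f2, 2^-1 *: b2), (2^-1 *: c2, - g2)).
by rewrite /top /ofN /= opprK !scalerA !mulfV // !scale1r.
Qed.

Lemma jp_jq (x : 'M[K]_2) : x 0 0 = jp x + jq x /\ x 1 1 = jp x - jq x.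
Proof. by rewrite /jp /jq; split; field. Qed.

Lemma te_dblk p q r s : map_blocks te (dblk (p * 2^-1) (q * 2^-1) (r * 2^-1) (s * 2^-1)) =
  Blocks ((te p * te 2^-1, 0), (0, - (te p * te 2^-1)))
    ((te q * te 2^-1, 0), (0, - (te q * te 2^-1)))
    ((te r * te 2^-1, 0), (0, - (te r * te 2^-1)))
    ((te s * te 2^-1, 0), (0, - (te s * te 2^-1))) 0 0.
Proof. by rewrite /map_blocks /dblk /map2 /= rmorph0 !rmorphN !rmorphM. Qed.

Lemma teN_top v v1 v2 w : teN (top ((v, v1), (v2, w))) =
  Nvec (0, 4%:R * ti v, 0) (0, - ti w, 0) ((0, 2%:R * ti v1), (0, 0))
    ((0, 2%:R * ti v2), (0, 0)) (0, 0, 0).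
Proof. by rewrite /teN /map_nvec /map3 /map2 /= !te_inZ te_inN !te_nat. Qed.
Lemma te_mod_s c v : ti (mod_s c v) =
  te c * ti v + (te 4^-1 + te 4^-1) * (te_poly W 'X_2 * ti v).
Proof. by rewrite /mod_s te_inD !te_inZ te_inact rmorphD. Qed.

Lemma top_l u (a : 'M[K]_2) m :
  blocks_of u = dblk (a 0 0 * 2^-1) (a 0 1 * 2^-1) (a 1 0 * 2^-1) (a 1 1 * 2^-1) ->
  top (mod_l a m) = rho u (top m).
Proof.
move=> hu; apply: teN_inj; rewrite teN_rho hu te_dblk.
have [-> ->] := jp_jq a; rewrite -/(jx a) -/(jy a).
case: m => [[v v1] [v2 w]]; rewrite /mod_l !teN_top.
move: (jp a) (jq a) (jx a) (jy a) => P Q q r.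
have tD : te (P + Q) = te P + te Q by exact: rmorphD.
have tB : te (P - Q) = te P - te Q by exact: rmorphB.
have tN c : te (- c) = - te c by exact: rmorphN.
rewrite /xr /yr /tr tN !te_nat tD tB.
have e2 : 2%:R * te 2^-1 = 1 by rewrite -te_nat -rmorphM mulfV ?rmorph1.
have e4 : 4%:R * te 4^-1 = 1 by rewrite -te_nat -rmorphM mulfV ?rmorph1.
have E := @nact_dblk R (te_poly W 'X_0) (te_poly W 'X_1) (te_poly W 'X_2) (te 2^-1) (te 4^-1)
  (te P) (te Q) (te q) (te r) (ti v) (ti v1) (ti v2) (ti w) e2 e4.
apply: etrans (esym E) => {E}.
by rewrite !(te_inD, te_inN, te_inZ, te_mod_s, te_inact, tN, tD, tB).
Qed.
End Weights.

(** * Nilpotency of the centre on the constructed module *)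

Section Central.
Variables (K : fieldType) (n2 : (2 : K) != 0) (V : superPolyRep K).
Local Notation W := (polyRep_of V).
Local Notation te := (@te_cst K W).
Local Notation act := (@pr_act K W).

Definition sblk (c a b : K) : blocks K :=
  Blocks ((c, 0), (0, c)) (z2 K) (z2 K) ((c, 0), (0, c)) a b.

Lemma rho_scalar u c a b (n : Nb V) : blocks_of u = sblk c a b ->
  rho u n = ofN (map_nvec (act ((4%:R * c) *: 'X_2 + (- 4%:R * a) *: 'X_0 + (- 4%:R * b) *: 'X_1))
    (toN n)).
Proof.
move=> hu; apply: teN_inj; rewrite teN_rho hu.
have -> : map_blocks te (sblk c a b) = r_ev ((te c, 0), (0, te c))
    ((te c, 0), (0, te c)) (te a) (te b).
  by rewrite /map_blocks /sblk /r_ev /map2 /z2 /= rmorph0.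
rewrite nact_scalar nscaleA.
set p := _ + _ *: 'X_1; have -> : te (2 : K)^-1 * (2%:R * (2%:R * te c * tr V + te a * xr V + te b * yr V))
    = te_poly W p.
  have e2 : te (2 : K)^-1 * 2%:R = 1 by rewrite -(te_nat V 2) -rmorphM mulVf ?rmorph1.
  have tZ k q : te_poly W (k *: q) = te k * te_poly W q.
    by rewrite -mul_mpolyC rmorphM.
  have tD q r : te_poly W (q + r) = te_poly W q + te_poly W r by exact: rmorphD.
  have tN k : te (- k) = - te k by exact: rmorphN.
  have tM k l : te (k * l) = te k * te l by exact: rmorphM.
  rewrite mulrA e2 mul1r /p !tD !tZ !tM !tN !te_nat.
  by rewrite /tr /xr /yr tN !te_nat; ring.
case: n => [[[[[f1 f2] f3] [[g1 g2] g3]] [[[b1 b2] [b3 b4]] [[c1 c2] [c3 c4]]]] [[d1 d2] d3]].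
by rewrite /teN /nscale /map_nvec /map3 /map2 /= !te_inact.
Qed.

Hypothesis V_nil : forall i : 'I_3, nilpotent_op (act 'X_i).

Lemma rho_scalar_nil u c a b : blocks_of u = sblk c a b ->
  exists k, forall n : Nb V, iter k (rho u) n = 0.
Proof.
move=> hu; set p := (4%:R * c) *: 'X_2 + (- 4%:R * a) *: 'X_0 + (- 4%:R * b) *: 'X_1 : {mpoly K[3]}.
have [k hk] : nilpotent_op (act p).
  by do ?apply: nilpotent_act_add; apply: nilpotent_act_scale.
exists k => n; have -> : iter k (rho u) n = ofN (map_nvec (iter k (act p)) (toN n)).
  elim: k {hk} => [|k IH] /=.
    case: n => [[[[[? ?] ?] [[? ?] ?]] [[[? ?] [? ?]] [[? ?] [? ?]]]] [[? ?] ?]].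
    by rewrite /map_nvec /map3 /map2.
  by rewrite IH (rho_scalar _ hu) -/p ofNK.
by rewrite /map_nvec /map3 /map2 !hk.
Qed.
End Central.

Section Weights.
Variables (K : fieldType) (n2 : (2 : K) != 0).

(** Commuting with lifts of E12 and E34 leaves only two diagonal scalars, the entries p2 and q2, and
    one entry in each odd block. Commuting with a lift of f removes the four entries, and the
    vanishing supertrace gives 2 q1 = 2 p1. *)
Lemma central_blocks (z x1 x2 y : E_sort K) :
  E_proj (x1 : Elie K) = psl_iota (delta_mx 0 0) ->
  E_proj (x2 : Elie K) = psl_iota (delta_mx 1 1) -> E_proj (y : Elie K) = psl_f K ->
  E_br z x1 = 0 -> E_br z x2 = 0 -> E_br z y = 0 -> exists c a b, blocks_of z = sblk c a b.
Proof.
move=> /blocks_iota[k1 [a1 [b1 h1]]] /blocks_iota[k2 [a2 [b2 h2]]] /blocks_f[k3 [a3 [b3 h3]]].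
rewrite !mxE /= in h1 h2.
have ev (w : E_sort K) P Q a b : blocks_of w = Blocks P (z2 K) (z2 K) Q a b -> b_even (blocks_of w).
  by move=> ->.
have tz := E_trace z.
have i2 : (2 : K)^-1 != 0 by rewrite invr_eq0.
have half (u : K) : u * (2 : K)^-1 = 0 -> u = 0.
  by move=> /eqP; rewrite mulf_eq0 (negPf i2) orbF => /eqP.
move=> /(congr1 (@blocks_of K)); rewrite (blocks_even_r _ (ev _ _ _ _ _ h1)) h1 blocks0.
move=> q1 /(congr1 (@blocks_of K)); rewrite (blocks_even_r _ (ev _ _ _ _ _ h2)) h2 blocks0.
move=> q2 /(congr1 (@blocks_of K)); rewrite (blocks_even_r _ (ev _ _ _ _ _ h3)) h3 blocks0.
move: q1 q2 tz; case: (blocks_of z) => [[[p1 p2] [p3 p4]] [[b11 b12] [b21 b22]] [[c11 c12] [c21 c22]]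
  [[q1 q2] [q3 q4]] a b].
rewrite /m2sub /m2add /m2opp /m2l /map2 /z2 /=.
case=> A1 A2 A3 A4 A5 A6 A7 A8 A9 A10 A11 A12 A13 A14 A15 A16.
case=> B1 B2 B3 B4 B5 B6 B7 B8 B9 B10 B11 B12 B13 B14 B15 B16.
move=> tq.
case=> C1 C2 C3 C4 C5 C6 C7 C8 C9 C10 C11 C12 C13 C14 C15 C16.
have P3 : p3 = 0 by rewrite -A4; ring.
have P4 : p4 = p1 by apply/eqP; rewrite -subr_eq0 -oppr_eq0; apply/eqP; rewrite -[RHS]A2; ring.
have Q3 : q3 = 0 by rewrite -B16; ring.
have Q4 : q4 = q1 by apply/eqP; rewrite -subr_eq0 -oppr_eq0; apply/eqP; rewrite -[RHS]B14; ring.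
have E21 : b21 = 0 by apply/oppr_inj; rewrite oppr0 -A5; ring.
have E22 : b22 = 0 by apply/oppr_inj; rewrite oppr0 -A6; ring.
have E11 : b11 = 0 by rewrite -B6; ring.
have G11 : c11 = 0 by rewrite -A10; ring.
have G21 : c21 = 0 by rewrite -A12; ring.
have G22 : c22 = 0 by apply/oppr_inj; rewrite oppr0 -B10; ring.
have E12 : b12 = 0 by apply: half; rewrite -C5; ring.
have G12 : c12 = 0 by apply: half; rewrite -C9; ring.
have P2 : p2 = 0 by apply: half; rewrite -C1; ring.
have Q2 : q2 = 0 by apply: half; rewrite -C13; ring.
have Q1 : q1 = p1.
  apply: (mulfI n2); apply/eqP; rewrite -subr_eq0; apply/eqP.
  have -> : 2%:R * q1 - 2%:R * p1 = q1 + q1 - (p1 + p1) by ring.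
  by rewrite -{1}Q4 tq P4; ring.
exists p1, a, b.
by rewrite P2 P3 P4 Q2 Q3 Q4 Q1 E11 E12 E21 E22 G11 G12 G21 G22.
Qed.
End Weights.

Section ModelInImage.
Variables (K : fieldType) (n2 : (2 : K) != 0).
Variables (ghat : lieSuperalgebra K) (pi : ghat -> psl22 K) (e f h : ghat).
Hypothesis lift : sl2_lift pi e f h.
Hypothesis pi_surj : forall y, exists x, pi x = y.
Variables (phi : ghat -> Elie K).
Hypothesis phiH : is_lie_hom phi.
Hypothesis phiP : forall x, E_proj (phi x) = pi x.
Variable V : superPolyRep K.
Local Notation N := (NU_mod n2 V phiH).
Local Notation U := (kersp (@nconstrV_linear K V)).

Let phi_br x y : phi (lie_br x y) = E_br (phi x) (phi y).
Proof. by case: phiH => _ _; exact. Qed.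

Lemma phi_h : blocks_of (phi h) = hblk (2 : K)^-1.
Proof.
case: lift => -[pe pf _] [ef _ _]; rewrite -ef phi_br.
by apply: blocks_ef; rewrite // phiP.
Qed.

Lemma phi_f : blocks_of (phi f) = fblk K.
Proof.
case: lift => -[_ pf _] [_ _ hf].
have pL : linear phi by case: phiH.
rewrite -[f]opprK -hf (linN pL) phi_br.
by apply: blocks_hf; rewrite ?phi_h // phiP.
Qed.

Lemma phi_xf a x : lie_br h x = x -> pi x = psl_iota a ->
  blocks_of (phi (lie_br x f)) =
    dblk (a 0 0 * 2^-1) (a 0 1 * 2^-1) (a 1 0 * 2^-1) (a 1 1 * 2^-1).
Proof.
move=> hx px; rewrite phi_br; apply: blocks_xf => //; last exact: phi_f.
by rewrite -hx phi_br; apply: blocks_hx; rewrite ?phi_h // phiP.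
Qed.

Lemma NU_mod1 : ghat_mod1 h N.
Proof.
move=> c n n0 hn; have := congr1 vsval hn.
rewrite NU_actE => e'.
apply: (@wt_eigen K n2 V (phi h) (vsval n) c phi_h).
  by rewrite e' linearZ.
by apply: contra n0 => /eqP w0; apply/eqP; apply: subvs_inj; rewrite w0 linear0.
Qed.

(** [phi] is not known to be surjective, so [phi z] is not known to be central in E. It commutes
    with the images of lifts of E12, E34 and f, and this is what [central_blocks] asks for. *)
Lemma NU_nil : (forall i : 'I_3, nilpotent_op (@pr_act K (polyRep_of V) 'X_i)) ->
  forall z, lie_central z -> nilpotent_op (@lm_act K ghat N z).
Proof.
move=> V_nil z zc.
have [x1 px1] := pi_surj (psl_iota (delta_mx 0 0)).
have [x2 px2] := pi_surj (psl_iota (delta_mx 1 1)).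
have [_ pf _] := lift.1.
have phi0 : phi 0 = 0 by apply: lin0; case: phiH.
have [c [a [b hz]]] : exists c a b, blocks_of (phi z) = sblk c a b.
  apply: (@central_blocks K n2 (phi z) (phi x1) (phi x2) (phi f));
    by rewrite ?phiP // -phi_br zc.
have [k hk] := rho_scalar_nil n2 V_nil hz.
exists k => n; apply: subvs_inj; rewrite linear0 -(hk (vsval n)).
by elim: k {hk} => //= k IH; rewrite NU_actE IH.
Qed.

Lemma NU_Jor : is_Jor pi f h N (modJ n2 V).
Proof.
pose q (m : modJ n2 V) : N := vsproj U (top m).
have qE m : vsval (q m) = top m.
  by rewrite vsprojK // mem_kersp top_constr.
exists q; split.
- by move=> a u v; rewrite /q (@top_linear K V) linearP.
- by move=> i m hm; have := top_gr hm; rewrite -qE.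
- by move=> u v /(congr1 vsval); rewrite !qE; exact: (top_inj n2).
- move=> n; split=> [/(congr1 vsval)|[m ->]].
    rewrite NU_actE => /(top_weight n2 _ phi_h)[m hm].
    by exists m; apply: subvs_inj; rewrite qE.
  by apply: subvs_inj; rewrite NU_actE qE; apply/(top_weight n2 _ phi_h); exists m.
move=> a x m hx px; apply: subvs_inj; rewrite NU_actE !qE.
by apply: top_l => //; exact: phi_xf.
Qed.

Lemma modJ_in_image : (forall i : 'I_3, nilpotent_op (@pr_act K (polyRep_of V) 'X_i)) ->
  in_image_Jor0 pi f h (modJ n2 V).
Proof.
by move=> V_nil; exists N; [split; [exact: NU_mod1|exact: NU_nil]|exact: NU_Jor].
Qed.
End ModelInImage.

(** * Nilpotency on the image of Jor *)

Section LieBasics.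
Variables (K : fieldType) (L : lieSuperalgebra K).
Local Notation br := (@lie_br K L).
Let gP : is_grading (@lie_gr K L). Proof. by case: (lieP L). Qed.

Lemma lie_brL y : linear (br^~ y). Proof. by case: (lieP L) => _ [h _]. Qed.
Lemma lie_brR x : linear (br x). Proof. by case: (lieP L) => _ [_ h]. Qed.
Lemma lie_br_gr i j x y : lie_gr i x -> lie_gr j y -> lie_gr (i (+) j) (br x y).
Proof. by case: (lieP L) => _ _ h _ _; exact: h. Qed.
Lemma lie_gradP : is_grading (@lie_gr K L). Proof. exact: gP. Qed.

(** [lie_central] is one-sided and z may be inhomogeneous, so skew symmetry does not apply directly.
    The brackets of the two parts of z with a homogeneous element have opposite parities and sum to
    zero, so each vanishes. *)
Lemma lie_central_r z x : lie_central z -> br x z = 0.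
Proof.
have [_ _ _ skew _] := lieP L.
move=> zc; pose p := grpart gP.
have key j i : br (p j z) (p i x) = 0.
  have e : br (p false z) (p i x) + br (p true z) (p i x) = 0.
    by rewrite -(linD (lie_brL _)) -(grpart_sum gP).
  have g k : lie_gr (k (+) i) (br (p k z) (p i x)).
    by apply: lie_br_gr; exact: grpart_gr.
  have e0 : br (p false z) (p i x) = 0.
    apply: (gr_eq0 gP (g false)); rewrite /= -[br _ _]opprK.
    move/eqP: e; rewrite addr_eq0 => /eqP ->; rewrite opprK.
    by apply: (grN gP); exact: (g true).
  by case: j => //; rewrite -[LHS]add0r -[X in X + _]e0.
have key' i j : br (p i x) (p j z) = 0.
  by rewrite (skew _ _ _ _ (grpart_gr gP i x) (grpart_gr gP j z)) key scaler0 oppr0.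
have zE : z = p false z + p true z by exact: grpart_sum.
have xE : x = p false x + p true x by exact: grpart_sum.
rewrite xE zE (linD (lie_brR _)) !(linD (lie_brL _)).
by rewrite !key' !addr0.
Qed.
End LieBasics.

Section PslGrading.
Variable K : fieldType.
Local Notation "2^-1" := (GRing.inv (2%:R : K)).

Let Emx_gr i j b : ((3 <= i)%N (+) (3 <= j)%N) = b -> mxgr par22 b (Emx K i j).
Proof. by move=> <-; exact: E_gr. Qed.

Lemma psl_gr_f : @lie_gr K (psl22 K) false (psl_f K).
Proof.
exists (SL (f_mxP K)) => //; rewrite /sl_gr /f_mx /=.
have gP := @mxgr_grading K 4 par22.
by apply: (grZ gP); apply: (grD gP); exact: Emx_gr.
Qed.

Lemma psl_gr_h : @lie_gr K (psl22 K) false (psl_h K).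
Proof.
exists (SL (h_mxP K)) => //; rewrite /sl_gr /h_mx /=.
have gP := @mxgr_grading K 4 par22.
by apply: (grZ gP); do ?[apply: (grD gP)|apply: (grN gP)]; exact: Emx_gr.
Qed.

Lemma psl_gr_iota (a : 'M[K]_2) : J_gr true a -> @lie_gr K (psl22 K) true (psl_iota a).
Proof.
move=> ha; exists (SL (iota_mxP a)) => //; rewrite /sl_gr /iota_mx /=.
have gP := @mxgr_grading K 4 par22.
have -> : a 0 0 = 0 by rewrite -ha !mxE.
have -> : a 1 1 = 0 by rewrite -ha !mxE.
rewrite !scale0r; do ?[apply: (grD gP)|apply: (gr0 gP)]; apply: (grZ gP); exact: Emx_gr.
Qed.

Lemma psl_h_iota (n2 : (2 : K) != 0) (a : 'M[K]_2) :
  lie_br (psl_h K) (psl_iota a) = psl_iota a.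
Proof.
by rewrite -psl_ef // -psl_iota1 psl_iotaM -[jordan_mul _ _ _]/(J_mul 1%:M a) J_1mul.
Qed.

Lemma E_proj_scalar (u : Elie K) c a b : blocks_of u = sblk c a b -> E_proj u = 0.
Proof.
have -> : (0 : psl22 K) = psl_class (0 : sl K par22).
  have h := @psl_class_linear K 4 par22 (-1) 0 0.
  by move: h; rewrite scaler0 addr0 => ->; rewrite scaleN1r addNr.
case: u => [[A hA] [x y]]; rewrite /blocks_of /blk /sblk /z2 /=.
case=> e1 e2 e3 e4 e5 e6 e7 e8 e9 e10 e11 e12 e13 e14 e15 e16 _ _.
apply/psl_class_eq/sl_scalarP; exists c; rewrite subr0 /=.
apply/matrixP => i j; rewrite mxE.
by case: (ord4E i) => ->; case: (ord4E j) => -> /=.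
Qed.
End PslGrading.

Section Nilpotency.
Variables (K : fieldType) (n2 : (2 : K) != 0).
Variables (ghat : lieSuperalgebra K) (pi : ghat -> psl22 K) (e f h : ghat).
Hypothesis lift : sl2_lift pi e f h.
Hypothesis pi_central : central_extension pi.
Variables (phi : ghat -> Elie K).
Hypothesis phiH : is_lie_hom phi.
Hypothesis phiP : forall x, E_proj (phi x) = pi x.

Let piL : linear pi. Proof. by case: pi_central => -[]. Qed.
Let pi_br x y : pi (lie_br x y) = lie_br (pi x) (pi y).
Proof. by case: pi_central => -[_ _]. Qed.
Let pi_ker z : pi z = 0 -> lie_central z.
Proof. by case: pi_central => _ _; exact. Qed.
Let gP := @lie_gradP K ghat.
Let gpP := @lie_gradP K (psl22 K).
Local Notation p := (grpart gP).

(* The part of the wrong parity is central, hence does not contribute to brackets. *)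
Lemma central_part i x : lie_gr i (pi x) -> exists x' z, [/\ lie_gr i x', pi x' = pi x,
  lie_central z & x = x' + z].
Proof.
move=> hx; have [_ pg _] : is_lie_hom pi by case: pi_central.
have e1 : pi (p false x) + pi (p true x) = pi x.
  by rewrite -(linD piL) -(grpart_sum gP).
have hz : pi (p (~~ i) x) = 0.
  apply: (gr_eq0 gpP (pg _ _ (grpart_gr gP (~~ i) x))); rewrite negbK.
  have g k : lie_gr k (pi (p k x)) by apply: pg; exact: grpart_gr.
  case: i hx {g} (g i) => hx g.
    have -> : pi (p (~~ true) x) = pi x - pi (p true x) by rewrite -e1 addrK.
    by apply: (grD gpP) => //; apply: (grN gpP).
  have -> : pi (p (~~ false) x) = pi x - pi (p false x) by rewrite -e1 addrAC subrr add0r.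
  by apply: (grD gpP) => //; apply: (grN gpP).
exists (p i x), (p (~~ i) x); split; [exact: grpart_gr| |exact: pi_ker|].
  by case: i {hx} hz e1 => /= -> <-; rewrite ?add0r ?addr0.
by rewrite {1}(grpart_sum gP x); case: i {hx hz} => //=; rewrite addrC.
Qed.

(** Brackets act as anticommutators only for odd elements, so [x, f] must be odd, whereas a preimage
    of [psl_iota a], h and f may have components of the wrong parity. Those are central by
    [central_part]; replacing x by its bracket with h then makes it an exact eigenvector. *)
Lemma top_lift (a : 'M[K]_2) : J_gr true a ->
  exists x, [/\ lie_br h x = x, pi x = psl_iota a & lie_gr true (lie_br x f)].
Proof.
move=> ha; have [_ surj _] := pi_central.
have [[_ pf ph] _] := lift.
have [x0 px0] := surj (psl_iota a).
have [x1 [z1 [g1 p1 c1 e1]]] : exists x' z, [/\ lie_gr true x', pi x' = pi x0,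
    lie_central z & x0 = x' + z] by apply: central_part; rewrite px0; exact: psl_gr_iota.
have [h1 [z2 [gh p2 c2 e2]]] : exists x' z, [/\ lie_gr false x', pi x' = pi h,
    lie_central z & h = x' + z] by apply: central_part; rewrite ph; exact: psl_gr_h.
have [f1 [z3 [gf p3 c3 e3]]] : exists x' z, [/\ lie_gr false x', pi x' = pi f,
    lie_central z & f = x' + z] by apply: central_part; rewrite pf; exact: psl_gr_f.
have px : pi (lie_br h x1) = psl_iota a by rewrite pi_br p1 px0 ph psl_h_iota.
exists (lie_br h x1); split=> //.
  have /pi_ker zc : pi (lie_br h x1 - x1) = 0 by rewrite (linB piL) px p1 px0 subrr.
  rewrite -{1}[lie_br h x1](subrK x1) (linD (lie_brR _)).
  by rewrite (lie_central_r _ zc) add0r.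
rewrite e3 (linD (lie_brR _)) (lie_central_r _ c3) addr0 e2 (linD (lie_brL _)) c2 addr0.
exact: lie_br_gr (lie_br_gr gh g1) gf.
Qed.

(** In E the bracket is that of two odd elements whose blocks are multiples of diag(1, -1). It is
    therefore of the form [sblk], whose class in psl(2|2) is zero. *)
Lemma bracket_central a b x y : J_gr true a -> J_gr true b ->
  lie_br h x = x -> lie_br h y = y -> pi x = psl_iota a -> pi y = psl_iota b ->
  lie_central (lie_br (lie_br x f) (lie_br y f)).
Proof.
move=> ha hb hx hy px py; apply: pi_ker; rewrite -phiP.
have [_ _ pb] := phiH.
have z (c : 'M[K]_2) : J_gr true c -> c 0 0 = 0 /\ c 1 1 = 0.
  by move=> <-; rewrite !mxE.
have [a0 a1] := z _ ha; have [b0 b1] := z _ hb.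
have bx := phi_xf n2 lift phiH phiP hx px.
have bY := phi_xf n2 lift phiH phiP hy py.
move: bx bY; rewrite a0 a1 b0 b1 !mul0r => bx bY.
have od (u : E_sort K) q r : blocks_of u = dblk 0 q r 0 -> b_odd (blocks_of u).
  by move=> ->; rewrite /b_odd /dblk /= oppr0.
have -> : phi (lie_br (lie_br x f) (lie_br y f)) = E_br (phi (lie_br x f)) (phi (lie_br y f)).
  exact: pb.
set q := a 0 1 / _ in bx; set r := a 1 0 / _ in bx; set q' := b 0 1 / _ in bY.
set r' := b 1 0 / _ in bY.
apply: (@E_proj_scalar K _ (q * r' + q' * r) (- (q * q') *+ 2) (- (r * r') *+ 2)).
rewrite (blocks_odd (od _ _ _ bx) (od _ _ _ bY)) bx bY.
rewrite /dblk /sblk /m2add /m2l /m2pol /map2 /z2 /=.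
by congr Blocks; try (congr pair; congr pair); ring.
Qed.

Variables (N : lieModule ghat) (M : jordanBimodule K).
Hypothesis N_nil : forall z, lie_central z -> nilpotent_op (@lm_act K ghat N z).
Hypothesis NM : is_Jor pi f h N M.

Lemma Jor_nil (i : 'I_3) : nilpotent_op (@opX K M i).
Proof.
have [q [qL _ qI _ qA]] := NM.
have [xa [hxa pxa ga]] := top_lift (J_gr_ja K).
have [xb [hxb pxb gb]] := top_lift (J_gr_jb K).
have cc := bracket_central (J_gr_ja K) (J_gr_ja K) hxa hxa pxa pxa.
have cd := bracket_central (J_gr_jb K) (J_gr_jb K) hxb hxb pxb pxb.
have ce := bracket_central (J_gr_ja K) (J_gr_jb K) hxa hxb pxa pxb.
have qa m := qA _ _ m hxa pxa; have qb m := qA _ _ m hxb pxb.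
have brE x y v : lie_gr true x -> lie_gr true y ->
    lm_act (lie_br x y) v = lm_act x (lm_act y v) + lm_act y (lm_act x v) :> N.
  by move=> hx hy; rewrite (lm_br v hx hy) /ksgn /= expr1 scaleN1r opprK.
suff [z [c [zc hz]]] : exists z c, lie_central z /\
    forall m, q (opX i m) = c *: lm_act z (q m).
  have [k hk] := N_nil zc; exists k => m; apply: qI; rewrite (lin0 qL).
  have zL : linear (@lm_act K ghat N z) by case: (lm_bilin N).
  have e' j : q (iter j (@opX K M i) m) = c ^+ j *: iter j (@lm_act K ghat N z) (q m).
    elim: j => [|j IH]; first by rewrite expr0 scale1r.
    by rewrite !iterS hz IH (linZ zL) scalerA exprS.
  by rewrite e' hk scaler0.
have half (v : N) : (2 : K)^-1 *: (v + v) = v.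
  by rewrite -[v in LHS]scale1r -scalerDl scalerA mulVf ?scale1r.
case: (boolP (i == 0)) => i0; last case: (boolP (i == 1)) => i1.
(* For an odd element the bracket with itself acts as twice its square, hence the factor 1/2. For
   [opT] the bracket is the anticommutator itself and the factor is 1. *)
- exists (lie_br (lie_br xa f) (lie_br xa f)), (2 : K)^-1; split=> // m.
  by rewrite /opX i0 brE // half -!qa.
- exists (lie_br (lie_br xb f) (lie_br xb f)), (2 : K)^-1; split=> // m.
  by rewrite /opX (negPf i0) i1 brE // half -!qb.
exists (lie_br (lie_br xa f) (lie_br xb f)), 1; split=> // m.
by rewrite /opX (negPf i0) (negPf i1) scale1r brE // -qb -!qa -qb (linD qL).
Qed.
End Nilpotency.

(** * The equivalences *)

Section BimoduleElements.
Variables (K : fieldType) (n2 : (2 : K) != 0) (M : jordanBimodule K).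

Let lE (a : 'M[K]_2) (m : M) : jb_l a m = (2^-1 * (a 0 0 + a 1 1)) *: m
  + (2^-1 * (a 0 0 - a 1 1)) *: opH m + a 0 1 *: opA m + a 1 0 *: opB m.
Proof.
have lL := jb_lLl m.
rewrite {1}(J_decomp a n2) !(linD lL) !(linZ lL) jb_l1.
by [].
Qed.

Lemma jb_l_even (a : 'M[K]_2) (m : M) : J_gr false a ->
  jb_l a m = (2^-1 * (a 0 0 + a 1 1)) *: m + (2^-1 * (a 0 0 - a 1 1)) *: opH m.
Proof.
move=> ha; rewrite lE; have -> : a 0 1 = 0 by rewrite -ha !mxE.
have -> : a 1 0 = 0 by rewrite -ha !mxE.
by rewrite !scale0r !addr0.
Qed.

Lemma jb_l_odd (a : 'M[K]_2) (m : M) : J_gr true a ->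
  jb_l a m = a 0 1 *: opA m + a 1 0 *: opB m.
Proof.
move=> ha; rewrite lE; have -> : a 0 0 = 0 by rewrite -ha !mxE.
have -> : a 1 1 = 0 by rewrite -ha !mxE.
by rewrite subr0 addr0 mulr0 !scale0r !add0r.
Qed.
End BimoduleElements.

(** The elements 1, [ju], [ja], [jb] span J, and on homogeneous elements the right action is the
    left one up to sign. *)
Lemma jb_hom_degI (K : fieldType) (n2 : (2 : K) != 0) d (M N : jordanBimodule K) (f : M -> N) :
  linear f -> (forall i m, sv_gr i m -> sv_gr (i (+) d) (f m)) ->
  (forall m, f (opH m) = opH (f m)) -> (forall m, f (opA m) = ksgn d true *: opA (f m)) ->
  (forall m, f (opB m) = ksgn d true *: opB (f m)) -> jb_hom_deg d f.
Proof.
move=> fL fG fH fA fB.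
have fl i (a : 'M[K]_2) m : J_gr i a -> f (jb_l a m) = ksgn d i *: jb_l a (f m).
  case: i => ha.
    rewrite !jb_l_odd // (linD fL) !(linZ fL) fA fB scalerDr !scalerA.
    by rewrite ![ksgn d true * _]mulrC.
  by rewrite !jb_l_even // (linD fL) !(linZ fL) fH /ksgn andbF expr0 scale1r.
split=> // m a.
have h i j u (x : 'M[K]_2) : sv_gr i u -> J_gr j x -> f (jb_r u x) = jb_r (f u) x.
  move=> hu hx; rewrite (jb_rE hu hx) (jb_rE (fG _ _ hu) hx) (linZ fL) (fl _ _ _ hx) scalerA.
  by rewrite [ksgn (i (+) d) j]ksgnC ksgnDr ![ksgn j _]ksgnC.
have h' i u x : sv_gr i u -> f (jb_r u x) = jb_r (f u) x.
  move=> hu; move: x; apply: (gr_ind (@mxgr_grading K 2 par11)) => [x y e e'|j x hx]; last exact: h hu hx.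
  by rewrite !(linD (jb_rL _)) (linD fL) e e'.
move: m; apply: (gr_ind (sv_grP M)) => [u v e e'|i u]; last exact: h'.
by rewrite !(linD (jb_rLl _), linD fL) e e'.
Qed.

Section ModelMap.
Variables (K : fieldType) (n2 : (2 : K) != 0) (V W : superPolyRep K) (d : bool).
Local Notation actV := (@spr_act K V).
Local Notation actW := (@spr_act K W).
Arguments mod_s : simpl never.
Variable g : V -> W.
Hypothesis gL : linear g.
Hypothesis g_gr : forall i v, sv_gr i v -> sv_gr (i (+) d) (g v).
Hypothesis g_act : forall p v, g (actV p v) = actW p (g v).
Local Notation ep := (ksgn d true).

(** A map of degree d commutes with A and B up to [ksgn d true], so the sign stands on v1 and v2,
    which represent A v1 and B v2. On w, which comes with AB, it occurs twice. *)
Definition model_map (x : modJ n2 V) : modJ n2 W :=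
  ((g x.1.1, ep *: g x.1.2), (ep *: g x.2.1, g x.2.2)).

Let ep2 : ep * ep = 1 :> K. Proof. exact: ksgnK. Qed.
Let gs c v : g (mod_s c v) = mod_s c (g v).
Proof. by rewrite /mod_s (linD gL) !(linZ gL) /= g_act. Qed.
Let sZ c a (v : W) : mod_s c (a *: v) = a *: mod_s c v.
Proof. by rewrite /mod_s (@actZ K (polyRep_of W)) scalerDr !scalerA ![a * _]mulrC. Qed.
Let aZ p a (v : W) : actW p (a *: v) = a *: actW p v.
Proof. exact: (@actZ K (polyRep_of W)). Qed.
Let gDs c u v : g (u + mod_s c v) = g u + mod_s c (g v). Proof. by rewrite (linD gL) gs. Qed.
Let gBs c u v : g (u - mod_s c v) = g u - mod_s c (g v). Proof. by rewrite (linD gL) (linN gL) gs. Qed.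
Let gsD c u v : g (mod_s c u + v) = mod_s c (g u) + g v. Proof. by rewrite (linD gL) gs. Qed.
Let epK (v : W) : ep *: (ep *: v) = v.
Proof. by rewrite scalerA ep2 scale1r. Qed.
Let gN := linN gL.
Let scD (v w : W) : ep *: (v + w) = ep *: v + ep *: w. Proof. exact: scalerDr. Qed.
Let scN (v : W) : ep *: - v = - (ep *: v). Proof. exact: scalerN. Qed.

Lemma model_map_linear : linear model_map.
Proof.
move=> a [[v v1] [v2 w]] [[u u1] [u2 z]]; rewrite /model_map;
  do ?apply: injective_projections; rewrite /= ?gL //;
by rewrite !scD !scalerA ![ep * a]mulrC.
Qed.

Lemma model_map_gr i x : sv_gr i x -> sv_gr (i (+) d) (model_map x).
Proof.
have gP := sv_grP W; case: x => [[v v1] [v2 w]] [h1 h2 h3 h4].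
have e : ~~ (i (+) d) = ~~ i (+) d by rewrite addNb.
by split => /=; rewrite ?e; do ?apply: (grZ gP); exact: g_gr.
Qed.

Lemma model_map_H x : model_map (opH x) = opH (model_map x).
Proof.
by rewrite !modH /model_map /= !gN !(lin0 gL) !scaler0.
Qed.

Lemma model_map_A x : model_map (opA x) = ep *: opA (model_map x).
Proof.
case: x => [[v v1] [v2 w]]; rewrite !modA /model_map /=.
do ?apply: injective_projections; rewrite /= ?gDs ?gBs ?g_act ?sZ ?aZ ?scD ?epK //.
Qed.

Lemma model_map_B x : model_map (opB x) = ep *: opB (model_map x).
Proof.
case: x => [[v v1] [v2 w]]; rewrite !modB /model_map /=.
do ?apply: injective_projections; rewrite /= ?gDs ?gsD ?gN ?g_act ?sZ ?aZ ?scD ?scN ?epK //.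
Qed.
End ModelMap.

Section PsiInverse.
Variables (K : fieldType) (n2 : (2 : K) != 0) (M : jordanBimodule K).
Hypothesis M_nil : forall i : 'I_3, nilpotent_op (@opX K M i).
Local Notation PV := (PsiV n2 M_nil).
Let PL := @Psi_linear K n2 M.

Lemma PsiV_linear : linear PV.
Proof. by move=> a u v; apply: (Psi_inj M_nil); rewrite PL !PsiVK. Qed.

Lemma PsiV_H m : PV (opH m) = opH (PV m).
Proof. by apply: (Psi_inj M_nil); rewrite Psi_H !PsiVK. Qed.
Lemma PsiV_A m : PV (opA m) = opA (PV m).
Proof. by apply: (Psi_inj M_nil); rewrite Psi_A !PsiVK. Qed.
Lemma PsiV_B m : PV (opB m) = opB (PV m).
Proof. by apply: (Psi_inj M_nil); rewrite Psi_B !PsiVK. Qed.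

(** [Psi] is even and injective: the component of the wrong parity of the preimage is mapped to
    zero. *)
Lemma PsiV_gr i m : sv_gr i m -> sv_gr i (PV m).
Proof.
pose gP := sv_grP (modJ n2 (F_rep n2 M)); pose p := grpart gP.
have gM := sv_grP M.
move=> hm; have e : m = Psi (p false (PV m)) + Psi (p true (PV m)).
  by rewrite -(linD PL) -(grpart_sum gP) PsiVK.
have hP j : sv_gr j (Psi (p j (PV m))) by apply: Psi_gr; exact: grpart_gr.
have [e0 e1] := grpart_uniq gM (hP false) (hP true) e.
have z : Psi (p (~~ i) (PV m)) = 0.
  by case: i hm => hm; rewrite -?e0 -?e1 (grpart_id gM _ hm).
have {}z : p (~~ i) (PV m) = 0 by apply: (Psi_inj M_nil); rewrite z (lin0 PL).
rewrite (grpart_sum gP (PV m)); case: i {hm} z => /= z.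
  by rewrite -/(p false _) z add0r; exact: grpart_gr.
by rewrite -/(p true _) z addr0; exact: grpart_gr.
Qed.
End PsiInverse.

Section LiftMap.
Variables (K : fieldType) (n2 : (2 : K) != 0) (M N : jordanBimodule K).
Hypothesis M_nil : forall i : 'I_3, nilpotent_op (@opX K M i).

(** Under [Psi] a homogeneous homomorphism becomes the model map of its restriction to the Peirce
    component, so this restriction determines it; [lift_map] uses the same formula to extend a
    map. *)
Lemma jb_hom_Psi d (f : M -> N) : jb_hom_deg d f -> forall x : modJ n2 (F_rep n2 M), f (Psi x) =
  Psi (model_map (V := F_rep n2 M) (W := F_rep n2 N) d (F_map (N := N) f) x).
Proof.
move=> fP [[v v1] [v2 w]]; have fL := jb_hom_lin fP.
have fH := jb_hom_H fP.
rewrite /Psi /model_map /= !F_mapE // !(linD fL) (linN fL) !(jb_hom_A fP, jb_hom_B fP).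
rewrite !(linZ (@opAL K N), linZ (@opBL K N)) !scalerA ksgnK scale1r.
congr (_ + (_ - _)); rewrite /opS (linD fL) !(linZ fL).
congr (_ + _ *: _); exact: (jb_hom_X fP 2).
Qed.

Lemma jb_hom_deg_eq d (f g : M -> N) : jb_hom_deg d f -> jb_hom_deg d g ->
  (forall m, opH m = m -> f m = g m) -> f =1 g.
Proof.
move=> fP gP fg m; rewrite -[m](PsiVK n2 M_nil) (jb_hom_Psi fP) (jb_hom_Psi gP).
suff -> : F_map (N := N) f = F_map (N := N) g by [].
by apply: funext => v; rewrite /F_map fg // F_inP.
Qed.

Section Lift.
Variables (d : bool) (g : F_rep n2 M -> F_rep n2 N).
Hypothesis gL : linear g.
Hypothesis g_gr : forall i v, sv_gr i v -> sv_gr (i (+) d) (g v).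
Hypothesis g_act : forall p v, g (spr_act p v) = spr_act p (g v).

Definition lift_map (m : M) : N := Psi (model_map d g (PsiV n2 M_nil m)).

Lemma lift_map_deg : jb_hom_deg d lift_map.
Proof.
have mL := @model_map_linear K n2 _ _ d g gL.
apply: (jb_hom_degI n2); rewrite /lift_map.
- by move=> a u v; rewrite PsiV_linear mL Psi_linear.
- by move=> i m hm; apply: Psi_gr; apply: model_map_gr => //; exact: PsiV_gr.
- by move=> m; rewrite PsiV_H model_map_H // Psi_H.
- by move=> m; rewrite PsiV_A model_map_A // (linZ (@Psi_linear K n2 N)) Psi_A.
- by move=> m; rewrite PsiV_B model_map_B // (linZ (@Psi_linear K n2 N)) Psi_B.
Qed.

Lemma lift_map_res v : lift_map (vsval v) = vsval (g v).
Proof.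
have PsiIn (L : jordanBimodule K) (u : F_rep n2 L) : Psi (((u, 0), (0, 0)) : modJ n2 _) = vsval u.
  rewrite /Psi /= /opS (lin0 (@opT_linear K L)) (lin0 (@opAL K L)) (lin0 (@opBL K L)).
  by rewrite (lin0 (@opAL K L)) !scaler0 !addr0 subr0 addr0.
rewrite /lift_map -[vsval v in LHS]PsiIn PsiK -PsiIn; congr Psi.
by rewrite /model_map /= (lin0 gL) !scaler0.
Qed.
End Lift.
End LiftMap.

Lemma pr_act_hom (K : fieldType) (V W : polyRep K) (f : V -> W) : linear f ->
  (forall i v, f (pr_act 'X_i v) = pr_act 'X_i (f v)) ->
  forall p v, f (pr_act p v) = pr_act p (f v).
Proof.
move=> fL fX; apply: mpoly_linear_ind => [v|a p q hp hq v|m].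
- by rewrite !act0p (lin0 fL).
- by rewrite !(actDp, actZp) (linD fL) (linZ fL) hp hq.
rewrite mpolyXE_id; elim/big_ind: _ => [v|p q hp hq v|i _].
- by rewrite !act1.
- by rewrite !actM hp hq.
elim: (m i) => [|k IH] v; first by rewrite expr0 !act1.
by rewrite exprS !actM fX IH.
Qed.

Section ModelPeirce.
Variables (K : fieldType) (n2 : (2 : K) != 0) (V : superPolyRep K).
Local Notation M := (modJ n2 V).
Local Notation FV := (F_rep n2 M).

Definition to_peirce (v : V) : FV := vsproj (peirce11 M) (((v, 0), (0, 0)) : M).
Definition of_peirce (m : FV) : V := (vsval m).1.1.

Lemma to_peirceE v : vsval (to_peirce v) = (((v, 0), (0, 0)) : M).
Proof. by rewrite vsprojK // mem_peirce11 modH /= oppr0. Qed.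

Lemma to_peirceK v : of_peirce (to_peirce v) = v.
Proof. by rewrite /of_peirce to_peirceE. Qed.

Lemma of_peirceK m : to_peirce (of_peirce m) = m.
Proof.
apply: subvs_inj; rewrite to_peirceE /of_peirce.
have := F_inP m; rewrite modH; case: (vsval m) => [[v v1] [v2 w]] /= [<- <-] ww.
congr (_, (_, _)); apply: (scale_inj n2); rewrite scaler0 -[2%:R]/(1 + 1) scalerDl scale1r.
by rewrite -{1}ww addNr.
Qed.

Lemma of_peirce_linear : linear of_peirce.
Proof. by move=> a u v; rewrite /of_peirce linearP. Qed.

Lemma to_peirce_linear : linear to_peirce.
Proof.
by move=> a u v; rewrite -[RHS]of_peirceK of_peirce_linear !to_peirceK.
Qed.

Lemma of_peirce_act p m : of_peirce (spr_act p m) = spr_act p (of_peirce m).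
Proof.
apply: (@pr_act_hom K (polyRep_of FV) (polyRep_of V) of_peirce of_peirce_linear) => i u.
rewrite -[u]of_peirceK to_peirceK; move: (of_peirce u) => v.
rewrite /of_peirce (F_act_Xi n2 i (to_peirce v)) to_peirceE.
have s0 c : mod_s c (0 : V) = 0.
  by rewrite /mod_s (@act0 K (polyRep_of V)) !scaler0 addr0.
have a0 (q : {mpoly K[3]}) : spr_act q (0 : V) = 0 by exact: (@act0 K (polyRep_of V)).
case: i => -[|[|[|//]]] hi.
- rewrite (_ : Ordinal hi = 0); last exact: val_inj.
  by rewrite -[opX 0 _]/(opA (opA _)) !modA /= !(s0, a0) subr0 addr0.
- rewrite (_ : Ordinal hi = 1); last exact: val_inj.
  by rewrite -[opX 1 _]/(opB (opB _)) !modB /= !(s0, a0) oppr0 s0 addr0 add0r.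
rewrite (_ : Ordinal hi = 2); last exact: val_inj.
rewrite -[opX 2 _]/(opA (opB _) + opB (opA _)) !modA !modB /= !(s0, a0) ?(addr0, subr0, add0r).
rewrite oppr0 a0 add0r /mod_s /=.
(* The first coordinates of A B v and B A v are T v/2 + v/4 and T v/2 - v/4: the quarters cancel and
   the halves add up to T v. *)
rewrite addrACA -scalerDl subrr scale0r add0r -scalerDl (half_quarter n2).
by rewrite -[_ + _](mulr_natr _ 2) mulVf ?scale1r.
Qed.

Lemma to_peirce_act p v : to_peirce (spr_act p v) = spr_act p (to_peirce v).
Proof. by rewrite -[RHS]of_peirceK of_peirce_act to_peirceK. Qed.

Lemma of_peirce_gr i m : sv_gr i m -> sv_gr i (of_peirce m).
Proof. by rewrite /= /subgr /= => -[]. Qed.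

Lemma to_peirce_gr i v : sv_gr i v -> sv_gr i (to_peirce v).
Proof.
move=> hv; rewrite /= /subgr to_peirceE.
by split=> //=; exact: (gr0 (sv_grP V)).
Qed.
End ModelPeirce.

Lemma sig_eq (T : Type) (P : T -> Prop) (u v : {x | P x}) : sval u = sval v -> u = v.
Proof.
by case: u v => [x hx] [y hy] /= xy; subst y; congr exist; exact: Prop_irrelevance.
Qed.

(** * Even and odd parts of a linear map *)

Section ParityParts.
Variables (K : fieldType) (V W : superVect K) (g : V -> W).
Hypothesis gL : linear g.
Local Notation pV := (grpart (sv_grP V)).
Local Notation pW := (grpart (sv_grP W)).

Definition deg_part (d : bool) (v : V) : W :=
  pW d (g (pV false v)) + pW (~~ d) (g (pV true v)).

Lemma deg_part_linear d : linear (deg_part d).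
Proof.
by move=> a u v; rewrite /deg_part !grpart_linear !gL !grpart_linear scalerDr addrACA.
Qed.

Lemma deg_part_gr d i v : sv_gr i v -> sv_gr (i (+) d) (deg_part d v).
Proof.
have gP := sv_grP W => hv; rewrite /deg_part !(grpart_id (sv_grP V) _ hv).
have p0 j : pW j 0 = 0 by exact: (lin0 (grpart_linear (sv_grP W) j)).
by case: i hv => hv /=; rewrite (lin0 gL) p0 ?add0r ?addr0; exact: grpart_gr.
Qed.

Lemma deg_part_sum v : g v = deg_part false v + deg_part true v.
Proof.
rewrite {1}(grpart_sum (sv_grP V) v) (linD gL) /deg_part.
rewrite {1}(grpart_sum (sv_grP W) (g (pV false v))) {1}(grpart_sum (sv_grP W) (g (pV true v))).
by rewrite [X in _ + X = _]addrC addrACA.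
Qed.
End ParityParts.

(** The polynomial ring is purely even. Consequently the parity parts of a K[x,y,t]-linear map are
    again K[x,y,t]-linear. *)
Lemma grpart_act (K : fieldType) (V : superPolyRep K) i p (v : V) :
  grpart (sv_grP V) i (spr_act p v) = spr_act p (grpart (sv_grP V) i v).
Proof.
pose gP := sv_grP V; have aD := @actD K (polyRep_of V).
have h j : sv_gr j (spr_act p (grpart gP j v)) by apply: spr_even; exact: grpart_gr.
have e : spr_act p v = spr_act p (grpart gP false v) + spr_act p (grpart gP true v).
  by rewrite {1}(grpart_sum gP v); exact: aD.
by have [] := grpart_uniq gP (h false) (h true) e; case: i.
Qed.

Section Equivalence.
Variables (K : fieldType) (n2 : (2 : K) != 0).
Variables (ghat : lieSuperalgebra K) (pi : ghat -> psl22 K) (e f h : ghat).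
Hypothesis pi_univ : universal_central_extension pi.
Hypothesis lift : sl2_lift pi e f h.

Lemma image_opX_nil M : in_image_Jor0 pi f h M -> forall i : 'I_3, nilpotent_op (@opX K M i).
Proof.
case: pi_univ => ce uni; have [phi [phiH phiP _]] := uni _ _ (E_proj_central K).
by move=> [N [_ N_nil] NM]; exact: (Jor_nil n2 lift ce phiH phiP N_nil NM).
Qed.

Lemma modJ_image (V : superPolyRep K) : (forall i : 'I_3, nilpotent_op (@spr_act K V 'X_i)) ->
  in_image_Jor0 pi f h (modJ n2 V).
Proof.
case: pi_univ => ce uni; have [phi [phiH phiP _]] := uni _ _ (E_proj_central K).
have [_ surj _] := ce.
by move=> V_nil; apply: (modJ_in_image n2 lift surj phiH phiP).
Qed.

Local Notation CE := (Jmod1_0_even pi f h).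
Local Notation CA := (Jmod1_0 pi f h).
Local Notation DE := (superPolyRep_nilp K).
Local Notation DA := (polyRep_nilp K).

Definition FE_obj (X : obj CE) : obj DE :=
  exist _ (F_rep n2 (sval X)) (F_nil n2 (image_opX_nil (svalP X))).
Definition FA_obj (X : obj CA) : obj DA :=
  exist _ (polyRep_of (F_rep n2 (sval X))) (F_nil n2 (image_opX_nil (svalP X))).

Lemma FE_hom_subproof (X Y : obj CE) (u : hom X Y) :
  @spr_hom K (F_rep n2 (sval X)) (F_rep n2 (sval Y)) (F_map (N := sval Y) (sval u)).
Proof.
have uP := svalP u; have uL := jb_hom_lin uP.
have uH := jb_hom_H uP; have uX := jb_hom_X uP.
split; [exact: F_map_linear| |by move=> p v; exact: F_map_act].
move=> i v; apply: F_map_gr => // j m hm.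
by case: uP => _ uG _ _; have := uG _ _ hm; rewrite addbF.
Qed.

Lemma FA_hom_subproof (X Y : obj CA) (u : hom X Y) :
  @pr_hom K (polyRep_of (F_rep n2 (sval X))) (polyRep_of (F_rep n2 (sval Y)))
    (F_map (N := sval Y) (sval u)).
Proof.
have uP := svalP u; have uL := jb_hom_linear uP.
have uH := jb_homH uP; have uX := jb_homX uP.
by split; [exact: F_map_linear|move=> p v; exact: F_map_act].
Qed.

Definition FE_hom (X Y : obj CE) (u : hom X Y) : hom (FE_obj X) (FE_obj Y) :=
  exist _ _ (FE_hom_subproof u).
Definition FA_hom (X Y : obj CA) (u : hom X Y) : hom (FA_obj X) (FA_obj Y) :=
  exist _ _ (FA_hom_subproof u).

Let F_map_id (M : jordanBimodule K) : F_map (N := M) (@id M) = @id (F_super M).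
Proof. by apply: funext => v; apply: subvs_inj; rewrite F_mapE. Qed.

Let F_map_comp (L M N : jordanBimodule K) (u : L -> M) (v : M -> N) :
  (forall m, u (opH m) = opH (u m)) -> (forall m, v (opH m) = opH (v m)) ->
  F_map (N := N) (v \o u) = F_map (N := N) v \o F_map (N := M) u.
Proof.
move=> uH vH; apply: funext => m; apply: subvs_inj.
by rewrite /= !F_mapE //= => n; rewrite uH vH.
Qed.

Definition FE : functor CE DE.
Proof.
refine (@Functor CE DE FE_obj FE_hom _ _) => [X|X Y Z u v]; apply: sig_eq.
  exact: F_map_id.
apply: F_map_comp; [exact: (jb_hom_H (svalP v))|exact: (jb_hom_H (svalP u))].
Defined.

Definition FA : functor CA DA.
Proof.
refine (@Functor CA DA FA_obj FA_hom _ _) => [X|X Y Z u v]; apply: sig_eq.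
  exact: F_map_id.
apply: F_map_comp; [exact: (jb_homH (svalP v))|exact: (jb_homH (svalP u))].
Defined.

Lemma F_map_eq (M N : jordanBimodule K) (u v : M -> N) :
  (forall m, u (opH m) = opH (u m)) -> (forall m, v (opH m) = opH (v m)) ->
  F_map (N := N) u = F_map (N := N) v -> forall m, opH m = m -> u m = v m.
Proof.
move=> uH vH uv m hm; have mP : m \in peirce11 M by rewrite mem_peirce11 hm.
by rewrite -[m](vsprojK mP) -!F_mapE // uv.
Qed.

Lemma FE_faithful (X Y : obj CE) (u v : hom X Y) : fmap FE u = fmap FE v -> u = v.
Proof.
move=> /(congr1 sval) uv; apply: sig_eq; apply: funext.
apply: (jb_hom_deg_eq n2 (image_opX_nil (svalP X)) (svalP u) (svalP v)).
by apply: F_map_eq => //; [exact: (jb_hom_H (svalP u))|exact: (jb_hom_H (svalP v))].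
Qed.

(** On the Peirce component only the sums of an even and an odd part are known to agree. On
    homogeneous vectors the two parts take values of opposite parity, so they agree separately, and
    [jb_hom_deg_eq] applies to each. *)
Lemma FA_faithful (X Y : obj CA) (u v : hom X Y) : fmap FA u = fmap FA v -> u = v.
Proof.
move=> /(congr1 sval) uv; apply: sig_eq; apply: funext => m.
have [u0 [u1 [hu0 hu1 uE]]] := svalP u; have [v0 [v1 [hv0 hv1 vE]]] := svalP v.
have eq1 : forall m, opH m = m -> sval u m = sval v m.
  by apply: F_map_eq => //; [exact: (jb_homH (svalP u))|exact: (jb_homH (svalP v))].
pose M := sval X; pose N := sval Y.
have gN := sv_grP N.
have key (m' : M) : opH m' = m' -> u0 m' = v0 m' /\ u1 m' = v1 m'.
  move=> hm'.
  have hom i (w : M) : sv_gr i w -> opH w = w -> u0 w = v0 w /\ u1 w = v1 w.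
    move=> hw /eq1; rewrite uE vE => e2.
    have [_ g0 _ _] := hu0; have [_ g1 _ _] := hu1.
    have [_ k0 _ _] := hv0; have [_ k1 _ _] := hv1.
    have d0 : u0 w - v0 w = 0.
      apply: (gr_eq0 gN (i := i)).
        by apply: (grD gN); [|apply: (grN gN)];
          [have := g0 _ _ hw|have := k0 _ _ hw]; rewrite addbF.
      have -> : u0 w - v0 w = v1 w - u1 w.
        by apply/eqP; rewrite subr_eq addrAC eq_sym subr_eq e2 addrC.
      by apply: (grD gN); [|apply: (grN gN)];
        [have := k1 _ _ hw|have := g1 _ _ hw]; rewrite addbT.
    have e0 : u0 w = v0 w by apply/eqP; rewrite -subr_eq0 d0.
    by split=> //; move: e2; rewrite e0 => /addrI.
  have parts i : opH (grpart (sv_grP M) i m') = grpart (sv_grP M) i m'.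
    by apply/eqP; rewrite -mem_peirce11; apply: peirce11_gr; rewrite mem_peirce11 hm'.
  have h0 i := hom i _ (grpart_gr (sv_grP M) i m') (parts i).
  have L0 := jb_hom_lin hu0; have L1 := jb_hom_lin hu1.
  have L2 := jb_hom_lin hv0; have L3 := jb_hom_lin hv1.
  rewrite (grpart_sum (sv_grP M) m') (linD L0) (linD L1) (linD L2) (linD L3).
  by rewrite !(h0 _).1 !(h0 _).2.
have X_nil := image_opX_nil (svalP X).
rewrite uE vE (jb_hom_deg_eq n2 X_nil hu0 hv0) ?(jb_hom_deg_eq n2 X_nil hu1 hv1) //;
  by move=> m' /key[].
Qed.

Lemma FE_full (X Y : obj CE) (g : hom (FE X) (FE Y)) : exists u : hom X Y, fmap FE u = g.
Proof.
have X_nil := image_opX_nil (svalP X).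
have [gL gG gA] := svalP g.
have gG' i v : sv_gr i v -> sv_gr (i (+) false) (sval g v) by rewrite addbF; exact: gG.
exists (exist _ _ (lift_map_deg X_nil gL gG' gA)); apply: sig_eq; apply: funext => v.
apply: subvs_inj; rewrite /= F_mapE; first exact: lift_map_res.
exact: (jb_hom_H (lift_map_deg X_nil gL gG' gA)).
Qed.

(** A morphism of [polyRep] ignores the grading, but its even and odd parts are lifted separately by
    [lift_map] and then added. *)
Lemma FA_full (X Y : obj CA) (g : hom (FA X) (FA Y)) : exists u : hom X Y, fmap FA u = g.
Proof.
have X_nil := image_opX_nil (svalP X).
have [gL gA] := svalP g.
pose g' := sval g : F_rep n2 (sval X) -> F_rep n2 (sval Y).
have dA d p v : deg_part g' d (spr_act p v) = spr_act p (deg_part g' d v).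
  have gE i w : grpart (sv_grP (F_rep n2 (sval Y))) i (g' (spr_act p w))
      = spr_act p (grpart (sv_grP (F_rep n2 (sval Y))) i (g' w)).
    by rewrite -grpart_act; congr grpart; exact: gA.
  rewrite /deg_part !grpart_act !gE.
  exact: esym (@actD K (polyRep_of (F_rep n2 (sval Y))) p _ _).
have gL' : linear g' by exact: gL.
pose gd d := lift_map X_nil d (deg_part g' d).
have lD d : jb_hom_deg d (gd d).
  by apply: lift_map_deg (@dA d); [exact: deg_part_linear|exact: deg_part_gr].
have uP : jb_hom (fun m => gd false m + gd true m) by exists (gd false), (gd true).
exists (exist _ _ uP); apply: sig_eq; apply: funext => v.
apply: subvs_inj; rewrite /= F_mapE; last exact: (jb_homH uP).
rewrite /gd !lift_map_res; try exact: deg_part_linear.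
by rewrite -[RHS](congr1 vsval (esym (deg_part_sum gL' v))) linearD.
Qed.

Lemma FE_surj (W : obj DE) : exists (X : obj CE) (u : hom (FE X) W) (v : hom W (FE X)),
  comp u v = idm W /\ comp v u = idm (FE X).
Proof.
case: W => [V V_nil]; exists (exist _ (modJ n2 V) (modJ_image V_nil)).
have uP : @spr_hom K (F_rep n2 (modJ n2 V)) V (@of_peirce K n2 V).
  by split; [exact: of_peirce_linear|exact: of_peirce_gr|exact: of_peirce_act].
have vP : @spr_hom K V (F_rep n2 (modJ n2 V)) (@to_peirce K n2 V).
  by split; [exact: to_peirce_linear|exact: to_peirce_gr|exact: to_peirce_act].
exists (exist _ _ uP), (exist _ _ vP); split; apply: sig_eq; apply: funext => x /=.
  exact: to_peirceK.
exact: of_peirceK.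
Qed.

(* The grading for which everything is even. *)
Let ev_gr (V : polyRep K) (i : bool) (v : V) : Prop := i -> v = 0.

Let ev_grP V : is_grading (@ev_gr V).
Proof.
split=> [i|i a u v hu hv i1|v|v _ h1]; [by []| | |exact: h1].
  by rewrite hu // hv // scaler0 addr0.
by exists v, 0; split=> //; rewrite addr0.
Qed.

Definition even_rep (V : polyRep K) : superPolyRep K.
Proof.
refine (@SuperPolyRep K (SuperVect (@ev_grP V)) (@pr_act K V) (pr_actP V) _).
by move=> i p v hv i1; rewrite (hv i1); exact: act0.
Defined.

(** An ungraded representation is placed in even degree before the model is built; [pr_hom] does not
    see this choice. *)
Lemma FA_surj (W : obj DA) : exists (X : obj CA) (u : hom (FA X) W) (v : hom W (FA X)),
  comp u v = idm W /\ comp v u = idm (FA X).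
Proof.
case: W => [V V_nil]; pose V' := even_rep V.
exists (exist _ (modJ n2 V') (modJ_image (V := V') V_nil)).
have uP : @pr_hom K (polyRep_of (F_rep n2 (modJ n2 V'))) V (@of_peirce K n2 V').
  by split; [exact: (@of_peirce_linear K n2 V')|exact: (@of_peirce_act K n2 V')].
have vP : @pr_hom K V (polyRep_of (F_rep n2 (modJ n2 V'))) (@to_peirce K n2 V').
  by split; [exact: (@to_peirce_linear K n2 V')|exact: (@to_peirce_act K n2 V')].
exists (exist _ _ uP), (exist _ _ vP); split; apply: sig_eq; apply: funext => x /=.
  exact: (@to_peirceK K n2 V').
exact: (@of_peirceK K n2 V').
Qed.

Theorem Jmod_equivalences : equivalent CE DE /\ equivalent CA DA.
Proof.
split.
  by apply: (@equivalent_ff _ _ FE); [exact: FE_faithful|exact: FE_full|exact: FE_surj].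
by apply: (@equivalent_ff _ _ FA); [exact: FA_faithful|exact: FA_full|exact: FA_surj].
Qed.
End Equivalence.

Theorem theorem6p17 (R : realType) (ghat : lieSuperalgebra R[i])
    (pi : ghat -> psl22 R[i]) (e f h : ghat)
    (ghat_universal : universal_central_extension pi)
    (efh_lift : sl2_lift pi e f h) :
  equivalent (Jmod1_0_even pi f h) (superPolyRep_nilp R[i]) /\
  equivalent (Jmod1_0 pi f h) (polyRep_nilp R[i]).
Proof.
have n2 : (2 : R[i]) != 0 by rewrite Num.Theory.pnatr_eq0.
exact (@Jmod_equivalences _ n2 _ pi e f h ghat_universal efh_lift).
Qed.
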